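(* The composition of the linear maps $S\mapsto\Xi$, $\Xi\mapsto\Sigma$ (this one being an action of $\mathbf{GL}_{n+1}(\mathbb{R})$, with $P\in\mathbf{GL}_{n+1}(\mathbb{R})$) and $\Sigma\mapsto\widetilde H$, described in the context, defines an action of the projective linear group $\mathbf{PGL}(n+1;\mathbb{R})$ over the space of $n\times n$ Divergence-free symmetric tensors. This action preserves positive semi-definiteness.
   Context: A tensor is a matrix-valued map (possibly with distributional entries) on an open domain; its divergence $\mathrm{Div}$ is taken row-wise, and it is Divergence-free if $\mathrm{Div}=0$. For vectors, $u\otimes v=uv^T$. Points of $\mathbb{R}^{1+n}$ are written $w=(\lambda,z)$ with $\lambda\in\mathbb{R}$, $z\in\mathbb{R}^n$. The three maps are the following, where $S$ is an $n\times n$ Divergence-free symmetric tensor on an open domain of $\mathbb{R}^n$ and $P\in\mathbf{GL}_{n+1}(\mathbb{R})$ (domains are transformed accordingly). 1. $S\mapsto\Xi$: $$\Xi(\lambda,z)=\lambda^{-n-1}\begin{pmatrix}0&0\\0&S\left(\frac z\lambda\right)\end{pmatrix},$$ a symmetric Divergence-free tensor in $n+1$ variables, homogeneous of degree $-n-1$. 2. $\Xi\mapsto\Sigma$: $$\Sigma(w)=(\det P)^{-1}\,|\det P|^{-\frac2{n+1}}\,P\,\Xi(P^{-1}w)\,P^T,$$ which is again symmetric, Divergence-free and homogeneous of degree $-n-1$. A homothety $P=aI_{n+1}$ yields $\Sigma=\Xi$. 3. $\Sigma\mapsto\widetilde H$: writing $$\Sigma(\lambda,z)=\lambda^{-n-1}\begin{pmatrix}h\left(\frac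 z\lambda\right)&Z\left(\frac z\lambda\right)^T\\ Z\left(\frac z\lambda\right)&H\left(\frac z\lambda\right)\end{pmatrix}$$ with $h$ scalar, $Z$ $\mathbb{R}^n$-valued and $H$ of size $n\times n$, set $$\widetilde H(x)=H(x)-x\otimes Z(x)-Z(x)\otimes x+h(x)\,x\otimes x .$$
   Formalization: Positive semi-definiteness is preserved only where det P·m(x)^{n+1}>0, m(x) the first coordinate of P^{-1}(1,x); where it is <0, −H̃ is PSD (n=1, S=1, P=diag(1,−1) gives H̃=−1). The action law P·(Q·S)=(PQ)·S holds on the domain left after dropping points Q sends to infinity. *)

(* Defs.v *)
From HB Require Import structures.
From mathcomp Require Import all_boot all_order all_algebra.
From mathcomp Require Import generic_quotient.
From mathcomp Require Import all_classical all_reals all_analysis.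

Set Implicit Arguments.
Unset Strict Implicit.
Unset Printing Implicit Defensive.

Import Order.TTheory GRing.Theory Num.Theory.
Import numFieldNormedType.Exports.

Local Open Scope classical_set_scope.
Local Open Scope ring_scope.

Record GL (R : realType) (m : nat) :=
  MkGL { glmx :> 'M[R]_m ; glmxP : glmx \in unitmx }.

HB.instance Definition _ (R : realType) (m : nat) :=
  [isSub of GL R m for @glmx R m].
HB.instance Definition _ (R : realType) (m : nat) :=
  [Choice of GL R m by <:].

Section GLGroup.
Context {R : realType} {m : nat}.
Implicit Types P Q : GL R m.

Definition gl_one : GL R m := MkGL (unitmx1 R m).

Fact gl_mul_subproof P Q : glmx P *m glmx Q \in unitmx.
Proof. by rewrite unitmx_mul !glmxP. Qed.
Definition gl_mul P Q : GL R m := MkGL (gl_mul_subproof P Q).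

Fact gl_inv_subproof P : invmx P \in unitmx.
Proof. by rewrite unitmx_inv glmxP. Qed.
Definition gl_inv P : GL R m := MkGL (gl_inv_subproof P).

Fact gl_mulA : associative gl_mul.
Proof. by move=> P Q S; apply: val_inj; rewrite /= mulmxA. Qed.
Fact gl_mul1 : left_id gl_one gl_mul.
Proof. by move=> P; apply: val_inj; rewrite /= mul1mx. Qed.
Fact gl_mulr1 : right_id gl_one gl_mul.
Proof. by move=> P; apply: val_inj; rewrite /= mulmx1. Qed.
Fact gl_mulV : left_inverse gl_one gl_inv gl_mul.
Proof. by move=> P; apply: val_inj; rewrite /= mulVmx ?glmxP. Qed.
Fact gl_mulrV : right_inverse gl_one gl_inv gl_mul.
Proof. by move=> P; apply: val_inj; rewrite /= mulmxV ?glmxP. Qed.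

HB.instance Definition _ := isGroup.Build (GL R m)
  gl_mulA gl_mul1 gl_mulr1 gl_mulV gl_mulrV.

Definition gl_proportional P Q : bool :=
  `[< exists2 a : R, a != 0 & glmx P = a *: glmx Q >].

Fact gl_proportional_equiv : equiv_class_of gl_proportional.
Proof.
have sym P Q : gl_proportional P Q -> gl_proportional Q P.
  move=> /asboolP[a a0 e]; apply/asboolP; exists a^-1; first by rewrite invr_eq0.
  by rewrite e scalerA mulVf ?scale1r.
split=> [P | P Q | Q P S].
- by apply/asboolP; exists 1; rewrite ?oner_eq0 // scale1r.
- by apply/idP/idP; apply: sym.
- move=> /asboolP[a a0 e] /asboolP[b b0 f]; apply/asboolP; exists (a * b).
    by rewrite mulf_eq0 negb_or a0.
  by rewrite e f scalerA.
Qed.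

Canonical gl_proportional_equiv_rel := EquivRelPack gl_proportional_equiv.

End GLGroup.

(* GL modulo the nonzero scalar matrices *)
Definition PGL (R : realType) (m : nat) := {eq_quot (@gl_proportional R m)}%qT.
HB.instance Definition _ (R : realType) (m : nat) := Choice.on (PGL R m).
HB.instance Definition _ (R : realType) (m : nat) := EqQuotient.on (PGL R m).

Definition pgl {R : realType} {m : nat} (P : GL R m) : PGL R m :=
  (\pi_(PGL R m) P)%qT.

Section PGLGroup.
Context {R : realType} {m : nat}.
Implicit Types P Q : GL R m.
Implicit Types g h : PGL R m.

Lemma pglP P Q :
  reflect (exists2 a : R, a != 0 & glmx P = a *: glmx Q)
          (pgl P == pgl Q).
Proof.
rewrite /pgl; apply: (iffP idP) => [/eqP/eqquotP/asboolP // | H].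
by apply/eqP/eqquotP/asboolP.
Qed.

Definition pgl_mul g h : PGL R m := pgl (repr g * repr h)%g.
Definition pgl_inv g : PGL R m := pgl (repr g)^-1%g.

Lemma pgl_repr g : pgl (repr g) = g.
Proof. exact: reprK. Qed.

Lemma pgl_mulE P Q : pgl_mul (pgl P) (pgl Q) = pgl (P * Q)%g.
Proof.
have [/eqP/pglP[a a0 e] /eqP/pglP[b b0 f]] :=
  (pgl_repr (pgl P), pgl_repr (pgl Q)).
apply/eqP/pglP; exists (a * b); first by rewrite mulf_eq0 negb_or a0.
by rewrite /= e f -scalemxAl -scalemxAr scalerA.
Qed.

Lemma pgl_invE P : pgl_inv (pgl P) = pgl P^-1%g.
Proof.
have /eqP/pglP[a a0 e] := pgl_repr (pgl P).
apply/eqP/pglP; exists a^-1; first by rewrite invr_eq0.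
by rewrite /= e invmxZ // unitmxZ ?unitfE // glmxP.
Qed.

Fact pgl_mulA : associative pgl_mul.
Proof.
move=> g h k; rewrite -(pgl_repr g) -(pgl_repr h) -(pgl_repr k).
by rewrite !pgl_mulE mulgA.
Qed.
Fact pgl_mul1 : left_id (pgl 1%g) pgl_mul.
Proof. by move=> g; rewrite -(pgl_repr g) pgl_mulE mul1g. Qed.
Fact pgl_mulr1 : right_id (pgl 1%g) pgl_mul.
Proof. by move=> g; rewrite -(pgl_repr g) pgl_mulE mulg1. Qed.
Fact pgl_mulV : left_inverse (pgl 1%g) pgl_inv pgl_mul.
Proof. by move=> g; rewrite -(pgl_repr g) pgl_invE pgl_mulE mulVg. Qed.
Fact pgl_mulrV : right_inverse (pgl 1%g) pgl_inv pgl_mul.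
Proof. by move=> g; rewrite -(pgl_repr g) pgl_invE pgl_mulE mulgV. Qed.

HB.instance Definition _ := isGroup.Build (PGL R m)
  pgl_mulA pgl_mul1 pgl_mulr1 pgl_mulV pgl_mulrV.

End PGLGroup.

Section Distributions.
Context {R : realType}.

(* iterated partial derivative d_(s_0) d_(s_1) ... f *)
Definition pder {m : nat} (s : seq 'I_m) (f : 'cV[R]_m -> R) : 'cV[R]_m -> R :=
  foldr (fun i (g : 'cV[R]_m -> R) x => 'D_(delta_mx i ord0) g x) f s.

Definition smooth {m : nat} (f : 'cV[R]_m -> R) : Prop :=
  forall (s : seq 'I_m) (x : 'cV[R]_m), differentiable (pder s f) x.

Definition vanishes_off {m : nat} (K : set 'cV[R]_m) (f : 'cV[R]_m -> R) :=
  forall x, ~ K x -> f x = 0.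

(* C_c^infty(U); its elements are extended by 0 to the whole of R^m *)
Definition test_fun {m : nat} (U : set 'cV[R]_m) (f : 'cV[R]_m -> R) : Prop :=
  smooth f /\ exists K, [/\ compact K, K `<=` U & vanishes_off K f].

(* A distribution on U is represented by a functional on all functions, of
   which only the values on [test_fun U] are meaningful: see [is_distr], [eq_distr]. *)
Definition functional (m : nat) : Type := ('cV[R]_m -> R) -> R.

Definition is_distr {m : nat} (U : set 'cV[R]_m) (u : functional m) : Prop :=
  (forall (a : R) (f g : 'cV[R]_m -> R), test_fun U f -> test_fun U g ->
     u (a *: f + g) = a * u f + u g) /\
  (forall K : set 'cV[R]_m, compact K -> K `<=` U ->
     exists (N : nat) (C : R), forall f, smooth f -> vanishes_off K f ->
       forall M : R,
         (forall s x, (size s <= N)%N -> `|pder s f x| <= M) ->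
         `|u f| <= C * M).

Definition eq_distr {m : nat} (U : set 'cV[R]_m) (u v : functional m) : Prop :=
  forall f, test_fun U f -> u f = v f.

Definition dpart {m : nat} (j : 'I_m) (u : functional m) : functional m :=
  fun f => - u (pder [:: j] f).

(* the product a u, for a function a that is smooth on the domain of u *)
Definition dmul {m : nat} (a : 'cV[R]_m -> R) (u : functional m)
    : functional m :=
  fun f => u (fun x => a x * f x).

(* u(A x), for A invertible: the change of variables y = A x *)
Definition dcomp_lin {m : nat} (A : 'M[R]_m) (u : functional m)
    : functional m :=
  fun f => `|\det A|^-1 * u (fun y => f (invmx A *m y)).

End Distributions.

Section Tensors.
Context {R : realType}.

Record tensor (m : nat) := Tensor {
  tdom : set 'cV[R]_m ;
  ent :> 'M[@functional R m]_m }.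

Definition eq_tensor {m : nat} (S T : tensor m) : Prop :=
  tdom S = tdom T /\ forall i j, eq_distr (tdom S) (S i j) (T i j).

Definition trestrict {m : nat} (U : set 'cV[R]_m) (S : tensor m) : tensor m :=
  Tensor U S.

(* a S + T, for S and T on the same domain *)
Definition tlin {m : nat} (a : R) (S T : tensor m) : tensor m :=
  Tensor (tdom S) (\matrix_(i, j) (a *: S i j + T i j)).

Definition topp {m : nat} (S : tensor m) : tensor m :=
  Tensor (tdom S) (\matrix_(i, j) - S i j).

Definition DivT {m : nat} (S : tensor m) : 'I_m -> functional m :=
  fun i => \sum_j dpart j (S i j).

Definition is_tensor {m : nat} (S : tensor m) : Prop :=
  open (tdom S) /\ forall i j, is_distr (tdom S) (S i j).

Definition symmetric_tensor {m : nat} (S : tensor m) : Prop :=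
  forall i j, eq_distr (tdom S) (S i j) (S j i).

Definition div_free {m : nat} (S : tensor m) : Prop :=
  forall i, eq_distr (tdom S) (DivT S i) 0.

Definition sym_div_free {m : nat} (S : tensor m) : Prop :=
  [/\ is_tensor S, symmetric_tensor S & div_free S].

Definition psdmx {m : nat} (A : 'M[R]_m) : Prop :=
  A^T = A /\ forall v : 'cV[R]_m, 0 <= (v^T *m A *m v) ord0 ord0.

(* Positive semi-definiteness by duality, as for nonnegative distributions:
   <S, F> = sum_ij <S_ij, F_ij> >= 0 for every test field F with values in the
   (self-dual) cone of positive semi-definite matrices.  For a continuous S this
   says that S(x) is positive semi-definite at every point x. *)
Definition psd {m : nat} (S : tensor m) : Prop :=
  forall F : 'cV[R]_m -> 'M[R]_m,
    (forall i j, test_fun (tdom S) (fun x => F x i j)) ->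
    (forall x, psdmx (F x)) ->
    0 <= \sum_i \sum_j S i j (fun x => F x i j).

(* Homogeneity of integer degree -d; both positive and negative dilations are
   meant, as lambda ranges over all nonzero reals in the formulas below. *)
Definition thomogeneous {m : nat} (d : nat) (X : tensor m) : Prop :=
  forall a : R, a != 0 ->
    (forall w, tdom X w -> tdom X (a *: w)) /\
    (forall i j,
       eq_distr (tdom X) (dcomp_lin a%:M (X i j)) ((a ^- d) *: X i j)).

Definition pt {n : nat} (l : R) (z : 'cV[R]_n) : 'cV[R]_(1 + n) :=
  col_mx l%:M z.

Definition lam {n : nat} (w : 'cV[R]_(1 + n)) : R := w ord0 ord0.

Definition affine_part {n : nat} (w : 'cV[R]_(1 + n)) : 'cV[R]_n :=
  (lam w)^-1 *: dsubmx w.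

Definition cone_over {n : nat} (U : set 'cV[R]_n) : set 'cV[R]_(1 + n) :=
  [set w | lam w != 0 /\ U (affine_part w)].

(* u(z / lambda), a distribution on [cone_over U] when u is one on U: formally,
   int int u(z / l) f(l, z) dz dl = int |l|^n (int u(x) f(l, l x) dx) dl *)
Definition dcomp_proj {n : nat} (u : @functional R n)
    : @functional R (1 + n) :=
  fun f => Rintegral lebesgue_measure setT
    (fun l : R => `|l| ^+ n * u (fun x => f (pt l (l *: x)))).

(* lambda^(-n-1) u(z / lambda) *)
Definition dlift {n : nat} (u : @functional R n) : @functional R (1 + n) :=
  dmul (fun w => lam w ^- n.+1) (dcomp_proj u).

Definition Xi {n : nat} (S : tensor n) : tensor (1 + n) :=
  Tensor (cone_over (tdom S))
    (block_mx 0 0 0 (\matrix_(i, j) dlift (S i j))).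

(* symmetric Divergence-free tensors in 1 + n variables, homogeneous of degree
   -n-1: the common target of S |-> Xi and of Xi |-> Sigma *)
Definition hom_sym_div_free {n : nat} (X : tensor (1 + n)) : Prop :=
  sym_div_free X /\ thomogeneous n.+1 X.

Definition Sigma {n : nat} (P : 'M[R]_(1 + n)) (X : tensor (1 + n))
    : tensor (1 + n) :=
  Tensor [set w | tdom X (invmx P *m w)]
    (\matrix_(i, j)
       (((\det P)^-1 * `|\det P| `^ (- 2 / n.+1%:R)) *:
        (\sum_k \sum_l (P i k * P j l) *: dcomp_lin (invmx P) (X k l)))).

(* T is (a representative of) the tensor \tilde H obtained from X = Sigma.
   The decomposition of X is required away from lambda = 0, that is on
   [cone_over (tdom T)], which is [tdom X `&` [set w | lam w != 0]] as soon as
   [tdom X] is stable under nonzero dilations. *)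
Definition Htilde {n : nat} (X : tensor (1 + n)) (T : tensor n) : Prop :=
  tdom T = [set x | tdom X (pt 1 x)] /\
  exists (h : @functional R n) (Z : 'cV[@functional R n]_n)
         (H : 'M[@functional R n]_n),
    [/\ is_distr (tdom T) h,
        forall i, is_distr (tdom T) (Z i ord0),
        forall i j, is_distr (tdom T) (H i j),
        forall i j, eq_distr (cone_over (tdom T)) (X i j)
          (dlift (block_mx (const_mx h) Z^T Z H i j)) &
        forall i j : 'I_n, eq_distr (tdom T) (T i j)
          (H i j - dmul (fun x => x i ord0) (Z j ord0)
                 - dmul (fun x => x j ord0) (Z i ord0)
                 + dmul (fun x => x i ord0 * x j ord0) h)].

Definition composition {n : nat} (P : 'M[R]_(1 + n)) (S T : tensor n) : Prop :=
  Htilde (Sigma P (Xi S)) T.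

(* the points x whose preimage under the projective map of P is not at infinity *)
Definition not_from_infinity {n : nat} (P : 'M[R]_(1 + n)) : set 'cV[R]_n :=
  [set x | lam (invmx P *m pt 1 x) != 0].

(* \tilde H(x) is this number times a product of a positive number and a matrix
   of the form A S(y) A^T.  It only depends on the class of P in PGL. *)
Definition orientation {n : nat} (P : 'M[R]_(1 + n)) (x : 'cV[R]_n) : R :=
  \det P * lam (invmx P *m pt 1 x) ^+ n.+1.

End Tensors.

Arguments tensor R m : clear implicits.

(* Main.v *)
Require Import Defs.
From HB Require Import structures.
From mathcomp Require Import all_boot all_order all_algebra.
From mathcomp Require Import all_classical all_reals all_analysis.
From mathcomp Require Import ring lra.

Set Implicit Arguments.
Unset Strict Implicit.
Unset Printing Implicit Defensive.

Import Order.TTheory GRing.Theory Num.Theory.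
Import numFieldNormedType.Exports.

Local Open Scope classical_set_scope.
Local Open Scope ring_scope.

(** A homogeneous distribution of degree -n-1 on a cone [cone_over U] is the
lift of a unique distribution on U.  Writing [m(l) = |l|^n l^(-n-1)], one has
[dlift u f = u (x |-> int m(l) f(l, l x) dl)]: a distribution commutes with the
integral over the fibers, because [t |-> u (int_(l <= t) F(l, .) dl)] has
derivative [u (F(t, .))].  Conversely, fix [rho] supported in [[1, 2]] with
integral 1, and let [s phi (l, z) = l rho(l) phi(z / l)], a right inverse of the
fiber integration.  If v is homogeneous and [u = v o s], then [dlift u = v]:
with w = (l, z), by homogeneity on each slice and the substitution a = l / b,
[dlift u f = int v (w |-> |b|^-1 (l/b) rho(l/b) f(b, b z/l)) db
 = v (w |-> int rho(a) f(w / a) da) = int rho(a) v (f( . / a)) da = v f].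

Testing the composition on [s phi] gives the closed formula
[T_ij(phi) = sum_kl S_kl (c sg(nu)^(n+1) A_ik A_jl (phi o p))], where p is the
projective map of P, nu its denominator, A = nu dp and
c = sg(det P) |det P|^(-2/(n+1)).  The action laws then reduce to the chain rule
for A, and positivity to the congruence [F |-> A^T (F o p) A].  The divergence
of T vanishes by testing Div X = 0 on [l s phi]. *)

Arguments pder : simpl never.

(** A [functional] is constrained only on test functions, so linearity, continuity and [eq_distr]
    can be used only once the arguments are known to be test functions. Nearly every change of
    variables is therefore put in the form f |-> a (f o q), and one properness condition on the pair
    (a, q) yields both the control of supports and the continuity estimate. Signs are the second
    obstacle. A dilation by a multiplies a homogeneous v by |a|^(n+1) a^(-n-1) = sg(a)^(n+1), which
    is the source of sg(nu)^(n+1) and the reason why positivity holds only up to the sign of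
    [orientation]. The exponent -2/(n+1) is the one for which a scalar matrix a I contributes a^(-2)
    to c, against the a^2 coming from the two factors A; the signs left over cancel between det P
    and nu. Finally, projective maps are partial. The coefficient sg(nu)^(n+1) is 0 where nu
    vanishes, so points sent to infinity drop out of the closed formula, and two successive actions
    give only a restriction of the action of the product. *)

Lemma pder_cons (R : realType) (m : nat) (i : 'I_m) s (f : 'cV[R]_m -> R) x :
  pder (i :: s) f x = 'D_(delta_mx i ord0) (pder s f) x.
Proof. by []. Qed.

(** Differentiability in epsilon form, for the places where the differential is guessed and the
    remainder estimated: germs of functions, fiber integrals, one-variable primitives. *)
Lemma diff_epsP (R : realType) (V W : normedModType R) (f : V -> W) (x : V)
    (L : {linear V -> W}) : continuous L ->
  (forall e : R, 0 < e -> \forall h \near (0 : V),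
     `|f (h + x) - f x - L h| <= e * `|h|) ->
  differentiable f x /\ 'd f x = L :> (V -> W).
Proof.
move=> Lc H.
have E : f \o shift x = cst (f x) + L +o_ (0 : V) id.
  apply/eqaddoP => _/posnumP[e].
  near=> h; rewrite /= ![(_ + _) _]/=.
  rewrite /cst /= opprD addrA; near: h; exact: H.
by split; [apply/diff_locallyP; split|]; rewrite (diff_unique Lc E).
Unshelve. all: by end_near. Qed.

Lemma diff_eps (R : realType) (V W : normedModType R) (f : V -> W) (x : V) :
  differentiable f x -> forall e : R, 0 < e -> \forall h \near (0 : V),
     `|f (h + x) - f x - 'd f x h| <= e * `|h|.
Proof.
move=> /diff_locally /eqaddoP H e e0.
have := H _ e0; apply: filterS => h.
by rewrite /= ![(_ + _) _]/= /cst /= opprD addrA.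
Qed.

Lemma differentiable_near (R : realType) (V W : normedModType R)
    (f g : V -> W) (x : V) :
  (\forall y \near x, f y = g y) -> differentiable f x -> differentiable g x.
Proof.
move=> fg df; apply: (proj1 (@diff_epsP _ _ _ _ _ ('d f x) _ _)).
  exact: diff_continuous.
move=> e e0; have fgx : f x = g x by exact: nbhs_singleton fg.
have fg0 : \forall h \near (0 : V), f (h + x) = g (h + x).
  by move: fg; rewrite (near_shift 0 x)/= subr0.
near=> h.
rewrite -fgx -(near fg0 h) //; near: h; exact: diff_eps.
Unshelve. all: by end_near. Qed.

(** * Smooth functions *)

Section Smooth.
Context {R : realType}.

Definition smooth_on {m : nat} (U : set 'cV[R]_m) (f : 'cV[R]_m -> R) : Prop :=
  forall (s : seq 'I_m) (x : 'cV[R]_m), U x -> differentiable (pder s f) x.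

(** Counting the order lets smoothness be proved by induction: the Leibniz and chain rules express a
    first partial through functions that are one order less smooth. *)
Definition smooth_upto {m : nat} k (U : set 'cV[R]_m) (f : 'cV[R]_m -> R) :=
  forall (s : seq 'I_m) (x : 'cV[R]_m), (size s <= k)%N -> U x ->
    differentiable (pder s f) x.

Section One.
Context {m : nat}.
Implicit Types (f g : 'cV[R]_m -> R) (U : set 'cV[R]_m) (s : seq 'I_m) (x y : 'cV[R]_m).

Lemma pder_rcons s i f : pder (rcons s i) f = pder s (pder [:: i] f).
Proof. by rewrite /pder foldr_rcons. Qed.

Lemma pder_cat s t f : pder (s ++ t) f = pder s (pder t f).
Proof. by rewrite /pder foldr_cat. Qed.

Lemma near_pder s f g (x : 'cV[R]_m) : (\forall y \near x, f y = g y) ->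
  \forall y \near x, pder s f y = pder s g y.
Proof.
move=> fg; elim: s => // i s IH.
move/near_join: IH; apply: filterS => y; rewrite !pder_cons; exact: near_eq_derive.
Qed.

Lemma eq_on_pder U s f g : open U -> (forall x, U x -> f x = g x) ->
  forall x, U x -> pder s f x = pder s g x.
Proof.
move=> oU fg x Ux.
apply: (@nbhs_singleton _ x (fun y => pder s f y = pder s g y)).
apply: near_pder.
by apply: filterS (open_nbhs_nbhs (conj oU Ux)) => y; exact: fg.
Qed.

Lemma smooth_onE U f : smooth_on U f <-> forall k, smooth_upto k U f.
Proof. by split=> [H k s x _|H s x]; [exact: H|exact: (H (size s))]. Qed.

Lemma smooth_onT f : smooth f <-> smooth_on setT f.
Proof. by split=> [H s x _|H s x]; exact: H. Qed.

Lemma eq_smooth_upto k U f g : open U -> (forall x, U x -> f x = g x) ->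
  smooth_upto k U f -> smooth_upto k U g.
Proof.
move=> oU fg sf s x sk Ux; apply: differentiable_near (sf s x sk Ux).
apply: near_pder.
by apply: filterS (open_nbhs_nbhs (conj oU Ux)) => y; exact: fg.
Qed.

(** The derivative split off is the innermost one, so it acts on f itself, where the explicit
    first-order rules apply. *)
Lemma smooth_uptoS k U f : smooth_upto k.+1 U f <->
  (forall x, U x -> differentiable f x) /\
  (forall i, smooth_upto k U (pder [:: i] f)).
Proof.
split=> [H|[H0 H1] s x].
  split=> [x Ux|i s x sk Ux]; first exact: (H [::] x).
  by rewrite -pder_rcons; apply: H => //; rewrite size_rcons.
case/lastP: s => [_|s i]; first exact: H0.
by rewrite size_rcons ltnS pder_rcons; exact: H1.
Qed.

Lemma smooth_upto0 U f :
  smooth_upto 0 U f <-> (forall x, U x -> differentiable f x).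
Proof.
split=> [H x|H s x]; first exact: (H [::] x).
by rewrite leqn0 size_eq0 => /eqP ->; exact: H.
Qed.

Lemma smooth_uptoW k U f : smooth_upto k.+1 U f -> smooth_upto k U f.
Proof. by move=> H s x sk; apply: H; exact: leq_trans sk _. Qed.

Lemma smooth_on_diff U f x : smooth_on U f -> U x -> differentiable f x.
Proof. by move=> /(_ [::] x); exact. Qed.

Lemma smooth_on_pder U s f : smooth_on U f -> smooth_on U (pder s f).
Proof. by move=> H t x Ux; rewrite -pder_cat; exact: H. Qed.

Lemma eq_smooth_on U f g : open U -> (forall x, U x -> f x = g x) ->
  smooth_on U f -> smooth_on U g.
Proof.
by move=> oU fg /smooth_onE H; apply/smooth_onE => k; exact: eq_smooth_upto (H k).
Qed.

Lemma smooth_onS U U' f : U' `<=` U -> smooth_on U f -> smooth_on U' f.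
Proof. by move=> UU H s x /UU; exact: H. Qed.

Lemma smooth_onU U U' f : smooth_on U f -> smooth_on U' f ->
  smooth_on (U `|` U') f.
Proof. by move=> H H' s x [] Ux; [exact: H|exact: H']. Qed.

Lemma dE f i x : differentiable f x ->
  pder [:: i] f x = 'd f x (delta_mx i ord0).
Proof. exact: deriveE. Qed.

Lemma pder1_cst (c : R) i x : pder [:: i] (fun=> c) x = 0.
Proof. exact: derive_cst. Qed.

Lemma pder1D f g i x : differentiable f x -> differentiable g x ->
  pder [:: i] (fun y => f y + g y) x = pder [:: i] f x + pder [:: i] g x.
Proof. by move=> df dg; rewrite /pder /= deriveD //; exact: diff_derivable. Qed.

Lemma pder1M f g i x : differentiable f x -> differentiable g x ->
  pder [:: i] (fun y => f y * g y) x =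
  pder [:: i] f x * g x + f x * pder [:: i] g x.
Proof.
move=> df dg; rewrite /pder /= deriveM //; try exact: diff_derivable.
by rewrite addrC /GRing.scale /= [g x * _]mulrC.
Qed.

Lemma smooth_upto_cst k U (c : R) : smooth_upto k U (fun=> c).
Proof.
move=> s x _ _; suff [d ->] : exists d : R, pder s (fun=> c) = (fun=> d).
  exact: differentiable_cst.
elim: s => [|i s [d IH]]; first by exists c.
by exists 0; apply/funext => y; rewrite pder_cons IH derive_cst.
Qed.

Lemma smooth_on_cst U (c : R) : smooth_on U (fun=> c).
Proof. by apply/smooth_onE => k; exact: smooth_upto_cst. Qed.

Lemma pder_cst0 s x : pder s (fun=> 0 : R) x = 0 :> R.
Proof.
elim: s x => // i s IH x; rewrite pder_cons.
have -> : pder s (fun=> 0 : R) = (fun=> 0) by apply/funext.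
exact: derive_cst.
Qed.

Lemma smooth_uptoD k U f g : open U ->
  smooth_upto k U f -> smooth_upto k U g -> smooth_upto k U (fun x => f x + g x).
Proof.
move=> oU; elim: k f g => [|k IH] f g.
  move=> /smooth_upto0 df /smooth_upto0 dg; apply/smooth_upto0 => x Ux.
  by apply: differentiableD; [exact: df|exact: dg].
move=> /smooth_uptoS[df Df] /smooth_uptoS[dg Dg]; apply/smooth_uptoS.
split=> [x Ux|i]; first by apply: differentiableD; [exact: df|exact: dg].
apply: eq_smooth_upto (IH _ _ (Df i) (Dg i)) => // x Ux.
by rewrite pder1D //; [exact: df|exact: dg].
Qed.

Lemma smooth_uptoM k U f g : open U ->
  smooth_upto k U f -> smooth_upto k U g -> smooth_upto k U (fun x => f x * g x).
Proof.
move=> oU; elim: k f g => [|k IH] f g.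
  move=> /smooth_upto0 df /smooth_upto0 dg; apply/smooth_upto0 => x Ux.
  by apply: differentiableM; [exact: df|exact: dg].
move=> sf sg; have /smooth_uptoS[df Df] := sf; have /smooth_uptoS[dg Dg] := sg.
apply/smooth_uptoS.
split=> [x Ux|i]; first by apply: differentiableM; [exact: df|exact: dg].
have := smooth_uptoD oU (IH _ _ (Df i) (smooth_uptoW sg))
  (IH _ _ (smooth_uptoW sf) (Dg i)).
apply: eq_smooth_upto => // x Ux.
by rewrite pder1M //; [exact: df|exact: dg].
Qed.

Lemma smooth_onD U f g : open U ->
  smooth_on U f -> smooth_on U g -> smooth_on U (fun x => f x + g x).
Proof.
move=> oU /smooth_onE sf /smooth_onE sg; apply/smooth_onE => k.
exact: smooth_uptoD.
Qed.

Lemma smooth_onM U f g : open U ->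
  smooth_on U f -> smooth_on U g -> smooth_on U (fun x => f x * g x).
Proof.
move=> oU /smooth_onE sf /smooth_onE sg; apply/smooth_onE => k.
exact: smooth_uptoM.
Qed.

Lemma smooth_onN U f : open U -> smooth_on U f -> smooth_on U (fun x => - f x).
Proof.
move=> oU sf; have := smooth_onM oU (@smooth_on_cst U (-1)) sf.
by apply: eq_smooth_on => // x _; rewrite mulN1r.
Qed.

Lemma smooth_on_sum U (I : Type) (r : seq I) (f : I -> 'cV[R]_m -> R) : open U ->
  (forall i, smooth_on U (f i)) -> smooth_on U (fun x => \sum_(i <- r) f i x).
Proof.
move=> oU sf; elim: r => [|i r IH].
  apply: eq_smooth_on (@smooth_on_cst U (0)) => // x _; by rewrite big_nil.
apply: eq_smooth_on (smooth_onD oU (sf i) IH) => // x _; by rewrite big_cons.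
Qed.

Lemma smooth_onX U f j : open U ->
  smooth_on U f -> smooth_on U (fun x => f x ^+ j).
Proof.
move=> oU sf; elim: j => [|j IH].
  by apply: eq_smooth_on (@smooth_on_cst U (1)) => // x _; rewrite expr0.
by apply: eq_smooth_on (smooth_onM oU sf IH) => // x _; rewrite exprS.
Qed.

Lemma pder1V f i x : differentiable f x -> f x != 0 ->
  pder [:: i] (fun y => (f y)^-1) x = - pder [:: i] f x * ((f x)^-1 * (f x)^-1).
Proof.
move=> df fx0; rewrite /pder /=.
rewrite deriveV //; last exact: diff_derivable.
by rewrite /GRing.scale /= -exprVn expr2 mulrC mulrN mulNr.
Qed.

(** The derivative of 1/f is -f' (1/f)^2, so order k for 1/f gives order k + 1. *)
Lemma smooth_onV U f : open U -> (forall x, U x -> f x != 0) ->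
  smooth_on U f -> smooth_on U (fun x => (f x)^-1).
Proof.
move=> oU f0 sf; apply/smooth_onE; elim=> [|k IH].
  apply/smooth_upto0 => x Ux; apply: differentiableV; last exact: f0.
  exact: smooth_on_diff Ux.
apply/smooth_uptoS; split=> [x Ux|i].
  apply: differentiableV; last exact: f0.
  exact: smooth_on_diff Ux.
have := smooth_onN oU (smooth_on_pder [:: i] sf).
move=> /smooth_onE/(_ k) H; have := smooth_uptoM oU H (smooth_uptoM oU IH IH).
apply: eq_smooth_upto => // x Ux.
by rewrite pder1V //; [exact: smooth_on_diff Ux|exact: f0].
Qed.

Lemma pder1_coord (i j : 'I_m) x :
  pder [:: i] (fun y : 'cV[R]_m => y j ord0) x = (j == i)%:R.
Proof.
have := @derive_mx R 'cV[R]_m m 1 id x (delta_mx i ord0) (@derivable_id _ _ _ _).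
by rewrite derive_id => /matrixP/(_ j ord0); rewrite !mxE eqxx andbT.
Qed.

Lemma smooth_on_coord U (j : 'I_m) : open U ->
  smooth_on U (fun y : 'cV[R]_m => y j ord0).
Proof.
move=> oU; apply/smooth_onE; case=> [|k].
  by apply/smooth_upto0 => x _; exact: differentiable_coord.
apply/smooth_uptoS; split=> [x _|i]; first exact: differentiable_coord.
have := @smooth_upto_cst k U (j == i)%:R; apply: eq_smooth_upto => // x _.
by rewrite pder1_coord.
Qed.

End One.

Lemma col_delta_sum {m : nat} (x : 'cV[R]_m) :
  x = \sum_(j < m) x j ord0 *: delta_mx j ord0.
Proof.
by rewrite {1}(matrix_sum_delta x); apply: eq_bigr => i _; rewrite big_ord1.
Qed.

Section Comp.
Context {m p : nat}.
Implicit Types (f : 'cV[R]_p -> R) (q : 'cV[R]_m -> 'cV[R]_p).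

Definition smooth_map (U : set 'cV[R]_m) q :=
  forall j, smooth_on U (fun x => q x j ord0).

Lemma differentiable_col q x :
  (forall j, differentiable (fun y => q y j ord0) x) -> differentiable q x.
Proof.
move=> dq.
have -> : q = \sum_(j < p) (fun y => q y j ord0 *: (delta_mx j ord0 : 'cV[R]_p)).
  by apply/funext => y; rewrite {1}(col_delta_sum (q y)) fct_sumE.
by apply: differentiable_sum => j; exact: differentiableZl.
Qed.

Lemma diff_col q x v j : (forall j, differentiable (fun y => q y j ord0) x) ->
  'd q x v j ord0 = 'd (fun y => q y j ord0) x v.
Proof.
move=> dq; have dqx := differentiable_col dq.
rewrite -deriveE // -deriveE //.
by rewrite derive_mx ?mxE //; exact: diff_derivable.
Qed.

Lemma pder1_comp f q i (x : 'cV[R]_m) :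
  (forall j, differentiable (fun y => q y j ord0) x) -> differentiable f (q x) ->
  pder [:: i] (fun y => f (q y)) x =
  \sum_j pder [:: i] (fun y => q y j ord0) x * pder [:: j] f (q x).
Proof.
move=> dq df; have dqx := differentiable_col dq.
rewrite dE; last exact: differentiable_comp.
rewrite -[fun y => f (q y)]/(f \o q) diff_comp //= (col_delta_sum ('d q x _)) linear_sum /=.
apply: eq_bigr => j _; rewrite linearZ /= diff_col // dE //.
by rewrite dE.
Qed.

(** The induction on the order has f general, since the chain rule replaces f by its partials, while
    the factors coming from q are smooth to every order. *)
Lemma smooth_on_comp (U : set 'cV[R]_m) (V : set 'cV[R]_p) f q :
  open U -> smooth_map U q -> (forall x, U x -> V (q x)) ->
  smooth_on V f -> smooth_on U (fun x => f (q x)).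
Proof.
move=> oU sq qUV sf; apply/smooth_onE => k.
have dq x : U x -> forall j, differentiable (fun y => q y j ord0) x.
  by move=> Ux j; exact: smooth_on_diff (sq j) Ux.
elim: k f sf => [|k IH] f sf.
  apply/smooth_upto0 => x Ux.
  apply: (@differentiable_comp _ _ _ _ q f).
    by apply: differentiable_col; exact: dq.
  by apply: smooth_on_diff sf _; exact: qUV.
apply/smooth_uptoS; split=> [x Ux|i].
  apply: (@differentiable_comp _ _ _ _ q f).
    by apply: differentiable_col; exact: dq.
  by apply: smooth_on_diff sf _; exact: qUV.
have H x : U x -> \sum_j pder [:: i] (fun y => q y j ord0) x *
    pder [:: j] f (q x) = pder [:: i] (fun y => f (q y)) x.
  move=> Ux; rewrite pder1_comp //; first exact: dq.
  by apply: smooth_on_diff sf _; exact: qUV.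
apply: eq_smooth_upto H _ => //.
elim: (index_enum _) => [|j r IHr].
  by apply: eq_smooth_upto (@smooth_upto_cst _ k U 0) => // x _; rewrite big_nil.
have sj : smooth_upto k U (pder [:: i] (fun y => q y j ord0)).
  by move: (smooth_on_pder [:: i] (sq j)) => /smooth_onE; exact.
have := smooth_uptoD oU (smooth_uptoM oU sj (IH _ (smooth_on_pder [:: j] sf))) IHr.
by apply: eq_smooth_upto => // x _; rewrite big_cons.
Qed.

Lemma smooth_map_continuous U q x : smooth_map U q -> U x ->
  {for x, continuous q}.
Proof.
move=> sq Ux; apply: differentiable_continuous.
by apply: differentiable_col => j; exact: smooth_on_diff (sq j) Ux.
Qed.

Lemma compact_smooth_image (U K : set 'cV[R]_m) q :
  compact K -> K `<=` U -> smooth_map U q -> compact (q @` K).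
Proof.
move=> cK KU sq; apply: continuous_compact => //.
apply: continuous_in_subspaceT => x; rewrite inE => Kx.
exact: smooth_map_continuous sq (KU _ Kx).
Qed.

End Comp.

Lemma smooth_on_bounded {m : nat} (U K : set 'cV[R]_m) (f : 'cV[R]_m -> R) :
  compact K -> K `<=` U -> smooth_on U f ->
  exists2 C : R, 0 <= C & forall x, K x -> `|f x| <= C.
Proof.
move=> cK KU sf.
have /compact_bounded [M [Mr HM]] : compact (f @` K).
  apply: continuous_compact => //.
  apply: continuous_in_subspaceT => x; rewrite inE => Kx.
  by apply: differentiable_continuous; exact: smooth_on_diff sf (KU _ Kx).
exists (`|M| + 1); first by rewrite addr_ge0.
move=> x Kx; apply: (HM (`|M| + 1)); last by exists x.
by rewrite (le_lt_trans (ler_norm M)) // ltrDl.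
Qed.

End Smooth.

(** * Test functions and distributions *)

Section TestFunctions.
Context {R : realType}.

Section One.
Context {m : nat}.
Implicit Types (f g : 'cV[R]_m -> R) (U V K : set 'cV[R]_m) (s : seq 'I_m)
  (x y : 'cV[R]_m) (u v : @functional R m).

Lemma pderD U s f g x : open U -> smooth_on U f -> smooth_on U g -> U x ->
  pder s (fun y => f y + g y) x = pder s f x + pder s g x.
Proof.
move=> oU; elim/last_ind: s f g => // s i IH f g sf sg Ux; rewrite !pder_rcons.
rewrite -IH //; try exact: smooth_on_pder.
apply: (eq_on_pder _ oU) Ux => y Uy.
by rewrite pder1D //; exact: smooth_on_diff Uy.
Qed.

Lemma pder_sum U s (I : Type) (r : seq I) (F : I -> 'cV[R]_m -> R) x :
  open U -> (forall i, smooth_on U (F i)) -> U x ->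
  pder s (fun y => \sum_(i <- r) F i y) x = \sum_(i <- r) pder s (F i) x.
Proof.
move=> oU sF Ux; elim: r => [|i r IH].
  rewrite big_nil; under [fun _ => _]funext do rewrite big_nil.
  exact: pder_cst0.
rewrite big_cons; under [fun _ => _]funext do rewrite big_cons.
by rewrite (@pderD U) ?IH //; exact: smooth_on_sum.
Qed.

Lemma pderZ U s (c : R) f x : open U -> smooth_on U f -> U x ->
  pder s (fun y => c * f y) x = c * pder s f x.
Proof.
move=> oU; elim/last_ind: s f => // s i IH f sf Ux; rewrite !pder_rcons.
rewrite -IH //; last exact: smooth_on_pder.
apply: (eq_on_pder _ oU) Ux => y Uy.
rewrite pder1M //; last exact: smooth_on_diff Uy.
by rewrite pder1_cst mul0r add0r.
Qed.

Lemma vanishes_off_pder K s f : closed K -> vanishes_off K f ->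
  vanishes_off K (pder s f).
Proof.
move=> cK vf x Kx; rewrite -(pder_cst0 s x).
apply: (@eq_on_pder _ _ (~` K)) => //; exact: closed_openC.
Qed.

Lemma col_compact_closed K : compact K -> closed K.
Proof. by apply: compact_closed; exact: norm_hausdorff. Qed.

(** The open sets U and the complement of K cover the space, and f is zero on the second. *)
Lemma smooth_glue U K f : open U -> compact K -> K `<=` U -> smooth_on U f ->
  vanishes_off K f -> smooth f.
Proof.
move=> oU cK KU sf vf; apply/smooth_onT.
have oK : open (~` K) by apply: closed_openC; exact: col_compact_closed.
have s0 : smooth_on (~` K) f.
  by apply: eq_smooth_on (@smooth_on_cst _ _ _ 0) => // x Kx; rewrite vf.
apply: smooth_onS (smooth_onU sf s0) => x _.
by have [/KU|] := pselect (K x); [left|right].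
Qed.

Lemma test_smooth U f : test_fun U f -> smooth f.
Proof. by case. Qed.

Lemma test_funS U V f : U `<=` V -> test_fun U f -> test_fun V f.
Proof.
move=> UV [sf [K [cK KU vf]]]; split=> //; exists K; split=> //.
exact: subset_trans UV.
Qed.

Lemma test_fun_off U f x : test_fun U f -> ~ U x -> f x = 0.
Proof. by move=> [_ [K [_ KU vf]]] Ux; apply: vf => /KU. Qed.

Lemma test_funD U f g : test_fun U f -> test_fun U g ->
  test_fun U (fun x => f x + g x).
Proof.
move=> [sf [K [cK KU vf]]] [sg [L [cL LU vg]]]; split.
  by apply/smooth_onT; apply: smooth_onD; [exact: openT|exact/smooth_onT..].
exists (K `|` L); split; first exact: compactU.
  by move=> x [/KU|/LU].
by move=> x /not_orP[Kx Lx]; rewrite vf // vg // addr0.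
Qed.

Lemma test_funM U a f : open U -> smooth_on U a -> test_fun U f ->
  test_fun U (fun x => a x * f x).
Proof.
move=> oU sa [sf [K [cK KU vf]]].
have v : vanishes_off K (fun x => a x * f x).
  by move=> x Kx; rewrite vf // mulr0.
split; last by exists K.
apply: (smooth_glue oU cK KU _ v); apply: smooth_onM => //.
Qed.

Lemma test_funZ U c f : test_fun U f -> test_fun U (fun x => c * f x).
Proof.
move=> [sf [K [cK KU vf]]]; split; last first.
  by exists K; split=> // x Kx; rewrite vf // mulr0.
apply/smooth_onT; apply: smooth_onM; [exact: openT|exact: smooth_on_cst|].
exact/smooth_onT.
Qed.

Lemma test_fun0 U : test_fun U (fun=> 0).
Proof.
split; first by apply/smooth_onT; exact: smooth_on_cst.
by exists set0; split=> //; exact: compact0.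
Qed.

Lemma test_fun_sum U (I : Type) (r : seq I) (F : I -> 'cV[R]_m -> R) :
  (forall i, test_fun U (F i)) -> test_fun U (fun x => \sum_(i <- r) F i x).
Proof.
move=> tF; elim: r => [|i r IH].
  by under [fun _ => _]funext do rewrite big_nil; exact: test_fun0.
by under [fun _ => _]funext do rewrite big_cons; exact: test_funD.
Qed.

Lemma test_fun_pder U s f : test_fun U f -> test_fun U (pder s f).
Proof.
move=> [sf [K [cK KU vf]]]; split.
  by apply/smooth_onT; apply: smooth_on_pder; exact/smooth_onT.
exists K; split=> //; apply: vanishes_off_pder => //.
exact: col_compact_closed.
Qed.

Lemma distrD U u f g : is_distr U u -> test_fun U f -> test_fun U g ->
  u (fun x => f x + g x) = u f + u g.
Proof.
move=> [lu _] tf tg; rewrite -[u f]mul1r -lu //; congr u.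
by apply/funext => x; rewrite scale1r.
Qed.

Lemma distr0 U u : is_distr U u -> u (fun=> 0) = 0.
Proof.
move=> du; have := distrD du (test_fun0 U) (test_fun0 U).
under [fun _ => _]funext do rewrite addr0.
by move/eqP; rewrite -subr_eq subrr eq_sym => /eqP.
Qed.

Lemma distrZ U u c f : is_distr U u -> test_fun U f ->
  u (fun x => c * f x) = c * u f.
Proof.
move=> du tf; transitivity (u (c *: f + (fun=> 0))).
  by congr u; apply/funext => x; rewrite [RHS]addr0.
by rewrite du.1 //; [rewrite (distr0 du); exact: addr0|exact: test_fun0].
Qed.

Lemma distr_sum U u (I : Type) (r : seq I) (F : I -> 'cV[R]_m -> R) :
  is_distr U u -> (forall i, test_fun U (F i)) ->
  u (fun x => \sum_(i <- r) F i x) = \sum_(i <- r) u (F i).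
Proof.
move=> du tF; elim: r => [|i r IH].
  rewrite big_nil; transitivity (u (fun=> 0)); last exact: distr0 du.
  by congr u; apply/funext => x; exact: big_nil.
rewrite big_cons -IH -(distrD du) //; last exact: test_fun_sum.
by congr u; apply/funext => x; exact: big_cons.
Qed.

Lemma distrS U V u : U `<=` V -> is_distr V u -> is_distr U u.
Proof.
move=> UV [lu bu]; split=> [a f g tf tg|K cK KU].
  by apply: lu; exact: test_funS UV _.
by apply: bu => //; exact: subset_trans UV.
Qed.

Lemma is_distr_eq U u v : eq_distr U u v -> is_distr U u -> is_distr U v.
Proof.
move=> uv [lu bu]; split=> [a f g tf tg|K cK KU].
  rewrite -!uv ?lu //.
  by apply: test_funD => //; exact: test_funZ.
have [N [C H]] := bu K cK KU; exists N, C => f sf vf M HM.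
by rewrite -uv; [exact: H|split=> //; exists K].
Qed.

Lemma is_distr0 U : is_distr U (0 : functional m).
Proof.
split=> [a f g _ _|K cK KU]; first by rewrite /= mulr0 addr0.
by exists 0%N, 0 => f _ _ M _; rewrite mul0r normr0.
Qed.

Lemma is_distr_lin U a u v : is_distr U u -> is_distr U v ->
  is_distr U (a *: u + v).
Proof.
move=> [lu bu] [lv bv]; split=> [b f g tf tg|K cK KU].
  change (a * u (b *: f + g) + v (b *: f + g) =
    b * (a * u f + v f) + (a * u g + v g)).
  by rewrite lu // lv //; ring.
have [N [C H]] := bu K cK KU; have [N' [C' H']] := bv K cK KU.
exists (maxn N N'), (`|a| * C + C') => f sf vf M HM.
change (`|a * u f + v f| <= (`|a| * C + C') * M).
rewrite (le_trans (ler_normD _ _)) // mulrDl lerD //.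
  rewrite normrM -mulrA ler_wpM2l //; apply: H => // s x sN; apply: HM.
  by rewrite leq_max sN.
by apply: H' => // s x sN; apply: HM; rewrite leq_max sN orbT.
Qed.

Lemma is_distrZ U a u : is_distr U u -> is_distr U (a *: u).
Proof.
by move=> du; have := is_distr_lin a du (is_distr0 U); rewrite addr0.
Qed.

Lemma is_distrD U u v : is_distr U u -> is_distr U v -> is_distr U (u + v).
Proof. by move=> du dv; have := is_distr_lin 1 du dv; rewrite scale1r. Qed.

Lemma is_distrN U u : is_distr U u -> is_distr U (- u).
Proof. by move=> du; have := is_distrZ (-1) du; rewrite scaleN1r. Qed.

Lemma is_distr_sum U (I : Type) (r : seq I) (F : I -> functional m) :
  (forall i, is_distr U (F i)) -> is_distr U (\sum_(i <- r) F i).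
Proof.
move=> dF; elim: r => [|i r IH]; first by rewrite big_nil; exact: is_distr0.
by rewrite big_cons; exact: is_distrD.
Qed.

End One.

Section Wcomp.
Context {m p : nat}.
Implicit Types (U : set 'cV[R]_m) (V W : set 'cV[R]_p)
  (a : 'cV[R]_p -> R) (q : 'cV[R]_p -> 'cV[R]_m).

(** The bounds on f are global and the constant does not depend on f: this is the seminorm estimate
    behind the continuity of f |-> a (f o q). The induction on N has the weight a general. *)
Lemma wcomp_bound W K q N a : open W -> compact K -> K `<=` W ->
  smooth_map W q -> smooth_on W a ->
  exists2 C : R, 0 <= C & forall (f : 'cV[R]_m -> R) (M : R), smooth f ->
    (forall s y, (size s <= N)%N -> `|pder s f y| <= M) ->
    forall s x, (size s <= N)%N -> K x ->
    `|pder s (fun y => a y * f (q y)) x| <= C * M.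
Proof.
move=> oW cK KW sq; elim: N a => [|N IH] a sa;
  have [C0 C00 HC0] := smooth_on_bounded cK KW sa.
  exists C0 => // f M _ HM s x; rewrite leqn0 size_eq0 => /eqP -> Kx.
  rewrite normrM ler_pM //; [exact: HC0|exact: (HM [::])].
have /fin_all_exists2[C C_ge0 HC] : forall i : 'I_p, exists2 C : R, 0 <= C &
    forall (f : 'cV[R]_m -> R) (M : R), smooth f ->
    (forall s y, (size s <= N.+1)%N -> `|pder s f y| <= M) ->
    forall s x, (size s <= N)%N -> K x ->
    `|pder (rcons s i) (fun y => a y * f (q y)) x| <= C * M.
  move=> i.
  have [C1 C10 H1] := IH _ (smooth_on_pder [:: i] sa).
  have /fin_all_exists2[C2 C20 H2] : forall j : 'I_m, exists2 C : R, 0 <= C &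
    forall (f : 'cV[R]_m -> R) (M : R), smooth f ->
    (forall s y, (size s <= N)%N -> `|pder s f y| <= M) ->
    forall s x, (size s <= N)%N -> K x ->
    `|pder s (fun y => (a y * pder [:: i] (fun z => q z j ord0) y) * f (q y)) x|
      <= C * M.
    move=> j; apply: IH.
    by apply: smooth_onM => //; exact: smooth_on_pder.
  exists (C1 + \sum_j C2 j); first by rewrite addr_ge0 ?sumr_ge0.
  move=> f M sf HM s x sN Kx; rewrite pder_rcons.
  have sfq g : smooth g -> smooth_on W (fun y => g (q y)).
    by move=> /smooth_onT; apply: smooth_on_comp.
  (* One derivative turns the weighted composite into a sum of weighted composites, with new weights
     d_i a and a d_i q_j, applied to f and to its partials. *)
  have E y : W y -> pder [:: i] (fun y => a y * f (q y)) y =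
      pder [:: i] a y * f (q y) + \sum_j
      (a y * pder [:: i] (fun z => q z j ord0) y) * pder [:: j] f (q y).
    move=> Wy; rewrite pder1M; [|exact: smooth_on_diff sa Wy|]; last first.
      exact: (smooth_on_diff (sfq f sf) Wy).
    have dqy j : differentiable (fun z => q z j ord0) y.
      exact: (smooth_on_diff (sq j) Wy).
    have dfq : differentiable f (q y).
      exact: (smooth_on_diff ((smooth_onT f).1 sf) I).
    rewrite (@pder1_comp _ _ _ f q) //.
    by congr (_ + _); rewrite mulr_sumr; apply: eq_bigr => j _; rewrite mulrA.
  rewrite (eq_on_pder _ oW E (KW _ Kx)).
  have spj j : smooth (pder [:: j] f).
    by apply/smooth_onT; apply: smooth_on_pder; exact/smooth_onT.
  have sB j : smooth_on W (fun y => a y * pder [:: i] (fun z => q z j ord0) y *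
      pder [:: j] f (q y)).
    apply: smooth_onM => //; last exact: sfq.
    by apply: smooth_onM => //; exact: smooth_on_pder.
  have Wx := KW _ Kx.
  have sA : smooth_on W (fun y => pder [:: i] a y * f (q y)).
    by apply: smooth_onM => //; [exact: smooth_on_pder|exact: sfq].
  rewrite (pderD _ oW sA (smooth_on_sum _ oW sB) Wx) (pder_sum _ _ oW sB Wx).
  rewrite (le_trans (ler_normD _ _)) // mulrDl lerD //.
    by apply: H1 => // t y tN; apply: HM; exact: leqW.
  rewrite (le_trans (ler_norm_sum _ _ _)) // mulr_suml ler_sum // => j _.
  by apply: H2 => // t y tN; rewrite -pder_rcons; apply: HM; rewrite size_rcons.
exists (C0 + \sum_i C i); first by rewrite addr_ge0 ?sumr_ge0.
move=> f M sf HM s x.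
have M0 : 0 <= M by rewrite (le_trans _ (HM [::] (q x) _)).
case/lastP: s => [|s i] sN Kx.
  rewrite (le_trans (_ : _ <= C0 * M)) // ?ler_wpM2r ?lerDl ?sumr_ge0 //.
  rewrite normrM ler_pM //; [exact: HC0|exact: (HM [::])].
rewrite size_rcons ltnS in sN.
rewrite (le_trans (HC i f M sf HM s x sN Kx)) // ler_wpM2r //.
rewrite (bigD1 i) //= addrCA lerDl addr_ge0 // sumr_ge0 //.
Qed.

(* Makes f |-> a (f o q) a continuous map from the test functions on U to those
   on V; W is where a and q are smooth. *)
Definition proper_weight U V a q := exists W : set 'cV[R]_p,
  [/\ open W, W `<=` V, smooth_on W a, smooth_map W q &
   forall K, compact K -> K `<=` U -> exists K' : set 'cV[R]_p,
     [/\ compact K', K' `<=` W & forall y, a y != 0 -> K (q y) -> K' y]].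

Lemma wcomp_vanishes K K' a q (f : 'cV[R]_m -> R) :
  (forall y, a y != 0 -> K (q y) -> K' y) -> vanishes_off K f ->
  vanishes_off K' (fun y => a y * f (q y)).
Proof.
move=> HK vf y K'y; have [->|a0] := eqVneq (a y) 0; first by rewrite mul0r.
by rewrite vf ?mulr0 // => Kq; apply: K'y; exact: HK.
Qed.

Lemma wcomp_test U V a q f : proper_weight U V a q -> test_fun U f ->
  test_fun V (fun y => a y * f (q y)).
Proof.
move=> [W [oW WV sa sq HK]] [sf [K [cK KU vf]]].
have [K' [cK' K'W Kq]] := HK K cK KU.
have vf' := wcomp_vanishes Kq vf.
split; last by exists K'; split=> //; exact: subset_trans WV.
apply: (smooth_glue oW cK' K'W _ vf').
by apply: smooth_onM => //; apply: (smooth_on_comp _ _ _ ((smooth_onT f).1 sf)).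
Qed.

Lemma wcomp_distr U V a q u : proper_weight U V a q -> is_distr V u ->
  is_distr U (fun f => u (fun y => a y * f (q y))).
Proof.
move=> aq du; split=> [c f g tf tg|K cK KU].
  have [tf' tg'] := (wcomp_test aq tf, wcomp_test aq tg).
  rewrite -(distrZ _ du tf') -(distrD du) //; last exact: test_funZ.
  by congr u; apply/funext => y; rewrite mulrDr mulrCA.
have [W [oW WV sa sq HK]] := aq; have [K' [cK' K'W Kq]] := HK K cK KU.
have [N [C H]] := du.2 K' cK' (subset_trans K'W WV).
have [D D0 HD] := wcomp_bound N oW cK' K'W sq sa.
exists N, (C * D) => f sf vf M HM; rewrite -mulrA.
have vf' := wcomp_vanishes Kq vf.
apply: H => //.
  by apply: (wcomp_test aq _).1; split=> //; exists K.
move=> s x sN; have [K'x|K'x] := pselect (K' x); first exact: HD.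
rewrite (vanishes_off_pder _ _ vf') //; last exact: col_compact_closed.
by rewrite normr0 mulr_ge0 // (le_trans _ (HM [::] (q x) _)).
Qed.

End Wcomp.

End TestFunctions.

(** * Integrals and fiber integrals *)

Section Integrals.
Context {R : realType}.
Notation mu := (@lebesgue_measure R).
Implicit Types (h H : R -> R) (c d t : R).

Definition integ c d h : R := Rintegral mu `[c, d] h.

Lemma continuous_integrable c d h : continuous h ->
  mu.-integrable `[c, d] (EFin \o h).
Proof.
move=> ch; apply: continuous_compact_integrable; first exact: segment_compact.
exact: continuous_subspaceT.
Qed.

Lemma integ_deriv c t h : c < t -> continuous h ->
  is_derive t 1 (fun s => integ c s h) (h t).
Proof.
move=> ct ch.
have tt1 : t < t + 1 by rewrite ltrDl.
have [d1 d2] := continuous_FTC1_closed tt1 (continuous_integrable c (t + 1) ch) ct (ch t).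
apply: DeriveDef; first exact: d1.
by rewrite -derive1E.
Qed.

Lemma integ_prim c d h H : c < d -> {within `[c, d], continuous h} ->
  (forall t, t \in `[c, d] -> is_derive t 1 H (h t)) ->
  integ c d h = H d - H c.
Proof.
move=> cd ch dH.
have cH t : t \in `[c, d] -> {for t, continuous H}.
  move=> tcd; apply: differentiable_continuous; apply/derivable1_diffP.
  by have [] := dH t tcd.
rewrite /integ /Rintegral (@continuous_FTC2 _ h H) //.
  split.
  - by move=> t tcd; have [] := dH t (subset_itv_oo_cc tcd).
  - by apply: cvg_at_right_filter; apply: cH; rewrite in_itv /= lexx ltW.
  - by apply: cvg_at_left_filter; apply: cH; rewrite in_itv /= lexx ltW.
move=> t tcd; rewrite derive1E.
by have [] := dH t (subset_itv_oo_cc tcd).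
Qed.

Lemma continuous_addf h1 h2 : continuous h1 -> continuous h2 ->
  continuous (fun t => h1 t + h2 t).
Proof. by move=> c1 c2 t; apply: continuousD; [exact: c1|exact: c2]. Qed.

Lemma continuous_scalef (r : R) h : continuous h -> continuous (fun t => r * h t).
Proof.
by move=> ch t; apply: continuousM; [exact: cst_continuous|exact: ch].
Qed.

Lemma integD c d h1 h2 : continuous h1 -> continuous h2 ->
  integ c d (fun t => h1 t + h2 t) = integ c d h1 + integ c d h2.
Proof.
by move=> c1 c2; apply: RintegralD => //; exact: continuous_integrable.
Qed.

Lemma integZ c d r h : continuous h ->
  integ c d (fun t => r * h t) = r * integ c d h.
Proof. by move=> c1; apply: RintegralZl => //; exact: continuous_integrable. Qed.

Lemma integ_sum c d (I : Type) (r : seq I) (h : I -> R -> R) :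
  (forall i, continuous (h i)) ->
  continuous (fun t => \sum_(i <- r) h i t) /\
  integ c d (fun t => \sum_(i <- r) h i t) = \sum_(i <- r) integ c d (h i).
Proof.
move=> ch; elim: r => [|i r [IHc IH]].
  rewrite big_nil; under [fun _ => _]funext do rewrite big_nil.
  split; first exact: cst_continuous.
  by have := @integZ c d 0 (fun=> 0) (@cst_continuous _ _ _); rewrite !mul0r.
rewrite big_cons -IH; under [fun _ => _]funext do rewrite big_cons.
split; last exact: integD.
by move=> t; apply: continuousD; [exact: ch|exact: IHc].
Qed.

Lemma integ_bound c d h M : c <= d -> continuous h ->
  (forall t, `|h t| <= M) -> `|integ c d h| <= M * (d - c).
Proof.
move=> cd ch hM.
have cn : continuous (fun t => `|h t|).
  by move=> t; apply: continuous_comp; [exact: ch|exact: norm_continuous].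
rewrite (le_trans (le_normr_Rintegral _ (continuous_integrable c d ch))) //.
have : Rintegral mu `[c, d] (fun t => `|h t|) <= Rintegral mu `[c, d] (fun=> M).
  by apply: le_Rintegral => //; apply: continuous_integrable => //;
    exact: cst_continuous.
move=> /le_trans; apply; rewrite Rintegral_cst //= lebesgue_measure_itv /= lte_fin.
by move: cd; rewrite le_eqVlt => /predU1P[->|->//]; rewrite ltxx subrr.
Qed.

Lemma Int_integ c d h : (forall t, t \notin `[c, d] -> h t = 0) ->
  Rintegral mu setT h = integ c d h.
Proof.
move=> h0; rewrite /integ [RHS]Rintegral_mkcond; congr (Rintegral _ _ _).
apply/funext => t; rewrite patchE; case: ifPn => //.
by move=> /negP tcd; apply: h0; apply/negP => H; apply: tcd; rewrite inE.
Qed.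

(** Substitution through primitives: if H' = h then s |-> a H(s/a) is a primitive of h(s/a). For a <
    0 the endpoints swap, which produces the absolute value. *)
Lemma Int_scale c d h (a : R) : a != 0 -> c < d -> continuous h ->
  (forall t, t \notin `[c, d] -> h t = 0) ->
  Rintegral mu setT (fun t => h (t / a)) = `|a| * Rintegral mu setT h.
Proof.
move=> a0 cd ch h0.
(* The primitive starts at c - 1 because [integ_deriv] gives a two-sided derivative only strictly to
   the right of the base point, and it is needed at c. *)
have [H dH] : exists H, forall t, c - 1 < t -> is_derive t 1 H (h t).
  by exists (fun s => integ (c - 1) s h) => t ct; exact: integ_deriv.
have HE : Rintegral mu setT h = H d - H c.
  rewrite (Int_integ h0); apply: integ_prim => //.
    exact: continuous_subspaceT.
  by move=> t /[!in_itv] /= /andP[ct _]; apply: dH; lra.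
have cha : continuous (fun t => h (t / a)).
  move=> t; apply: continuous_comp; last exact: ch.
  by apply: continuousM; [exact: cvg_id|exact: cst_continuous].
have dHa t : c <= t / a -> is_derive t 1 (fun s => a * H (s / a)) (h (t / a)).
  move=> ct; have dHt : is_derive (t / a) 1 H (h (t / a)) by apply: dH; lra.
  have da : is_derive t 1 (fun s : R => s / a) a^-1.
    have -> : (fun s : R => s / a) = a^-1 *: (id : R -> R).
      by apply/funext => s; rewrite mulrC.
    have := is_deriveZ a^-1 (is_derive_id t (1 : R)).
    by rewrite [_ *: 1]mulr1.
  have X : is_derive t 1 (fun s => a * H (s / a)) (a *: (h (t / a) * a^-1)).
    exact: (is_deriveZ a (@is_derive1_comp _ H (fun s : R => s / a) _ _ _ dHt da)).
  by move: X; rewrite /GRing.scale /= mulrCA divff // mulr1.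
have [ap|an|/eqP] := ltgtP a 0; last by rewrite (negbTE a0).
- rewrite (@Int_integ (a * d) (a * c)).
    transitivity (a * H (a * c / a) - a * H (a * d / a)); last first.
      by rewrite HE ltr0_norm // ![a * _ / a]mulrAC divff // !mul1r; ring.
    apply: (@integ_prim _ _ _ (fun s => a * H (s / a))).
    + by rewrite ltr_nM2l.
    + exact: continuous_subspaceT.
    + move=> t /[!in_itv] /= /andP[_ tc]; apply: dHa.
      by rewrite ler_ndivlMr // mulrC.
  move=> t; rewrite in_itv /= => tn; apply: h0; rewrite in_itv /=.
  apply: contra tn => /andP[]; rewrite ler_ndivlMr // ler_ndivrMr // => ? ?.
  by rewrite mulrC [a * c]mulrC; apply/andP.
- rewrite (@Int_integ (a * c) (a * d)).
    transitivity (a * H (a * d / a) - a * H (a * c / a)); last first.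
      by rewrite HE gtr0_norm // ![a * _ / a]mulrAC divff // !mul1r; ring.
    apply: (@integ_prim _ _ _ (fun s => a * H (s / a))).
    + by rewrite ltr_pM2l.
    + exact: continuous_subspaceT.
    + move=> t /[!in_itv] /= /andP[tc _]; apply: dHa.
      by rewrite ler_pdivlMr // mulrC.
  move=> t; rewrite in_itv /= => tn; apply: h0; rewrite in_itv /=.
  apply: contra tn => /andP[]; rewrite ler_pdivlMr // ler_pdivrMr // => ? ?.
  by rewrite mulrC [a * d]mulrC; apply/andP.
Qed.

(** The substitution t = l/s, dt = |l|/s^2 ds. As 0 < c, the support of the integrand in s stays
    away from 0; at s = 0 itself, l/s is 0 by convention, outside [[c, d]]. *)
Lemma Int_inv c d h (l : R) : l != 0 -> 0 < c -> c < d -> continuous h ->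
  (forall t, t \notin `[c, d] -> h t = 0) ->
  Rintegral mu setT (fun s => `|l| / s ^+ 2 * h (l / s)) = Rintegral mu setT h.
Proof.
move=> l0 c0 cd ch h0.
have [H dH] : exists H, forall t, c - 1 < t -> is_derive t 1 H (h t).
  by exists (fun s => integ (c - 1) s h) => t ct; exact: integ_deriv.
have HE : Rintegral mu setT h = H d - H c.
  rewrite (Int_integ h0); apply: integ_prim => //.
    exact: continuous_subspaceT.
  by move=> t /[!in_itv] /= /andP[ct _]; apply: dH; lra.
have d0 : 0 < d by exact: lt_trans cd.
have cne0 : c != 0 by rewrite gt_eqF.
have dne0 : d != 0 by rewrite gt_eqF.
have cs (s : R) : s != 0 ->
    {for s, continuous (fun s : R => `|l| / s ^+ 2 * h (l / s))}.
  move=> s0.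
  have cV : {for s, continuous (fun s : R => s^-1)} by exact: inv_continuous.
  have cX : {for s, continuous (fun s : R => (s ^+ 2)^-1)}.
    apply: (@continuous_comp _ _ _ (fun s : R => s ^+ 2) (fun s : R => s^-1)).
      exact: exprn_continuous.
    by apply: inv_continuous; rewrite expf_neq0.
  apply: (@continuousM _ _ (fun s : R => `|l| / s ^+ 2)).
    by apply: (@continuousM _ _ (fun=> `|l|)) => //; exact: cst_continuous.
  apply: (@continuous_comp _ _ _ (fun s : R => l / s) h); last exact: ch.
  by apply: (@continuousM _ _ (fun=> l)) => //; exact: cst_continuous.
have dHs s (k : R) : s != 0 -> c <= l / s ->
    is_derive s 1 (fun s => k * H (l / s)) (- k * l / s ^+ 2 * h (l / s)).
  move=> s0 ct; have dHt : is_derive (l / s) 1 H (h (l / s)) by apply: dH; lra.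
  have dV : is_derive s 1 (fun s : R => s^-1) (- s ^- 2 *: 1).
    by apply: is_deriveV.
  have dl : is_derive s 1 (fun s : R => l / s) (l *: (- s ^- 2 *: 1)).
    exact: is_deriveZ.
  have X : is_derive s 1 (fun s => k * H (l / s))
      (k *: (h (l / s) * (l *: (- s ^- 2 *: 1)))).
    exact: (is_deriveZ k (@is_derive1_comp _ H (fun s : R => l / s) _ _ _ dHt dl)).
  by apply: (is_derive_eq X); rewrite /GRing.scale /= mulr1; ring.
(* Both signs of l share this argument. The primitive is k H(l/s) with k = 1 or -1, chosen so that -
   k l = |l|, and u < v are l/c and l/d in increasing order. *)
have main (k u v : R) : (forall s, s \in `[u, v] -> s != 0) -> u < v ->
    (forall s, s \in `[u, v] -> c <= l / s) -> - k * l = `|l| ->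
    (forall s, s \notin `[u, v] -> l / s \notin `[c, d]) ->
    k * (H (l / v) - H (l / u)) = H d - H c ->
    Rintegral mu setT (fun s => `|l| / s ^+ 2 * h (l / s)) = Rintegral mu setT h.
  move=> uv0 uv cl kl out E.
  rewrite (@Int_integ u v); last by move=> s /out /h0 ->; rewrite mulr0.
  transitivity (k * H (l / v) - k * H (l / u)); last by rewrite -mulrBr E HE.
  apply: (@integ_prim _ _ _ (fun s => k * H (l / s))) => //.
  - apply: continuous_in_subspaceT => s; rewrite inE => suv.
    by apply: cs; exact: uv0.
  - by move=> s suv; rewrite -kl; apply: dHs; [exact: uv0|exact: cl].
have [ln|lp|/eqP] := ltgtP l 0; last by rewrite (negbTE l0).
- apply: (main 1 (l / c) (l / d)).
  + move=> s /[!in_itv] /= /andP[_ sd]; rewrite lt_eqF //.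
    by rewrite (le_lt_trans sd) // pmulr_llt0 ?invr_gt0.
  + by rewrite ltr_nM2l // ltf_pV2.
  + move=> s /[!in_itv] /= /andP[sc sd].
    have s0 : s < 0 by rewrite (le_lt_trans sd) // pmulr_llt0 ?invr_gt0.
    by rewrite ler_ndivlMr // mulrC -ler_pdivrMr.
  + by rewrite ltr0_norm // mulN1r.
  + move=> s; rewrite !in_itv /=; apply: contra => /andP[c1 c2].
    have s0 : s < 0.
      rewrite ltNge; apply/negP => s0.
      have : l / s <= 0 by rewrite nmulr_rle0 ?invr_ge0.
      by rewrite leNgt (lt_le_trans c0 c1).
    move: c1 c2; rewrite ler_ndivlMr // ler_ndivrMr // => c1 c2.
    by rewrite ler_pdivrMr // ler_pdivlMr // mulrC c1 mulrC c2.
  + by rewrite mul1r !invfM !invrK !mulrA divff // !mul1r.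
- apply: (main (-1) (l / d) (l / c)).
  + move=> s /[!in_itv] /= /andP[sd _]; rewrite gt_eqF //.
    by rewrite (lt_le_trans _ sd) // divr_gt0.
  + by rewrite ltr_pM2l // ltf_pV2.
  + move=> s /[!in_itv] /= /andP[sd sc].
    have s0 : 0 < s by rewrite (lt_le_trans _ sd) // divr_gt0.
    by rewrite ler_pdivlMr // mulrC -ler_pdivlMr.
  + by rewrite gtr0_norm // opprK mul1r.
  + move=> s; rewrite !in_itv /=; apply: contra => /andP[c1 c2].
    have s0 : 0 < s.
      rewrite ltNge; apply/negP => s0.
      have : l / s <= 0 by rewrite pmulr_rle0 ?invr_le0.
      by rewrite leNgt (lt_le_trans c0 c1).
    move: c1 c2; rewrite ler_pdivlMr // ler_pdivrMr // => c1 c2.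
    by rewrite ler_pdivrMr // ler_pdivlMr // [s * d]mulrC c2 [s * c]mulrC c1.
  + by rewrite !invfM !invrK !mulrA divff // !mul1r; ring.
Qed.

End Integrals.

Section Points.
Context {R : realType} {n : nat}.
Implicit Types (l : R) (z : 'cV[R]_n) (w : 'cV[R]_(1 + n)).

Lemma pt_head l z : pt l z ord0 ord0 = l.
Proof.
have E : (@ord0 n) = lshift n (@ord0 0) by exact: val_inj.
by rewrite E /pt col_mxEu mxE.
Qed.

Lemma pt_tail l z j : pt l z (rshift 1 j) ord0 = z j ord0.
Proof. by rewrite /pt col_mxEd. Qed.

Lemma lam_pt l z : lam (pt l z) = l.
Proof. exact: pt_head. Qed.

Lemma dsubmx_pt l z : dsubmx (pt l z) = z.
Proof. exact: col_mxKd. Qed.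

Lemma ord_1D (k : 'I_(1 + n)) : k = ord0 \/ exists j, k = rshift 1 j.
Proof.
case: (splitP k) => [i|j] E; [left|right; exists j]; apply: val_inj => //=.
by rewrite E; case: i {E} => [[]].
Qed.

Lemma rshift_neq0 (j : 'I_n) : (rshift 1 j == ord0 :> 'I_(1 + n)) = false.
Proof. by []. Qed.

Lemma pt_eta w : w = pt (lam w) (dsubmx w).
Proof.
apply/colP => k; have [->|[j ->]] := ord_1D k; first by rewrite pt_head.
by rewrite pt_tail mxE.
Qed.

Lemma pt_scale (a : R) l z : pt (a * l) (a *: z) = a *: pt l z.
Proof.
apply/colP => k; have [->|[j ->]] := ord_1D k; rewrite [RHS]mxE.
  by rewrite !pt_head.
by rewrite !pt_tail mxE.
Qed.

Lemma affine_part_pt l z : affine_part (pt l z) = l^-1 *: z.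
Proof. by rewrite /affine_part lam_pt dsubmx_pt. Qed.

Lemma lam_scale (a : R) w : lam (a *: w) = a * lam w.
Proof. by rewrite /lam mxE. Qed.

Lemma affine_part_scale (a : R) w : a != 0 -> affine_part (a *: w) = affine_part w.
Proof.
move=> a0; rewrite /affine_part lam_scale linearZ /= scalerA invfM mulrAC.
by rewrite mulVf // mul1r.
Qed.

Lemma pt_affine w : lam w != 0 -> w = lam w *: pt 1 (affine_part w).
Proof.
move=> w0; rewrite -pt_scale mulr1 /affine_part scalerA divff // scale1r.
exact: pt_eta.
Qed.

End Points.

(** * Mean value and second-order Taylor bounds *)

Section Taylor.
Context {R : realType} {m : nat}.
Implicit Types (f : 'cV[R]_m -> R) (K : set 'cV[R]_m) (w h : 'cV[R]_m).

Lemma diff_colE f w h : differentiable f w ->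
  'd f w h = \sum_j h j ord0 * pder [:: j] f w.
Proof.
move=> df; rewrite {1}(col_delta_sum h) linear_sum /=; apply: eq_bigr => j _.
by rewrite linearZ /= dE.
Qed.

Lemma coord_le h j : `|h j ord0| <= `|h|.
Proof.
rewrite [leRHS]/Num.Def.normr /= mx_normrE.
by apply/bigmax_geP; right => /=; exists (j, ord0).
Qed.

Lemma MVT_col f w h : (forall x, differentiable f x) ->
  exists2 c : R, 0 <= c <= 1 &
    f (h + w) - f w = \sum_j h j ord0 * pder [:: j] f (c *: h + w).
Proof.
move=> df.
pose g (t : R) := t *: h + w.
have dg t : is_diff t g ( *:%R ^~ h).
  have E : g = (fun t => t *: h) + cst w by apply/funext.
  rewrite E; apply: is_diff_eq; exact: addr0.
have dfg t : is_derive t (1 : R) (f \o g) ('d f (g t) h).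
  have dgt := @ex_diff _ _ _ _ _ _ _ (dg t).
  apply: DeriveDef.
    by apply: diff_derivable; apply: differentiable_comp.
  rewrite deriveE; last exact: differentiable_comp.
  by rewrite diff_comp //= (@diff_val _ _ _ _ _ _ _ (dg t)) scale1r.
have cfg : {within `[0, 1], continuous (f \o g)}.
  apply: continuous_subspaceT => t; apply: differentiable_continuous.
  by apply/derivable1_diffP; have [] := dfg t.
have [c c01 E] := @MVT_segment R (f \o g) (fun t => 'd f (g t) h) 0 1 ler01
  (fun t _ => dfg t) cfg.
exists c; first by move: c01; rewrite in_itv.
move: E; rewrite /= /g scale1r scale0r add0r subr0 mulr1 => ->.
exact: diff_colE.
Qed.

Lemma lipschitz_bound f M w h : (forall x, differentiable f x) ->
  (forall j x, `|pder [:: j] f x| <= M) -> `|f (h + w) - f w| <= m%:R * M * `|h|.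
Proof.
move=> df HM; have [c _ ->] := MVT_col w h df.
rewrite (le_trans (ler_norm_sum _ _ _)) //.
have -> : m%:R * M * `|h| = \sum_(j < m) (`|h| * M).
  by rewrite sumr_const card_ord -mulr_natl; ring.
by apply: ler_sum => j _; rewrite normrM ler_pM // coord_le.
Qed.

(** The mean value theorem for f gives the partials at an intermediate point; the Lipschitz bound
    then compares each of them with its value at w. *)
Lemma taylor_bound f M w h : smooth f ->
  (forall i j x, `|pder [:: i; j] f x| <= M) ->
  `|f (h + w) - f w - \sum_j h j ord0 * pder [:: j] f w|
    <= m%:R * (m%:R * M) * `|h| ^+ 2.
Proof.
move=> sf HM; have [c /andP[c0 c1] ->] := MVT_col w h (sf [::]).
rewrite -sumrB (le_trans (ler_norm_sum _ _ _)) //.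
have -> : m%:R * (m%:R * M) * `|h| ^+ 2 = \sum_(j < m) (`|h| * (m%:R * M * `|h|)).
  by rewrite sumr_const card_ord -[RHS]mulr_natl; ring.
apply: ler_sum => j _; rewrite -mulrBr normrM ler_pM ?coord_le //.
have := @lipschitz_bound (pder [:: j] f) M w (c *: h) (sf [:: j]).
move=> /(_ (fun i => HM i j)) /le_trans; apply.
have M0 : 0 <= M by exact: le_trans (HM j j 0).
by rewrite ler_wpM2l ?mulr_ge0 // normrZ ger0_norm // ler_piMl.
Qed.

Lemma smooth_compact_bound K f (N : nat) : compact K -> vanishes_off K f ->
  smooth f -> exists2 M : R, 0 <= M &
    forall s x, (size s <= N)%N -> `|pder s f x| <= M.
Proof.
move=> cK.
have H0 f' : vanishes_off K f' -> smooth f' ->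
    exists2 M : R, 0 <= M & forall x, `|f' x| <= M.
  move=> vf /smooth_onT sf.
  have [M M0 HM] := smooth_on_bounded cK (@subsetT _ K) sf.
  exists M => // x; have [/HM //|Kx] := pselect (K x).
  by rewrite vf // normr0.
elim: N f => [|N IH] f vf sf; have [M0 M00 HM0] := H0 f vf sf.
  by exists M0 => // s x; rewrite leqn0 size_eq0 => /eqP ->.
have /fin_all_exists2[M M_ge0 HM] : forall i : 'I_m, exists2 M : R, 0 <= M &
    forall s x, (size s <= N)%N -> `|pder s (pder [:: i] f) x| <= M.
  move=> i; apply: IH.
    by apply: vanishes_off_pder => //; exact: col_compact_closed.
  by apply/smooth_onT; apply: smooth_on_pder; exact/smooth_onT.
exists (M0 + \sum_i M i); first by rewrite addr_ge0 ?sumr_ge0.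
move=> s x; case/lastP: s => [_|s i].
  by rewrite (le_trans (HM0 x)) // lerDl sumr_ge0.
rewrite size_rcons ltnS pder_rcons => sN; rewrite (le_trans (HM i s x sN)) //.
by rewrite (bigD1 i) //= addrCA lerDl addr_ge0 // sumr_ge0.
Qed.

End Taylor.

(** * Slices of functions of (l, x) *)

Section Slices.
Context {R : realType} {p : nat}.
Implicit Types (F : 'cV[R]_(1 + p) -> R) (t l : R) (x : 'cV[R]_p).

Lemma pder1_slice F t (i : 'I_p) x : differentiable F (pt t x) ->
  pder [:: i] (fun y => F (pt t y)) x = pder [:: rshift 1 i] F (pt t x).
Proof.
move=> dF.
have E k : (fun y : 'cV[R]_p => pt t y k ord0) =
    if k == ord0 then (fun=> t) else (fun y => pt t y k ord0).
  by case: eqP => // ->; apply/funext => y; rewrite pt_head.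
have dp k : differentiable (fun y : 'cV[R]_p => pt t y k ord0) x.
  have [->|[j ->]] := ord_1D k.
    under [fun _ => _]funext do rewrite pt_head; exact: differentiable_cst.
  under [fun _ => _]funext do rewrite pt_tail; exact: differentiable_coord.
rewrite (@pder1_comp _ _ _ F (pt t)) //.
have D k : pder [:: i] (fun y : 'cV[R]_p => pt t y k ord0) x = (k == rshift 1 i)%:R.
  have [->|[j ->]] := ord_1D k.
    under [fun _ => _]funext do rewrite pt_head; rewrite pder1_cst.
    by rewrite eq_sym rshift_neq0.
  under [fun _ => _]funext do rewrite pt_tail; rewrite pder1_coord.
  by rewrite (inj_eq (@rshift_inj _ _)).
rewrite (bigD1 (rshift 1 i)) //= D eqxx mul1r big1 ?addr0 // => k /negbTE ki.
by rewrite D ki mul0r.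
Qed.

Lemma pder_slice F t s x : smooth F ->
  pder s (fun y => F (pt t y)) x = pder (map (@rshift 1 p) s) F (pt t x).
Proof.
elim/last_ind: s F x => // s i IH F x sF.
rewrite map_rcons !pder_rcons -IH; last first.
  by apply/smooth_onT; apply: smooth_on_pder; exact/smooth_onT.
congr (pder s _ x); apply/funext => y; apply: pder1_slice; exact: (sF [::]).
Qed.

Lemma smooth_slice F t : smooth F -> smooth (fun y => F (pt t y)).
Proof.
move=> sF s x.
have -> : pder s (fun y => F (pt t y)) =
    (fun y => pder (map (@rshift 1 p) s) F (pt t y)).
  by apply/funext => y; exact: pder_slice.
apply: (@differentiable_comp _ _ _ _ (pt t)); last exact: sF.
apply: differentiable_col => k; have [->|[j ->]] := ord_1D k.
  by under [fun _ => _]funext do rewrite pt_head; exact: differentiable_cst.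
by under [fun _ => _]funext do rewrite pt_tail; exact: differentiable_coord.
Qed.

Lemma pt_line l x : pt l x = l *: pt 1 0 + pt 0 x.
Proof.
rewrite -pt_scale mulr1 scaler0; apply/colP => k; rewrite [RHS]mxE.
have [->|[j ->]] := ord_1D k; first by rewrite !pt_head addr0.
by rewrite !pt_tail mxE add0r.
Qed.

Lemma is_derive_line F t x : differentiable F (pt t x) ->
  is_derive t 1 (fun l => F (pt l x)) (pder [:: ord0] F (pt t x)).
Proof.
move=> dF; pose g (l : R) := pt l x.
have dg : is_diff t g ( *:%R ^~ (pt 1 0)).
  have -> : g = (fun l => l *: pt 1 0) + cst (pt 0 x).
    by apply/funext => l; exact: pt_line.
  apply: is_diff_eq; exact: addr0.
have dgt := @ex_diff _ _ _ _ _ _ _ dg.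
rewrite -/(F \o g); apply: DeriveDef.
  by apply: diff_derivable; apply: differentiable_comp.
rewrite deriveE; last exact: differentiable_comp.
rewrite diff_comp //= (@diff_val _ _ _ _ _ _ _ dg) scale1r dE //.
congr ('d F _ _); apply/colP => k; have [->|[j ->]] := ord_1D k.
  by rewrite pt_head [RHS]mxE !eqxx.
by rewrite pt_tail [RHS]mxE mxE rshift_neq0.
Qed.

Lemma continuous_line F x : smooth F -> continuous (fun l => F (pt l x)).
Proof.
move=> sF t; apply: differentiable_continuous; apply/derivable1_diffP.
by have [] := is_derive_line (sF [::] (pt t x)).
Qed.

End Slices.

(** * Differentiation under the fiber integral *)

Section FiberIntegral.
Context {R : realType} {p : nat}.
Notation mu := (@lebesgue_measure R).
Implicit Types (F G : 'cV[R]_(1 + p) -> R) (t l c d B : R) (x : 'cV[R]_p)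
  (K : set 'cV[R]_(1 + p)) (V : set 'cV[R]_p).

Definition fiber_on c d F x : R := integ c d (fun l => F (pt l x)).

Definition fiber_int F x : R := Rintegral mu setT (fun l => F (pt l x)).

Lemma test_pder F s K : compact K -> vanishes_off K F -> smooth F ->
  vanishes_off K (pder s F) /\ smooth (pder s F).
Proof.
move=> cK vF sF; split.
  by apply: vanishes_off_pder => //; exact: col_compact_closed.
by apply/smooth_onT; apply: smooth_on_pder; exact/smooth_onT.
Qed.

(** The Taylor remainder in x is quadratic with a constant independent of l, by compact support;
    integrating it over the bounded interval keeps it quadratic. *)
Lemma fiber_on_diff c d F K x : c <= d -> compact K -> vanishes_off K F ->
  smooth F -> differentiable (fiber_on c d F) x /\ forall j : 'I_p,
    pder [:: j] (fiber_on c d F) x = fiber_on c d (pder [:: rshift 1 j] F) x.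
Proof.
move=> cd cK vF sF.
have [M M0 HM] := smooth_compact_bound 2 cK vF sF.
have cl G y : smooth G -> continuous (fun l => G (pt l y)) by exact: continuous_line.
have sj j : smooth (pder [:: rshift 1 j] F) by exact: (test_pder _ cK vF sF).2.
pose a j := fiber_on c d (pder [:: rshift 1 j] F) x.
pose Lf (h : 'cV[R]_p) := \sum_j h j ord0 * a j.
have Llin : linear Lf.
  move=> r u v; rewrite /Lf scaler_sumr -big_split /=; apply: eq_bigr => j _.
  by rewrite !mxE mulrDl -mulrA.
pose LL := GRing.isLinear.Build _ _ _ _ Lf Llin.
pose L : {linear 'cV[R]_p -> R} := HB.pack Lf LL.
have Lc : continuous L.
  move=> h; suff dL : differentiable Lf h by exact: (differentiable_continuous dL).
  have -> : Lf = \sum_j (fun h : 'cV[R]_p => h j ord0 * a j).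
    by apply/funext => u; rewrite fct_sumE.
  apply: differentiable_sum => j; apply: differentiableM.
    exact: differentiable_coord.
  exact: differentiable_cst.
pose C := p%:R * (p%:R * M) * (d - c).
have C0 : 0 <= C by rewrite !mulr_ge0 // subr_ge0.
have est h : `|fiber_on c d F (h + x) - fiber_on c d F x - L h| <= C * `|h| ^+ 2.
  (* The Taylor remainder on the slice at l, with each minus sign written as a factor -1 so that
     [integD] and [integZ] apply. *)
  pose T l := F (pt l (h + x)) + (-1) * F (pt l x) +
    (-1) * \sum_j h j ord0 * pder [:: rshift 1 j] F (pt l x).
  have [cS ES] := @integ_sum R c d 'I_p (index_enum _)
    (fun j l => h j ord0 * pder [:: rshift 1 j] F (pt l x))
    (fun j => continuous_scalef (cl _ x (sj j))).
  have cF1 := @continuous_scalef _ (-1) _ (cl _ x sF).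
  have cF2 := continuous_addf (cl _ (h + x) sF) cF1.
  have cF3 := @continuous_scalef _ (-1) _ cS.
  have cT : continuous T := continuous_addf cF2 cF3.
  have -> : fiber_on c d F (h + x) - fiber_on c d F x - L h = integ c d T.
    rewrite /T integD // integD //; last exact: cl.
    rewrite !integZ //; last exact: cl.
    rewrite ES /L /= /Lf !mulN1r; congr (_ - _).
    by apply: eq_bigr => j _; rewrite integZ //; exact: cl.
  rewrite (le_trans (integ_bound (M := p%:R * (p%:R * M) * `|h| ^+ 2) cd cT _)) //;
    last by rewrite /C; rewrite mulrAC.
  move=> l; rewrite /T !mulN1r.
  have := @taylor_bound R p (fun y => F (pt l y)) M x h (smooth_slice l sF).
  under eq_bigr do rewrite pder_slice //.
  apply=> i j y; rewrite pder_slice //; exact: HM.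
have [dJ EL] : differentiable (fiber_on c d F) x /\
    'd (fiber_on c d F) x = L :> ('cV[R]_p -> R).
  apply: (diff_epsP Lc) => e e0.
  (* C may be 0; C + 1 is a positive divisor. *)
  have e1 : 0 < e / (C + 1) by rewrite divr_gt0 // ltr_wpDl.
  apply: filterS (@nbhs0_le R 'cV[R]_p _ e1) => h hs.
  rewrite (le_trans (est h)) // expr2 mulrA ler_wpM2r //.
  rewrite (le_trans (ler_wpM2l C0 hs)) // mulrA ler_pdivrMr ?ltr_wpDl //.
  by rewrite [C * e]mulrC ler_wpM2l ?(ltW e0) // lerDl.
split=> // j; rewrite dE //.
rewrite EL /L /= /Lf (bigD1 j) //= mxE !eqxx mul1r big1 ?addr0 // => i /negbTE ij.
by rewrite mxE ij mul0r.
Qed.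

End FiberIntegral.

Section RealLemmas.
Context {R : realType}.

Lemma integ0 (c d : R) : integ c d (fun=> 0) = 0.
Proof.
have := @integZ R c d 0 (fun=> 0) (@cst_continuous _ _ _).
by rewrite !mul0r.
Qed.

Lemma eq_integ (c d : R) (h1 h2 : R -> R) :
  (forall t, c <= t <= d -> h1 t = h2 t) -> integ c d h1 = integ c d h2.
Proof.
by move=> E; apply: eq_Rintegral => t; rewrite inE /= in_itv /= => /E.
Qed.

(** A Lipschitz derivative gives a quadratic remainder with the same constant. The explicit constant
    matters: it is applied for every x at once and must be uniform in x. *)
Lemma quadratic_error (c L : R) (f df : R -> R) :
  (forall t, c < t -> is_derive t 1 f (df t)) ->
  (forall s t, `|df s - df t| <= L * `|s - t|) ->
  forall s t, c < s -> c < t -> `|f s - f t - (s - t) * df t| <= L * `|s - t| ^+ 2.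
Proof.
move=> dff lip s t cs ct.
have L0 : 0 <= L.
  have := lip 1 0; rewrite subr0 normr1 mulr1; exact: le_trans.
have cf (a b : R) : c < a -> {within `[a, b], continuous f}.
  move=> ca; apply: continuous_in_subspaceT => x; rewrite inE /= in_itv /=.
  move=> /andP[ax _]; apply: differentiable_continuous; apply/derivable1_diffP.
  by have [] := dff x (lt_le_trans ca ax).
have mvt a b : c < a -> a <= b -> exists2 r, a <= r <= b &
    f b - f a = df r * (b - a).
  move=> ca ab; have dab x : x \in `]a, b[ -> is_derive x 1 f (df x).
    by rewrite in_itv /= => /andP[ax _]; apply: dff; exact: lt_trans ax.
  have [r rab E] := @MVT_segment R f df a b ab dab (cf a b ca).
  by exists r => //; rewrite in_itv in rab.
have [r rst ->] : exists2 r, `|r - t| <= `|s - t| & f s - f t = df r * (s - t).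
  have [st|/ltW ts] := leP s t.
    have [r /andP[sr rt] E] := mvt s t cs st; exists r.
      by rewrite !ler0_norm ?subr_le0 // lerN2 lerD2r.
    by rewrite -opprB E -mulrN opprB.
  have [r /andP[tr rs] E] := mvt t s ct ts; exists r => //.
  by rewrite !ger0_norm ?subr_ge0 // lerD2r.
have -> : df r * (s - t) - (s - t) * df t = (df r - df t) * (s - t) by ring.
rewrite normrM expr2 mulrA ler_wpM2r //.
by rewrite (le_trans (lip r t)) // ler_wpM2l.
Qed.

Lemma is_derive_quadratic (f : R -> R) (t v C e : R) : 0 < e ->
  (forall h, `|h| < e -> `|f (h + t) - f t - h * v| <= C * `|h| ^+ 2) ->
  is_derive t 1 f v.
Proof.
move=> e0 H; pose Lf (h : R) := h * v.
have Llin : linear Lf by move=> r x y; rewrite /Lf mulrDl -mulrA.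
pose LL := GRing.isLinear.Build _ _ _ _ Lf Llin.
pose L : {linear R -> R} := HB.pack Lf LL.
have Lc : continuous L.
  by move=> h; apply: (@continuousM _ _ id (cst v)) => //; exact: cst_continuous.
have [dF EL] : differentiable f t /\ 'd f t = L :> (R -> R).
  apply: (diff_epsP Lc) => b b0.
  have e1 : 0 < Num.min e (b / (`|C| + 1)).
    by rewrite lt_min e0 divr_gt0 // ltr_wpDl.
  apply: filterS (@nbhs0_lt R R _ e1) => h.
  rewrite lt_min => /andP[he hb].
  rewrite (le_trans (H h he)) // expr2 mulrA ler_wpM2r //.
  rewrite (le_trans (ler_wpM2r _ (ler_norm C))) //.
  rewrite (le_trans (ler_wpM2l _ (ltW hb))) // mulrA ler_pdivrMr ?ltr_wpDl //.
  by rewrite [_ * b]mulrC ler_wpM2l ?(ltW b0) // lerDl.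
apply: DeriveDef; first exact: diff_derivable.
by rewrite deriveE // EL /L /= /Lf mul1r.
Qed.

End RealLemmas.

(** * Distributions commute with fiber integrals *)

Section Fubini.
Context {R : realType} {p : nat}.
Notation mu := (@lebesgue_measure R).
Implicit Types (F G : 'cV[R]_(1 + p) -> R) (t l c d B : R) (x : 'cV[R]_p)
  (K : set 'cV[R]_(1 + p)) (V : set 'cV[R]_p) (u : @functional R p).

(** The domain of the families l |-> F(l, .) of test functions on V that are compactly supported in
    l as well. *)
Definition cylinder V : set 'cV[R]_(1 + p) := [set w | V (dsubmx w)].

Lemma smooth_map_dsubmx (U : set 'cV[R]_(1 + p)) : open U ->
  smooth_map U (@dsubmx R 1 p 1).
Proof.
move=> oU j; apply: eq_smooth_on (smooth_on_coord (rshift 1 j) oU) => // w _.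
by rewrite mxE.
Qed.

Lemma compact_dsubmx K : compact K -> compact (@dsubmx R 1 p 1 @` K).
Proof.
move=> cK; apply: (@compact_smooth_image _ _ _ setT) => //.
by apply: smooth_map_dsubmx; exact: openT.
Qed.

Lemma lam_bound K : compact K -> exists2 B, 0 < B & forall w, K w -> `|lam w| < B.
Proof.
move=> cK; have [B B0 HB] := smooth_on_bounded cK (@subsetT _ K)
  (@smooth_on_coord R (1 + p) setT ord0 openT).
exists (B + 1); first by rewrite ltr_wpDl.
by move=> w /HB wB; rewrite (le_lt_trans wB) // ltrDl.
Qed.

Lemma line_off K B F l x : (forall w, K w -> `|lam w| < B) -> vanishes_off K F ->
  B <= `|l| -> F (pt l x) = 0.
Proof. by move=> KB vF Bl; apply: vF => /KB; rewrite lam_pt ltNge Bl. Qed.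

Lemma fiber_on_pder c d F K s x : c <= d -> compact K -> vanishes_off K F ->
  smooth F -> pder s (fiber_on c d F) x =
    fiber_on c d (pder (map (@rshift 1 p) s) F) x.
Proof.
move=> cd cK; elim/last_ind: s F => // s i IH F vF sF.
rewrite map_rcons !pder_rcons.
have [vF' sF'] := test_pder [:: rshift 1 i] cK vF sF.
rewrite -IH //; congr (pder s _ x); apply/funext => y.
exact: (fiber_on_diff y cd cK vF sF).2.
Qed.

Lemma smooth_fiber_on c d F K : c <= d -> compact K -> vanishes_off K F ->
  smooth F -> smooth (fiber_on c d F).
Proof.
move=> cd cK vF sF s x.
have -> : pder s (fiber_on c d F) = fiber_on c d (pder (map (@rshift 1 p) s) F).
  by apply/funext => y; exact: (fiber_on_pder s y cd cK vF sF).
have [vF' sF'] := test_pder (map (@rshift 1 p) s) cK vF sF.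
exact: (fiber_on_diff x cd cK vF' sF').1.
Qed.

Lemma slice_off K F l : vanishes_off K F ->
  vanishes_off (@dsubmx R 1 p 1 @` K) (fun x => F (pt l x)).
Proof.
move=> vF x Kx; apply: vF => Kp; apply: Kx; exists (pt l x) => //.
exact: dsubmx_pt.
Qed.

Lemma fiber_on_off c d K F : vanishes_off K F ->
  vanishes_off (@dsubmx R 1 p 1 @` K) (fiber_on c d F).
Proof.
move=> vF x Kx; rewrite -(integ0 c d); apply: eq_integ => t _.
exact: (slice_off t vF).
Qed.

Lemma fiber_intE B F K : compact K -> (forall w, K w -> `|lam w| < B) ->
  vanishes_off K F -> fiber_int F = fiber_on (- B - 1) B F.
Proof.
move=> cK KB vF; apply/funext => x; apply: Int_integ => l.
rewrite in_itv /= => lB; apply: (line_off _ KB vF); rewrite leNgt.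
by apply: contra lB; rewrite ltr_norml => /andP[? ?]; apply/andP; split; lra.
Qed.

Lemma test_slice V F l : test_fun (cylinder V) F ->
  test_fun V (fun x => F (pt l x)).
Proof.
move=> [sF [K [cK KV vF]]]; split; first exact: smooth_slice.
exists (@dsubmx R 1 p 1 @` K); split; [exact: compact_dsubmx| |exact: slice_off].
by move=> _ [w /KV ? <-].
Qed.

Lemma test_fiber_on c d V F : c <= d -> test_fun (cylinder V) F ->
  test_fun V (fiber_on c d F).
Proof.
move=> cd [sF [K [cK KV vF]]]; split; first exact: (smooth_fiber_on cd cK vF sF).
exists (@dsubmx R 1 p 1 @` K); split; [exact: compact_dsubmx| |exact: fiber_on_off].
by move=> _ [w /KV ? <-].
Qed.

Lemma test_fiber V F : test_fun (cylinder V) F -> test_fun V (fiber_int F).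
Proof.
move=> tF; have [sF [K [cK KV vF]]] := tF; have [B B0 KB] := lam_bound cK.
by rewrite (fiber_intE cK KB vF); apply: test_fiber_on => //; lra.
Qed.

Lemma fiber_int_pder V F j x : test_fun (cylinder V) F ->
  pder [:: j] (fiber_int F) x = fiber_int (pder [:: rshift 1 j] F) x.
Proof.
move=> [sF [K [cK KV vF]]]; have [B B0 KB] := lam_bound cK.
have [vF' sF'] := test_pder [:: rshift 1 j] cK vF sF.
rewrite (fiber_intE cK KB vF) (fiber_intE cK KB vF').
by apply: (fiber_on_diff x _ cK vF sF).2; lra.
Qed.

Lemma distr_bound {m : nat} (U K : set 'cV[R]_m) (u : @functional R m) :
  is_distr U u -> compact K -> K `<=` U -> exists N, exists2 C : R, 0 <= C &
  forall f, smooth f -> vanishes_off K f -> forall M : R,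
    (forall s y, (size s <= N)%N -> `|pder s f y| <= M) -> `|u f| <= C * M.
Proof.
move=> [_ bu] cK KU; have [N [C H]] := bu K cK KU.
exists N, `|C| => // f sf vf M HM; rewrite (le_trans (H f sf vf M HM)) //.
have M0 : 0 <= M by rewrite (le_trans _ (HM [::] 0 _)).
by rewrite ler_wpM2r // ler_norm.
Qed.

Section Distr.
Variables (V : set 'cV[R]_p) (u : @functional R p).
Hypothesis du : is_distr V u.
Variable F : 'cV[R]_(1 + p) -> R.
Hypothesis tF : test_fun (cylinder V) F.

(** The difference of two slices, together with its derivatives up to the order N seen by u, is
    bounded by a multiple of |s - t|, so continuity of u carries the bound over. *)
Lemma slice_lipschitz : exists2 C : R, 0 <= C &
  forall s t, `|u (fun x => F (pt s x)) - u (fun x => F (pt t x))| <= C * `|s - t|.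
Proof.
have [sF [K [cK KV vF]]] := tF.
have KV' : (@dsubmx R 1 p 1 @` K) `<=` V by move=> _ [w /KV ? <-].
have [N [C C0 HC]] := distr_bound du (compact_dsubmx cK) KV'.
(* One order beyond N: the Lipschitz constants of the derivatives of order N are bounds on those of
   order N + 1. *)
have [M M0 HM] := smooth_compact_bound N.+1 cK vF sF.
pose D := (1 + p)%:R * M * `|pt 1 0 : 'cV[R]_(1 + p)|.
have D0 : 0 <= D by rewrite !mulr_ge0.
exists (C * D); first by rewrite mulr_ge0.
move=> s t.
have E : u (fun x => F (pt s x)) - u (fun x => F (pt t x)) =
    u (fun x => F (pt s x) + (-1) * F (pt t x)).
  rewrite (distrD du (test_slice s tF) (test_funZ (-1) (test_slice t tF))).
  by rewrite (distrZ _ du (test_slice t tF)) mulN1r.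
have sS := smooth_slice _ sF.
rewrite E -mulrA; apply: HC.
- apply/smooth_onT; apply: smooth_onD; [exact: openT|exact/smooth_onT|].
  apply: smooth_onM; [exact: openT|exact: smooth_on_cst|exact/smooth_onT].
- move=> x Kx; rewrite !(slice_off _ vF) // mulr0 addr0 //.
move=> r x rN.
rewrite (@pderD _ _ setT) ?(@pderZ _ _ setT) //;
  try (by apply/smooth_onT); try exact: openT; last first.
  by apply: smooth_onM; [exact: openT|exact: smooth_on_cst|exact/smooth_onT].
rewrite !pder_slice // mulN1r.
have [vF' sF'] := test_pder (map (@rshift 1 p) r) cK vF sF.
have -> : pt s x = (s - t) *: pt 1 0 + pt t x.
  by rewrite (pt_line s) (pt_line t) addrA -scalerDl subrK.
have HM' j y : `|pder [:: j] (pder (map (@rshift 1 p) r) F) y| <= M.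
  by rewrite -pder_cat; apply: HM; rewrite /= size_map.
rewrite (le_trans (@lipschitz_bound _ _ _ M _ _ (sF' [::]) HM')) //.
by rewrite normrZ /D [`|s - t| * _]mulrC mulrA lexx.
Qed.

Lemma slice_continuous : continuous (fun t => u (fun x => F (pt t x))).
Proof.
have [C C0 HC] := slice_lipschitz => t.
apply/cvgrPdist_le => e e0.
have e1 : 0 < e / (C + 1) by rewrite divr_gt0 // ltr_wpDl.
have := @nbhsx_ballx R R t _ e1; apply: filterS => s.
rewrite /ball /= => ts; rewrite (le_trans (HC t s)) //.
rewrite (le_trans (ler_wpM2l C0 (ltW ts))) // mulrA ler_pdivrMr ?ltr_wpDl //.
by rewrite [C * e]mulrC ler_wpM2l ?(ltW e0) // lerDl.
Qed.

(** The remainder J(t + h) - J(t) - h F(t, .) of the partial fiber integral J is a test function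
    whose derivatives up to order N are all O(h^2), uniformly in x. Continuity of u makes the
    remainder of the real function u(J) quadratic too. *)
Lemma fiber_on_derive c t : c < t ->
  is_derive t 1 (fun s => u (fiber_on c s F)) (u (fun x => F (pt t x))).
Proof.
move=> ct; have [sF [K [cK KV vF]]] := tF.
have KV' : (@dsubmx R 1 p 1 @` K) `<=` V by move=> _ [w /KV ? <-].
have [N [C C0 HC]] := distr_bound du (compact_dsubmx cK) KV'.
have [M M0 HM] := smooth_compact_bound N.+1 cK vF sF.
pose D := (1 + p)%:R * M * `|pt 1 0 : 'cV[R]_(1 + p)|.
(* The radius t - c keeps h + t to the right of the base point c. *)
apply: (@is_derive_quadratic _ _ _ _ (C * D) (t - c)); first lra.
move=> h hct.
have cth : c < h + t by move: hct; rewrite ltr_norml => /andP[? _]; lra.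
have tJ1 : test_fun V (fiber_on c (h + t) F) by apply: test_fiber_on => //; lra.
have tJ2 : test_fun V (fiber_on c t F) by apply: test_fiber_on => //; lra.
have tS := test_slice t tF.
have E : u (fiber_on c (h + t) F) - u (fiber_on c t F) - h * u (fun x => F (pt t x))
   = u (fun x => (fiber_on c (h + t) F x + (-1) * fiber_on c t F x)
                 + (- h) * F (pt t x)).
  have t1 := test_funZ (-1) tJ2; have t2 := test_funZ (- h) tS.
  rewrite (distrD du (test_funD tJ1 t1) t2) (distrD du tJ1 t1).
  by rewrite (distrZ _ du tJ2) (distrZ _ du tS) mulN1r mulNr.
have sT f : test_fun V f -> smooth_on setT f by move=> /test_smooth/smooth_onT.
have sZ (r : R) f : smooth_on setT f -> smooth_on setT (fun x : 'cV[R]_p => r * f x).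
  by move=> sf; apply: smooth_onM => //; [exact: openT|exact: smooth_on_cst].
have s1 := sT _ tJ1; have s2 := sZ (-1) _ (sT _ tJ2); have s3 := sZ (- h) _ (sT _ tS).
have s12 := smooth_onD openT s1 s2.
rewrite E -mulrA; apply: HC.
- by apply/smooth_onT; exact: (smooth_onD openT s12 s3).
- move=> x Kx; rewrite !(fiber_on_off _ _ vF) // (slice_off _ vF) //.
  by rewrite !mulr0 !addr0.
move=> r x rN.
rewrite (pderD _ openT s12 s3 I) (pderD _ openT s1 s2 I).
rewrite (pderZ _ _ openT (sT _ tJ2) I) (pderZ _ _ openT (sT _ tS) I).
rewrite !(@fiber_on_pder _ _ _ K) //; try lra.
rewrite pder_slice // mulN1r mulNr.
have [vF' sF'] := test_pder (map (@rshift 1 p) r) cK vF sF.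
set G := pder _ F in vF' sF' *.
(* For fixed x, the primitive s |-> [fiber_on c s G x] has derivative G(s, x), which is Lipschitz in
   s with the constant D, independent of x. *)
have := @quadratic_error _ c D (fun s => fiber_on c s G x) (fun s => G (pt s x)).
have -> : h = h + t - t by rewrite addrK.
rewrite subrK; apply=> //.
  by move=> s cs; apply: integ_deriv => //; exact: continuous_line.
move=> s s'.
have -> : pt s x = (s - s') *: pt 1 0 + pt s' x.
  by rewrite (pt_line s) (pt_line s') addrA -scalerDl subrK.
have HM' j y : `|pder [:: j] G y| <= M.
  by rewrite /G -pder_cat; apply: HM; rewrite /= size_map.
rewrite (le_trans (@lipschitz_bound _ _ _ M _ _ (sF' [::]) HM')) //.
by rewrite normrZ /D [`|s - s'| * _]mulrC mulrA lexx.
Qed.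

(** The fundamental theorem of calculus for t |-> u([fiber_on] up to t): its increment over
    [[-B, B]] is the integral of the slice values. *)
Lemma distr_fubini :
  Rintegral mu setT (fun t => u (fun x => F (pt t x))) = u (fiber_int F).
Proof.
have [sF [K [cK KV vF]]] := tF; have [B B0 KB] := lam_bound cK.
rewrite (fiber_intE cK KB vF) (@Int_integ _ (- B) B); last first.
  move=> t; rewrite in_itv /= => tB.
  rewrite -(distr0 du); congr u; apply/funext => x.
  apply: (line_off _ KB vF); rewrite leNgt.
  by apply: contra tB; rewrite ltr_norml => /andP[? ?]; apply/andP; split; lra.
have BB : - B < B by lra.
have dB t : t \in `[- B, B] -> is_derive t 1
    (fun s => u (fiber_on (- B - 1) s F)) (u (fun x => F (pt t x))).
  by rewrite in_itv /= => /andP[? ?]; apply: fiber_on_derive; lra.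
have := integ_prim BB (continuous_subspaceT slice_continuous) dB.
(* The base point -B - 1 lies strictly left of -B, so the primitive is differentiable at -B; it is 0
   there because F vanishes for l <= -B. *)
move=> ->; rewrite (_ : u (fiber_on _ (- B) F) = 0) ?subr0 //.
rewrite -(distr0 du); congr u; apply/funext => x.
rewrite -(integ0 (- B - 1) (- B)); apply: eq_integ => l /andP[_ lB].
by apply: (line_off _ KB vF); rewrite ler0_norm; lra.
Qed.

End Distr.

Lemma fiber_intD V F G x : test_fun (cylinder V) F -> test_fun (cylinder V) G ->
  fiber_int (fun w => F w + G w) x = fiber_int F x + fiber_int G x.
Proof.
move=> [sF [K [cK KV vF]]] [sG [L [cL LV vG]]].
have [B B0 KB] := lam_bound (compactU cK cL).
have vF' : vanishes_off (K `|` L) F by move=> w /not_orP[Kw _]; exact: vF.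
have vG' : vanishes_off (K `|` L) G by move=> w /not_orP[_ Lw]; exact: vG.
have vFG : vanishes_off (K `|` L) (fun w => F w + G w).
  by move=> w Kw; rewrite vF' // vG' // addr0.
have cKL := compactU cK cL.
rewrite (fiber_intE cKL KB vF') (fiber_intE cKL KB vG') (fiber_intE cKL KB vFG).
by apply: integD; exact: continuous_line.
Qed.

Lemma fiber_intZ V F r x : test_fun (cylinder V) F ->
  fiber_int (fun w => r * F w) x = r * fiber_int F x.
Proof.
move=> [sF [K [cK KV vF]]]; have [B B0 KB] := lam_bound cK.
have vF' : vanishes_off K (fun w => r * F w) by move=> w Kw; rewrite vF // mulr0.
rewrite (fiber_intE cK KB vF) (fiber_intE cK KB vF').
by apply: integZ; exact: continuous_line.
Qed.

(** On functions supported in a fixed compact set, the fiber integral runs over one bounded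
    interval, whose length enters the continuity constant. *)
Lemma fiber_int_distr V u : is_distr V u ->
  is_distr (cylinder V) (fun F => u (fiber_int F)).
Proof.
move=> du; split=> [r F G tF tG|K cK KV].
  rewrite -(distrZ _ du (test_fiber tF)) -(distrD du); last 2 first.
  - by apply: test_funZ; exact: test_fiber.
  - exact: test_fiber.
  congr u; apply/funext => x; rewrite -(fiber_intZ r x tF) -(fiber_intD x (V := V)) //.
  exact: test_funZ.
have KV' : (@dsubmx R 1 p 1 @` K) `<=` V by move=> _ [w /KV ? <-].
have [N [C C0 HC]] := distr_bound du (compact_dsubmx cK) KV'.
have [B B0 KB] := lam_bound cK.
exists N, (C * (B - (- B - 1))) => F sF vF M HM.
have tF : test_fun (cylinder V) F by split=> //; exists K.
have BB : - B - 1 <= B by lra.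
rewrite -mulrA; apply: HC.
- exact: (test_fiber tF).1.
- by rewrite (fiber_intE cK KB vF); exact: fiber_on_off.
move=> s x sN; rewrite (fiber_intE cK KB vF) (fiber_on_pder _ _ BB cK vF sF) mulrC.
apply: integ_bound => //.
  by apply: continuous_line; exact: (test_pder _ cK vF sF).2.
by move=> t; apply: HM; rewrite size_map.
Qed.

End Fubini.

(** * Homogeneous distributions *)

Section LocalSmooth.
Context {R : realType} {m : nat}.
Implicit Types (U : set 'cV[R]_m) (f g : 'cV[R]_m -> R) (x y : 'cV[R]_m).

Lemma smooth_on_local U f : open U ->
  (forall x, U x -> exists2 g, smooth_on U g & \forall y \near x, g y = f y) ->
  smooth_on U f.
Proof.
move=> oU H s x Ux; have [g sg E] := H x Ux.
by apply: differentiable_near (sg s x Ux); exact: near_pder.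
Qed.

Lemma open_preimage p (W : set 'cV[R]_m) (V : set 'cV[R]_p) q : open W ->
  smooth_map W q -> open V -> open [set x | W x /\ V (q x)].
Proof.
move=> oW sq oV; rewrite openE => x [Wx Vqx]; rewrite /interior /=.
have cq := smooth_map_continuous sq Wx.
have H1 : nbhs x W by exact: open_nbhs_nbhs.
have H2 : nbhs x (q @^-1` V) by apply: cq; exact: open_nbhs_nbhs.
exact: filterI H1 H2.
Qed.

Lemma open_preimageR (W : set 'cV[R]_m) (V : set R) f : open W ->
  smooth_on W f -> open V -> open [set x | W x /\ V (f x)].
Proof.
move=> oW sf oV; rewrite openE => x [Wx Vqx]; rewrite /interior /=.
have cq := differentiable_continuous (smooth_on_diff sf Wx).
have H1 : nbhs x W by exact: open_nbhs_nbhs.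
have H2 : nbhs x (f @^-1` V) by apply: cq; exact: open_nbhs_nbhs.
exact: filterI H1 H2.
Qed.

Lemma near_sg U f x : smooth_on U f -> U x -> f x != 0 ->
  \forall y \near x, Num.sg (f y) = Num.sg (f x).
Proof.
move=> sf Ux fx; have cq := differentiable_continuous (smooth_on_diff sf Ux).
have [fn|fp|/eqP] := ltgtP (f x) 0; last by rewrite (negbTE fx).
- have H : \forall y \near x, f y < 0 :=
    cq [set r | r < 0] (open_nbhs_nbhs (conj (@open_lt R 0) fn)).
  by apply: filterS H => y /= yn; rewrite !ltr0_sg.
- have H : \forall y \near x, f y > 0 :=
    cq [set r | r > 0] (open_nbhs_nbhs (conj (@open_gt R 0) fp)).
  by apply: filterS H => y /= yn; rewrite !gtr0_sg.
Qed.

Lemma smooth_on_sg U f : open U -> smooth_on U f -> (forall x, U x -> f x != 0) ->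
  smooth_on U (fun x => Num.sg (f x)).
Proof.
move=> oU sf f0; apply: smooth_on_local => // x Ux.
exists (fun=> Num.sg (f x)); first exact: smooth_on_cst.
apply: filterS (near_sg sf Ux (f0 x Ux)) => y; exact: esym.
Qed.

Lemma smooth_on_norm U f : open U -> smooth_on U f ->
  (forall x, U x -> f x != 0) -> smooth_on U (fun x => `|f x|).
Proof.
move=> oU sf f0; have := smooth_onM oU (smooth_on_sg oU sf f0) sf.
by apply: eq_smooth_on => // x _; rewrite -normrEsg.
Qed.

Lemma pder1_comp1 (phi dphi : R -> R) g i x :
  is_derive (g x) 1 phi (dphi (g x)) -> differentiable g x ->
  differentiable (fun y => phi (g y)) x /\
  pder [:: i] (fun y => phi (g y)) x = dphi (g x) * pder [:: i] g x.
Proof.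
move=> [d1 d2] dg; have dphi' : differentiable phi (g x) by exact/derivable1_diffP.
have dc : differentiable (phi \o g) x by exact: differentiable_comp.
split=> //; rewrite dE // -[fun y => phi (g y)]/(phi \o g) diff_comp //= dE //.
set v := 'd g x _; rewrite -[v in LHS]mulr1 -/(v *: 1) linearZ /= -deriveE // d2.
by rewrite mulrC.
Qed.

End LocalSmooth.

(** * A smooth bump of integral one supported in [1, 2] *)

Section Bump.
Context {R : realType}.
Notation mu := (@lebesgue_measure R).
Implicit Types (P : {poly R}) (t y : R).

Definition flat P t : R := if 0 < t then P.[t^-1] * expR (- t^-1) else 0.

(** For t > 0 the derivative of P(1/t) exp(-1/t) is t^(-2) (P - P')(1/t) exp(-1/t), so the family
    [flat] is closed under differentiation. *)
Definition flat_deriv P : {poly R} := 'X^2 * (P - P^`()).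

Lemma pow_le_expR k y : 0 < y -> y ^+ k <= k`!%:R * expR y.
Proof.
move=> y0; case: k => [|k].
  by rewrite expr0 mul1r (le_trans _ (expR_ge1Dx y)) // lerDl ltW.
rewrite mulrC -ler_pdivrMr ?ltr0n ?fact_gt0 //.
by rewrite (le_trans _ (expR_ge1Dxn k (ltW y0))) // lerDr.
Qed.

(** A quadratic bound is exactly what gives derivative 0 at the origin, for every P and hence for
    all the iterated derivatives. *)
Lemma flat_quadratic P : exists C : R, forall t, `|flat P t| <= C * `|t| ^+ 2.
Proof.
(* With y = 1/t, the inequality y^k <= k! exp(y) is used for k = i + 2: i from the monomial, 2 from
   dividing by t^2. *)
pose C := \sum_(i < size P) `|P`_i| * (i.+2)`!%:R.
have C0 : 0 <= C by apply: sumr_ge0 => i _; rewrite mulr_ge0.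
exists C => t; rewrite /flat; case: ifPn => [t0|_]; last first.
  by rewrite normr0 mulr_ge0 // exprn_ge0.
set y := t^-1; have y0 : 0 < y by rewrite invr_gt0.
have -> : `|t| = y^-1 by rewrite gtr0_norm // invrK.
rewrite exprVn ler_pdivlMr ?exprn_gt0 // normrM (gtr0_norm (expR_gt0 _)).
rewrite horner_coef mulrAC expRN ler_pdivrMr ?expR_gt0 //.
rewrite (le_trans (ler_wpM2r _ (ler_norm_sum _ _ _))) ?exprn_ge0 ?(ltW y0) //.
rewrite !mulr_suml. apply: ler_sum => i _.
rewrite normrM -!mulrA ler_wpM2l // normrX gtr0_norm // -exprD addn2.
exact: pow_le_expR.
Qed.

Lemma is_derive_flat P t : is_derive t 1 (flat P) (flat (flat_deriv P) t).
Proof.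
have [tn|tp|->] := ltgtP t 0; last first.
- have [C HC] := flat_quadratic P.
  rewrite {2}/flat ltxx; apply: (@is_derive_quadratic _ _ _ _ C 1) => // h _.
  by rewrite addr0 {2}/flat ltxx subr0 mulr0 subr0.
- rewrite {2}/flat tp.
  have E : \forall s \near t, P.[s^-1] * expR (- s^-1) = flat P s.
    have H := open_nbhs_nbhs (conj (@open_gt R 0) tp).
    by apply: filterS H => s /= s0; rewrite /flat s0.
  apply: near_eq_is_derive E _.
  have t0 : t != 0 by rewrite gt_eqF.
  have dV : is_derive t 1 (fun s : R => s^-1) (- t ^- 2 *: 1) by apply: is_deriveV.
  have dNV : is_derive t 1 (fun s : R => - s^-1) (- (- t ^- 2 *: 1)).
    exact: is_deriveN.
  have dP : is_derive (t^-1) 1 (horner P) P^`().[t^-1] by exact: is_derive_poly.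
  have d1 := @is_derive1_comp _ (horner P) (fun s : R => s^-1) _ _ _ dP dV.
  have d2 := @is_derive1_comp _ expR (fun s : R => - s^-1) _ _ _
    (is_derive_expR _) dNV.
  have X : is_derive t 1 (fun s => P.[s^-1] * expR (- s^-1)) _ := is_deriveM d1 d2.
  apply: (is_derive_eq X); rewrite /flat_deriv !hornerE /GRing.scale /= !mulr1.
  by rewrite -exprVn /=; ring.
- rewrite {2}/flat ltNge (ltW tn) /=.
  have E : \forall s \near t, cst 0 s = flat P s.
    have H := open_nbhs_nbhs (conj (@open_lt R 0) tn).
    by apply: filterS H => s /= s0; rewrite /flat ltNge (ltW s0).
  apply: near_eq_is_derive E _; exact: is_derive_cst.
Qed.

Lemma smooth_on_flat {m} (U : set 'cV[R]_m) P (g : 'cV[R]_m -> R) : open U ->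
  smooth_on U g -> smooth_on U (fun w => flat P (g w)).
Proof.
move=> oU sg; apply/smooth_onE => k.
have D Q i x : U x -> differentiable (fun w => flat Q (g w)) x /\
    pder [:: i] (fun w => flat Q (g w)) x = flat (flat_deriv Q) (g x) * pder [:: i] g x.
  by move=> Ux; apply: pder1_comp1; [exact: is_derive_flat|exact: smooth_on_diff Ux].
have D0 Q x : U x -> differentiable (fun w => flat Q (g w)) x.
  move=> Ux; apply: (@differentiable_comp _ _ _ _ g (flat Q)).
    exact: smooth_on_diff Ux.
  by apply/derivable1_diffP; have [] := is_derive_flat Q (g x).
elim: k P => [|k IH] P; first by apply/smooth_upto0; exact: D0.
apply/smooth_uptoS; split; first exact: D0.
move=> i; have si : smooth_upto k U (pder [:: i] g).
  by move: (smooth_on_pder [:: i] sg) => /smooth_onE; exact.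
apply: eq_smooth_upto (smooth_uptoM oU (IH (flat_deriv P)) si) => // x Ux.
by rewrite (D P i x Ux).2.
Qed.

(** A smooth transition from 0 on t <= 1 to 1 on t >= 2. *)
Definition step t : R := flat 1 (t - 1) / (flat 1 (t - 1) + flat 1 (2 - t)).

Lemma flat1_ge0 t : 0 <= flat 1 t.
Proof. by rewrite /flat; case: ifP => //; rewrite hornerC mul1r expR_ge0. Qed.

Lemma flat1_gt0 t : 0 < t -> 0 < flat 1 t.
Proof. by move=> t0; rewrite /flat t0 hornerC mul1r expR_gt0. Qed.

Lemma flat_le0 P t : t <= 0 -> flat P t = 0.
Proof. by rewrite /flat ltNge => ->. Qed.

Lemma step_denom_gt0 t : 0 < flat 1 (t - 1) + flat 1 (2 - t).
Proof.
have [t1|t1] := ltP 1 t.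
  by rewrite ltr_pwDl ?flat1_ge0 // flat1_gt0 // subr_gt0.
by rewrite ltr_wpDl ?flat1_ge0 // flat1_gt0 //; lra.
Qed.

Lemma step_le1 t : t <= 1 -> step t = 0.
Proof. by move=> t1; rewrite /step flat_le0 ?mul0r // subr_le0. Qed.

Lemma step_ge2 t : 2 <= t -> step t = 1.
Proof.
move=> t2; have := step_denom_gt0 t.
by rewrite /step [flat 1 (2 - t)]flat_le0 ?subr_le0 // addr0 => ?; rewrite divff ?gt_eqF.
Qed.

Lemma smooth_on_step {m} (U : set 'cV[R]_m) (g : 'cV[R]_m -> R) : open U ->
  smooth_on U g -> smooth_on U (fun w => step (g w)).
Proof.
move=> oU sg.
have s1 : smooth_on U (fun w => flat 1 (g w - 1)).
  by apply: smooth_on_flat => //; apply: smooth_onD => //; exact: smooth_on_cst.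
have s2 : smooth_on U (fun w => flat 1 (2 - g w)).
  apply: smooth_on_flat => //; apply: smooth_onD => //; first exact: smooth_on_cst.
  exact: smooth_onN.
apply: smooth_onM => //; apply: smooth_onV => //; last exact: smooth_onD.
by move=> x _; rewrite gt_eqF // step_denom_gt0.
Qed.

(** As the derivative of a transition from 0 to 1, the bump has integral 1 without any normalizing
    constant. *)
Definition bump_fun t : R := derive1 step t.

Lemma is_derive_step t : is_derive t 1 step (bump_fun t).
Proof.
have := @smooth_on_step 1 setT (fun w => w ord0 ord0) openT (smooth_on_coord _ openT).
move=> /(_ [::] (t%:M) I) d; rewrite /bump_fun derive1E; apply: derivableP.
apply/derivable1_diffP.
(* Smoothness is established for functions on column vectors; the real line is identified with
   vectors of size 1. *)
have E : step = (fun w : 'cV[R]_1 => step (w ord0 ord0)) \o (fun s : R => s *: 1%:M).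
  by apply/funext => s /=; rewrite !mxE eqxx mulr1.
rewrite E; apply: differentiable_comp; last by rewrite scalemx1.
exact: differentiableZl.
Qed.

Lemma bump_out t : t \notin `[1, 2] -> bump_fun t = 0.
Proof.
rewrite in_itv /= negb_and -!ltNge /bump_fun derive1E => /orP[t1|t2].
  have E : \forall s \near t, step s = cst 0 s.
    have H := open_nbhs_nbhs (conj (@open_lt R 1) t1).
    by apply: filterS H => s /= s0; rewrite step_le1 // ltW.
  by rewrite (near_eq_derive _ E) derive_cst.
have E : \forall s \near t, step s = cst 1 s.
  have H := open_nbhs_nbhs (conj (@open_gt R 2) t2).
  by apply: filterS H => s /= s0; rewrite step_ge2 // ltW.
by rewrite (near_eq_derive _ E) derive_cst.
Qed.

Lemma smooth_on_bump {m} (U : set 'cV[R]_m) (g : 'cV[R]_m -> R) : open U ->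
  smooth_on U g -> smooth_on U (fun w => bump_fun (g w)).
Proof.
(* The bump is the partial derivative of a smooth function of one coordinate, hence smooth, and the
   general case follows by composition. *)
move=> oU sg; pose f (w : 'cV[R]_1) := step (w ord0 ord0).
have sf : smooth_on setT f by apply: smooth_on_step; [exact: openT|exact: smooth_on_coord openT].
have E (w : 'cV[R]_1) : pder [:: ord0] f w = bump_fun (w ord0 ord0).
  have dw := @differentiable_coord R 1 1 w ord0 ord0.
  have [_ ->] := pder1_comp1 ord0 (is_derive_step (w ord0 ord0)) dw.
  by rewrite pder1_coord eqxx mulr1.
have H : smooth_on U (fun w => pder [:: ord0] f (g w)%:M).
  apply: (@smooth_on_comp _ _ _ U setT _ (fun w => (g w)%:M)) => //.
    move=> j; apply: eq_smooth_on sg => // w _.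
    by rewrite ord1 mxE eqxx.
  exact: smooth_on_pder.
by apply: eq_smooth_on H => // w _; rewrite E mxE eqxx.
Qed.

Lemma bump_continuous : continuous bump_fun.
Proof.
move=> t; have := @smooth_on_bump 1 setT (fun w => w ord0 ord0) openT (smooth_on_coord _ openT).
move=> /(_ [::] (t%:M) I) d; apply: differentiable_continuous.
have E : bump_fun = (fun w : 'cV[R]_1 => bump_fun (w ord0 ord0)) \o (fun s : R => s *: 1%:M).
  by apply/funext => s /=; rewrite !mxE eqxx mulr1.
rewrite E; apply: differentiable_comp; last by rewrite scalemx1.
exact: differentiableZl.
Qed.

Lemma Int_bump : Rintegral mu setT bump_fun = 1.
Proof.
rewrite (Int_integ bump_out).
have := @integ_prim R 1 2 bump_fun step _ (continuous_subspaceT bump_continuous)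
  (fun t _ => is_derive_step t).
by rewrite step_ge2 // step_le1 // subr0; apply; lra.
Qed.

End Bump.

Section SmoothMaps.
Context {R : realType} {m p : nat}.
Implicit Types (U : set 'cV[R]_m) (a : 'cV[R]_m -> R) (q : 'cV[R]_m -> 'cV[R]_p).

Lemma smooth_on_lam (U : set 'cV[R]_(1 + m)) : open U -> smooth_on U (@lam R m).
Proof. exact: smooth_on_coord. Qed.

Lemma smooth_map_id U : open U -> smooth_map U (fun x => x).
Proof. by move=> oU j; exact: smooth_on_coord. Qed.

Lemma smooth_map_pt U a q : smooth_on U a -> smooth_map U q ->
  smooth_map U (fun x => pt (a x) (q x)).
Proof.
move=> sa sq k; have [->|[j ->]] := ord_1D k.
  by under [fun _ => _]funext do rewrite pt_head.
by under [fun _ => _]funext do rewrite pt_tail; exact: sq.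
Qed.

Lemma smooth_map_scale U a q : open U -> smooth_on U a -> smooth_map U q ->
  smooth_map U (fun x => a x *: q x).
Proof.
move=> oU sa sq j; under [fun _ => _]funext do rewrite mxE.
exact: smooth_onM.
Qed.

Lemma smooth_map_mulmx U k (A : 'M[R]_(k, p)) q : open U -> smooth_map U q ->
  smooth_map U (fun x => A *m q x).
Proof.
move=> oU sq j; under [fun _ => _]funext do rewrite mxE.
apply: smooth_on_sum => // i; apply: smooth_onM => //; exact: smooth_on_cst.
Qed.

Lemma smooth_map_tail U (q : 'cV[R]_m -> 'cV[R]_(1 + p)) : smooth_map U q ->
  smooth_map U (fun x => dsubmx (q x)).
Proof.
by move=> sq j; under [fun _ => _]funext do rewrite mxE; exact: sq.
Qed.

Lemma smooth_map_affine U (q : 'cV[R]_m -> 'cV[R]_(1 + p)) : open U ->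
  smooth_map U q -> (forall x, U x -> lam (q x) != 0) ->
  smooth_map U (fun x => affine_part (q x)).
Proof.
move=> oU sq q0; apply: smooth_map_scale => //.
  by apply: smooth_onV => //; exact: sq.
exact: smooth_map_tail.
Qed.

Lemma smooth_mapS U U' q : U' `<=` U -> smooth_map U q -> smooth_map U' q.
Proof. by move=> UU sq j; exact: smooth_onS UU (sq j). Qed.

End SmoothMaps.

(** * Criteria for proper weights *)

Section ProperWeights.
Context {R : realType} {m p : nat}.
Implicit Types (U : set 'cV[R]_m) (V W : set 'cV[R]_p)
  (a : 'cV[R]_p -> R) (q : 'cV[R]_p -> 'cV[R]_m).

(** Case where q is injective on the support of a, with inverse r: the new support lies in the
    compact set r(K). *)
Lemma proper_weight_image U V W a q (r : 'cV[R]_m -> 'cV[R]_p) :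
  open W -> W `<=` V -> smooth_on W a -> smooth_map W q ->
  smooth_map U r -> (forall x, U x -> W (r x)) ->
  (forall y, a y != 0 -> U (q y) -> y = r (q y)) ->
  proper_weight U V a q.
Proof.
move=> oW WV sa sq sr rW rq; exists W; split=> // K cK KU.
exists (r @` K); split.
- exact: compact_smooth_image cK KU sr.
- by move=> _ [x /KU/rW Wx <-].
- by move=> y ay Kq; rewrite (rq y ay (KU _ Kq)); exists (q y).
Qed.

Lemma compact_box (K : set 'cV[R]_m) (c d : R) : compact K ->
  compact [set w : 'cV[R]_(1 + m) | c <= lam w <= d /\ K (dsubmx w)].
Proof.
move=> cK; pose g (z : R * 'cV[R]_m) : 'cV[R]_(1 + m) := z.1 *: pt 1 0 + pt 0 z.2.
have -> : [set w : 'cV[R]_(1 + m) | c <= lam w <= d /\ K (dsubmx w)] =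
    g @` (`[c, d] `*` K).
  apply/seteqP; split=> [w [wcd Kw]|_ [[s x] [/= scd Kx] <-]].
    exists (lam w, dsubmx w); first by split=> //=; rewrite in_itv.
    by rewrite /g /= -pt_line -pt_eta.
  by rewrite /g /= -pt_line lam_pt dsubmx_pt; split.
apply: continuous_compact; last first.
  by apply: compact_setX => //; exact: segment_compact.
apply: continuous_subspaceT => z.
have c1 : {for z, continuous (fun z : R * 'cV[R]_m => z.1 *: (pt 1 0 : 'cV[R]_(1 + m)))}.
  apply: (@continuous_comp _ _ _ fst (fun s : R => s *: (pt 1 0 : 'cV[R]_(1 + m)))).
    exact: cvg_fst.
  exact: scalel_continuous.
have c2 : {for z, continuous (fun z : R * 'cV[R]_m => (pt 0 z.2 : 'cV[R]_(1 + m)))}.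
  apply: (@continuous_comp _ _ _ snd (pt 0)); first exact: cvg_snd.
  apply: (@smooth_map_continuous _ _ _ setT) => //.
  apply: smooth_map_pt; first exact: smooth_on_cst.
  by apply: smooth_map_id; exact: openT.
exact: (continuousD c1 c2).
Qed.

(** Case where q has one-dimensional fibers: a confines the fiber parameter s to [[c, d]], and the
    new support lies in the image under r of a compact box. *)
Lemma proper_weight_box U V W a q (r : 'cV[R]_(1 + m) -> 'cV[R]_p) (c d : R) :
  open W -> W `<=` V -> smooth_on W a -> smooth_map W q ->
  smooth_map [set w | c <= lam w <= d /\ U (dsubmx w)] r ->
  (forall s x, c <= s <= d -> U x -> W (r (pt s x))) ->
  (forall y, a y != 0 -> U (q y) -> exists2 s, c <= s <= d & y = r (pt s (q y))) ->
  proper_weight U V a q.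
Proof.
move=> oW WV sa sq sr rW rq; exists W; split=> // K cK KU.
exists (r @` [set w | c <= lam w <= d /\ K (dsubmx w)]); split.
- apply: compact_smooth_image (@compact_box K c d cK) _ sr.
  by move=> w [? /KU].
- move=> _ [w [wcd /KU Uw] <-]; rewrite (pt_eta w); exact: rW.
- move=> y ay Kq; have [s scd ->] := rq y ay (KU _ Kq).
  by exists (pt s (q y)) => //; rewrite /= lam_pt dsubmx_pt.
Qed.

End ProperWeights.

(** * Cones, cylinder coordinates and lifts *)

Section Cone.
Context {R : realType} {n : nat}.
Implicit Types (U : set 'cV[R]_n) (w : 'cV[R]_(1 + n)).

Lemma open_lam_neq0 : open [set w : 'cV[R]_(1 + n) | lam w != 0].
Proof.
have -> : [set w : 'cV[R]_(1 + n) | lam w != 0] =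
    [set w | setT w /\ [set r : R | r != 0] (lam w)].
  by apply/seteqP; split=> w //= [].
exact: (open_preimageR openT (smooth_on_lam openT) (@open_neq R 0)).
Qed.

Lemma smooth_map_affine_part :
  smooth_map [set w : 'cV[R]_(1 + n) | lam w != 0] (@affine_part R n).
Proof.
apply: (@smooth_map_affine _ _ _ _ (fun w => w)) => //.
  exact: open_lam_neq0.
by apply: smooth_map_id; exact: open_lam_neq0.
Qed.

Lemma open_cone_over U : open U -> open (cone_over U).
Proof. exact: (open_preimage open_lam_neq0 smooth_map_affine_part). Qed.

Lemma cone_overZ U a w : a != 0 -> cone_over U w -> cone_over U (a *: w).
Proof.
move=> a0 [w0 Uw]; split; first by rewrite lam_scale mulf_neq0.
by rewrite affine_part_scale.
Qed.

Lemma cone_over_pt U l x : l != 0 -> U x -> cone_over U (pt l (l *: x)).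
Proof.
move=> l0 Ux; split; first by rewrite lam_pt.
by rewrite affine_part_pt scalerA mulVf // scale1r.
Qed.

(** The chart (l, x) |-> (l, l x), from the part l != 0 of the cylinder over U onto the cone over
    U. *)
Definition slope w : 'cV[R]_(1 + n) := pt (lam w) (lam w *: dsubmx w).

Lemma smooth_map_slope (W : set 'cV[R]_(1 + n)) : open W -> smooth_map W slope.
Proof.
move=> oW; apply: smooth_map_pt; first exact: smooth_on_lam.
by apply: smooth_map_scale => //; [exact: smooth_on_lam|exact: smooth_map_dsubmx].
Qed.

(** The weight m(l) of the overview: |l|^n is the Jacobian of [slope], and l^(-n-1) is the
    homogeneity factor. *)
Definition jac (l : R) : R := `|l| ^+ n * l ^- n.+1.

Definition cone_lift (f : 'cV[R]_(1 + n) -> R) w : R := jac (lam w) * f (slope w).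

Lemma jac_pos l : 0 < l -> jac l = l^-1.
Proof.
move=> l0; rewrite /jac gtr0_norm // exprS invfM mulrCA divff ?mulr1 //.
by rewrite expf_neq0 // gt_eqF.
Qed.

Lemma lift_proper U : open U ->
  proper_weight (cone_over U) (cylinder U) (fun w => jac (lam w)) slope.
Proof.
move=> oU; pose W := [set w | lam w != 0 /\ U (dsubmx w)].
have oW : open W.
  apply: open_preimage oU; first exact: open_lam_neq0.
  apply: smooth_map_dsubmx; exact: open_lam_neq0.
apply: (@proper_weight_image _ _ _ _ _ W _ _ (fun w => pt (lam w) (affine_part w))) => //.
- by move=> w [].
- have sl := smooth_on_lam oW; apply: smooth_onM => //.
    by apply: smooth_onX => //; apply: smooth_on_norm => // w [].
  apply: smooth_onV => //; last exact: smooth_onX.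
  by move=> w [w0 _]; rewrite expf_neq0.
- exact: smooth_map_slope.
- have oC := open_cone_over oU.
  apply: smooth_map_pt; first exact: smooth_on_lam.
  by apply: smooth_mapS smooth_map_affine_part => w [].
- by move=> w [w0 Uw]; split; rewrite ?lam_pt ?dsubmx_pt.
- move=> w jw [+ _]; rewrite lam_pt => w0.
  by rewrite /slope affine_part_pt scalerA mulVf // scale1r -pt_eta.
Qed.

Definition tent (k : R -> R) (f : 'cV[R]_n -> R) w : R :=
  k (lam w) * f (affine_part w).

Lemma tent_proper U (V : set 'cV[R]_(1 + n)) (k : R -> R) : open U ->
  cone_over U `<=` V -> smooth_on setT (fun w : 'cV[R]_(1 + n) => k (lam w)) ->
  (forall l, l \notin `[1, 2] -> k l = 0) ->
  proper_weight U V (fun w => k (lam w)) (@affine_part R n).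
Proof.
move=> oU UV sk k0.
apply: (@proper_weight_box _ _ _ _ _ (cone_over U) _ _ slope 1 2) => //.
- exact: open_cone_over.
- exact: smooth_onS (@subsetT _ _) sk.
- by apply: smooth_mapS smooth_map_affine_part => w [].
- exact: smooth_mapS (@subsetT _ _) (smooth_map_slope openT).
- move=> s x s12 Ux; rewrite /slope lam_pt dsubmx_pt; apply: cone_over_pt => //.
  by rewrite gt_eqF //; lra.
move=> w kw _; have w12 : lam w \in `[1, 2].
  by apply/negPn/negP => /k0 kw0; rewrite kw0 eqxx in kw.
rewrite in_itv /= in w12; exists (lam w) => //.
rewrite /slope lam_pt dsubmx_pt /affine_part scalerA divff ?scale1r; first exact: pt_eta.
by rewrite gt_eqF //; lra.
Qed.

Lemma test_lift U f : open U -> test_fun (cone_over U) f ->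
  test_fun (cylinder U) (cone_lift f).
Proof. by move=> oU; exact: wcomp_test (lift_proper oU). Qed.

Lemma lift_pt f l x : cone_lift f (pt l x) = jac l * f (pt l (l *: x)).
Proof. by rewrite /cone_lift /slope lam_pt dsubmx_pt. Qed.

(** Once the weight is moved inside u on each slice, the defining integral of [dlift] is the one
    that [distr_fubini] evaluates. *)
Lemma dliftE U (u : @functional R n) f : open U -> is_distr U u ->
  test_fun (cone_over U) f -> dlift u f = u (fiber_int (cone_lift f)).
Proof.
move=> oU du tf; rewrite -(distr_fubini du (test_lift oU tf)).
rewrite /dlift /dmul /dcomp_proj; congr (Rintegral _ _ _); apply/funext => l.
have tl := test_slice l (test_lift oU tf).
(* For n = 0 the factor |l|^n is 1 at l = 0; both sides are 0 there because the inverse of 0 is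
   0. *)
have [->|l0] := eqVneq l 0.
  transitivity (`|0 : R| ^+ n * u (fun=> 0)).
    congr (_ * u _); apply/funext => x.
    by rewrite lam_pt expr0n /= invr0 mul0r.
  rewrite (distr0 du) mulr0; transitivity (u (fun=> 0)); first by rewrite (distr0 du).
  congr u; apply/funext => x.
  by rewrite lift_pt /jac [_ ^+ n.+1]expr0n /= invr0 mulr0 mul0r.
have ln0 : `|l| ^+ n != 0 by rewrite expf_neq0 // normr_eq0.
transitivity (`|l| ^+ n * u (fun x => (`|l| ^+ n)^-1 * cone_lift f (pt l x))).
  congr (_ * u _); apply/funext => x.
  by rewrite lam_pt lift_pt /jac !mulrA mulVf // mul1r.
by rewrite (distrZ _ du tl) mulrA divff // mul1r.
Qed.

Lemma dlift_distr U (u : @functional R n) : open U -> is_distr U u ->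
  is_distr (cone_over U) (dlift u).
Proof.
move=> oU du.
apply: is_distr_eq (wcomp_distr (lift_proper oU) (fiber_int_distr du)) => f tf.
by rewrite (dliftE oU du tf).
Qed.

Lemma dlift_eq U (u v : @functional R n) : open U -> is_distr U u ->
  eq_distr U u v -> eq_distr (cone_over U) (dlift u) (dlift v).
Proof.
move=> oU du uv f tf; rewrite (dliftE oU du tf) (dliftE oU (is_distr_eq uv du) tf).
by apply: uv; apply: test_fiber; exact: test_lift.
Qed.

(* The weight [l * bump_fun l] is normalized for the measure [dl / l] *)
Definition section_fun (f : 'cV[R]_n -> R) : 'cV[R]_(1 + n) -> R :=
  tent (fun l => l * bump_fun l) f.

Lemma section_weight (l : R) : l \notin `[1, 2] -> l * bump_fun l = 0 :> R.
Proof. by move=> l0; rewrite bump_out // mulr0. Qed.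

Lemma smooth_on_section_weight k (U : set 'cV[R]_k) (g : 'cV[R]_k -> R) : open U ->
  smooth_on U g -> smooth_on U (fun y => g y * bump_fun (g y)).
Proof. by move=> oU sg; apply: smooth_onM => //; exact: smooth_on_bump. Qed.

Lemma section_proper U : open U -> proper_weight U (cone_over U)
  (fun w => lam w * bump_fun (lam w)) (@affine_part R n).
Proof.
move=> oU; apply: (@tent_proper _ _ (fun l => l * bump_fun l)) => //.
  by apply: smooth_on_section_weight; [exact: openT|exact: smooth_on_lam openT].
exact: section_weight.
Qed.

Lemma test_section U f : open U -> test_fun U f ->
  test_fun (cone_over U) (section_fun f).
Proof. by move=> oU; exact: wcomp_test (section_proper oU). Qed.

Lemma jac_bump (l : R) : jac l * (l * bump_fun l) = bump_fun l.
Proof.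
have [l12|l12] := boolP (l \in `[1, 2]); last by rewrite bump_out // !mulr0.
have l0 : 0 < l by rewrite in_itv /= in l12; lra.
by rewrite jac_pos // mulrA mulVf ?mul1r // gt_eqF.
Qed.

Lemma fiber_section f x : fiber_int (cone_lift (section_fun f)) x = f x.
Proof.
rewrite /fiber_int -[RHS]mulr1 -(@Int_bump R).
rewrite (Int_integ (@bump_out R)) -integZ; last exact: bump_continuous.
rewrite (@Int_integ _ 1 2) => [|l l12].
  congr integ; apply/funext => l; rewrite lift_pt /section_fun /tent lam_pt.
  rewrite mulrA jac_bump; have [->|l0] := eqVneq l 0.
    by rewrite bump_out ?mulr0 ?mul0r // in_itv /= negb_and -ltNge ltr01.
  by rewrite affine_part_pt scalerA mulVf // scale1r mulrC.
by rewrite lift_pt /section_fun /tent lam_pt mulrA jac_bump bump_out // mul0r.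
Qed.

Lemma dlift_section U (u : @functional R n) f : open U -> is_distr U u ->
  test_fun U f -> dlift u (section_fun f) = u f.
Proof.
move=> oU du tf; rewrite (dliftE oU du (test_section oU tf)); congr u.
by apply/funext => x; exact: fiber_section.
Qed.

(** Responsible for the uniqueness of h, Z and H in [Htilde]. *)
Lemma dlift_inj U (u v : @functional R n) : open U -> is_distr U u ->
  is_distr U v -> eq_distr (cone_over U) (dlift u) (dlift v) -> eq_distr U u v.
Proof.
move=> oU du dv uv f tf.
rewrite -(dlift_section oU du tf) -(dlift_section oU dv tf).
by apply: uv; exact: test_section.
Qed.

End Cone.

(** * Homogeneous distributions are lifts *)

Section Homogeneous.
Context {R : realType} {n : nat}.
Notation mu := (@lebesgue_measure R).
Implicit Types (U : set 'cV[R]_n) (w : 'cV[R]_(1 + n)) (v : @functional R (1 + n)).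

(** Homogeneity of degree -n-1 with the determinant of a I, present in [dcomp_lin], moved to the
    right-hand side. The factor is sg(a)^(n+1). *)
Definition dilation_invariant (C : set 'cV[R]_(1 + n)) v := forall a : R, a != 0 ->
  forall f, test_fun C f ->
    v (fun w => f (a^-1 *: w)) = `|a| ^+ n.+1 * a ^- n.+1 * v f.

Lemma dilation_invariantP (C : set 'cV[R]_(1 + n)) v : dilation_invariant C v <->
  forall a : R, a != 0 -> eq_distr C (dcomp_lin a%:M v) ((a ^- n.+1) *: v).
Proof.
have E (a : R) f : a != 0 -> dcomp_lin a%:M v f =
    (`|a| ^+ n.+1)^-1 * v (fun w => f (a^-1 *: w)).
  move=> a0; rewrite /dcomp_lin det_scalar normrX; congr (_ * v _).
  by apply/funext => w; rewrite invmx_scalar mul_scalar_mx.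
have an (a : R) : a != 0 -> `|a| ^+ n.+1 != 0 by move=> a0; rewrite expf_neq0 ?normr_eq0.
split=> H a a0 f tf.
  by rewrite E // H // !mulrA mulVf ?an // mul1r.
have := H a a0 f tf; rewrite E // => /(congr1 (fun z => `|a| ^+ n.+1 * z)).
by rewrite mulrA divff ?an // mul1r -mulrA => ->.
Qed.

Lemma dilation_invariantS (C D : set 'cV[R]_(1 + n)) v : D `<=` C ->
  dilation_invariant C v -> dilation_invariant D v.
Proof. by move=> DC H a a0 f tf; apply: H => //; exact: test_funS tf. Qed.

(** Here y stands for a pair (b, w). With [sweep_map] this gives the integrand |b|^(-1) (l/b)
    rho(l/b) f(b, b z/l) as one function of (b, w), to which [distr_fubini] can be applied for v. *)
Definition sweep_weight (y : 'cV[R]_(1 + (1 + n))) : R := `|lam y|^-1 *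
  (lam (dsubmx y) / lam y * bump_fun (lam (dsubmx y) / lam y)).

Definition sweep_map (y : 'cV[R]_(1 + (1 + n))) : 'cV[R]_(1 + n) :=
  pt (lam y) (lam y *: affine_part (dsubmx y)).

Lemma sweep_proper U : open U ->
  proper_weight (cone_over U) (cylinder (cone_over U)) sweep_weight sweep_map.
Proof.
move=> oU; have oC := open_cone_over oU.
pose W := [set y : 'cV[R]_(1 + (1 + n)) | lam y != 0 /\ cone_over U (dsubmx y)].
have oW : open W.
  apply: open_preimage oC; first exact: open_lam_neq0.
  by apply: smooth_map_dsubmx; exact: open_lam_neq0.
have sd : smooth_map W (fun y => dsubmx y) by exact: smooth_map_dsubmx.
have sl : smooth_on W (fun y => lam y) by exact: smooth_on_lam.
have sld : smooth_on W (fun y => lam (dsubmx y)) by exact: (sd ord0).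
have nl y : W y -> lam y != 0 by case.
have sq : smooth_on W (fun y => lam (dsubmx y) / lam y).
  by apply: smooth_onM => //; apply: smooth_onV.
(* The pair (b, w) is recovered from q = (b, b z/l) and s = l/b: b is the head of q and w = s q. The
   bump confines s to [[1, 2]]. *)
apply: (@proper_weight_box _ _ _ _ _ W _ _
  (fun z => pt (lam (dsubmx z)) (lam z *: dsubmx z)) 1 2) => //.
- by move=> y [].
- apply: smooth_onM => //; last exact: smooth_on_section_weight.
  apply: smooth_onV => //; last exact: smooth_on_norm.
  by move=> y /nl; rewrite normr_eq0.
- apply: smooth_map_pt => //; apply: smooth_map_scale => //.
  by apply: smooth_map_affine => // y [_ []].
- have sT : smooth_map setT (fun z : 'cV[R]_(1 + (1 + n)) => dsubmx z).
    exact: smooth_map_dsubmx openT.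
  apply: (@smooth_mapS _ _ _ setT) => //; apply: smooth_map_pt; first exact: (sT ord0).
  by apply: smooth_map_scale => //; [exact: openT|exact: smooth_on_lam openT].
- move=> s w s12 Cw; rewrite /W /= !lam_pt !dsubmx_pt; split; first by case: Cw.
  by apply: cone_overZ => //; rewrite gt_eqF //; lra.
move=> y ay [+ _]; rewrite /sweep_map lam_pt => y0.
set s := lam (dsubmx y) / lam y.
have s12 : s \in `[1, 2].
  apply/negPn/negP => /bump_out s0; move: ay.
  by rewrite /sweep_weight -/s s0 !mulr0 eqxx.
rewrite in_itv /= in s12; exists s => //.
have s0 : s != 0 by rewrite gt_eqF //; lra.
have ly : lam (dsubmx y) != 0 by apply: contraNneq s0 => E; rewrite /s E mul0r.
rewrite !lam_pt !dsubmx_pt lam_pt -pt_scale scalerA /s divfK //.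
rewrite [LHS]pt_eta; congr pt.
by rewrite [LHS]pt_affine // -pt_scale mulr1.
Qed.

Lemma homogeneous_section U v : open U -> is_distr (cone_over U) v ->
  dilation_invariant (cone_over U) v ->
  is_distr U (fun f => v (section_fun f)) /\
  eq_distr (cone_over U) v (dlift (fun f => v (section_fun f))).
Proof.
move=> oU dv hv; set u := (X in is_distr U X).
have oC := open_cone_over oU.
have du : is_distr U u by exact: wcomp_distr (section_proper oU) dv.
split=> // f tf; have tl := test_lift oU tf.
rewrite (dliftE oU du tf) -(distr_fubini du tl).
pose G y := sweep_weight y * f (sweep_map y).
pose E := tent bump_fun f.
have tG : test_fun (cylinder (cone_over U)) G by exact: wcomp_test (sweep_proper oU) tf.
have tE : test_fun (cylinder (cone_over U)) E.
  apply: wcomp_test (tent_proper oC _ _ (@bump_out R)) tf.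
    move=> y [y0 Cy]; rewrite /cylinder /=.
    have := cone_overZ y0 Cy; rewrite /affine_part scalerA divff // scale1r //.
  by apply: smooth_on_bump; [exact: openT|exact: smooth_on_lam openT].
(* Homogeneity with dilation factor b on the slice at l = b. The scalar k is cancelled between the
   two sides, and k |b|^(-1) is [jac b]. *)
have uG (b : R) : u (fun x => cone_lift f (pt b x)) = v (fun w => G (pt b w)).
  have tb := test_section oU (test_slice b tl).
  have tGb := test_slice b tG.
  have [->|b0] := eqVneq b 0.
    congr v; apply/funext => w.
    rewrite /section_fun /tent lift_pt /jac /G /sweep_weight lam_pt.
    by rewrite [_ ^+ n.+1]expr0n /= normr0 !invr0 !(mulr0, mul0r).
  have := hv b b0 _ tb; set k := _ * b ^- _.
  have k0 : k != 0.
    by rewrite mulf_neq0 ?invr_eq0 ?expf_neq0 ?normr_eq0.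
  have -> : (fun w => section_fun (fun x => cone_lift f (pt b x)) (b^-1 *: w)) =
      (fun w => k * G (pt b w)).
    apply/funext => w; rewrite /section_fun /tent /G /sweep_weight /sweep_map.
    rewrite affine_part_scale ?invr_eq0 // lam_scale lift_pt lam_pt dsubmx_pt.
    have -> : @jac R n b = k * `|b|^-1.
      have nb : `|b| != 0 by rewrite normr_eq0.
      by rewrite /jac /k [`|b| ^+ n.+1]exprSr [RHS]mulrAC mulfK.
    rewrite ?lam_pt ?dsubmx_pt [b^-1 * lam w]mulrC; by ring.
  by rewrite (distrZ _ dv tGb) => /(mulfI k0) ->.
under [fun _ => u _]funext do rewrite uG.
rewrite (distr_fubini dv tG).
(* The substitution a = l/b at fixed w turns the integrand into rho(a) f(w/a), which is the slice of
   E. On the hyperplane l = 0 both sides vanish, since f is supported in the cone. *)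
have -> : fiber_int G = fiber_int E.
  apply/funext => w; rewrite /fiber_int.
  pose h (a : R) := E (pt a w).
  have hE a : h a = bump_fun a * f (a^-1 *: w).
    by rewrite /h /E /tent lam_pt affine_part_pt.
  have [lw|lw] := eqVneq (lam w) 0.
    congr (Rintegral _ _ _); apply/funext => b.
    rewrite -/(h b) hE /G /sweep_weight lam_pt dsubmx_pt lw !mul0r mulr0 mul0r.
    rewrite (test_fun_off tf) ?mulr0 // => -[+ _].
    by rewrite lam_scale lw mulr0 eqxx.
  rewrite -(@Int_inv _ 1 2 h (lam w)) //.
  - congr (Rintegral _ _ _); apply/funext => b.
    rewrite hE /G /sweep_weight /sweep_map lam_pt dsubmx_pt.
    set l := lam w / b.
    have [l12|l12] := boolP (l \in `[1, 2]); last first.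
      by rewrite bump_out // !(mulr0, mul0r).
    rewrite in_itv /= in l12; have l0 : 0 < l by lra.
    have b0 : b != 0 by apply: contraTneq l0 => b0; rewrite /l b0 invr0 mulr0 ltxx.
    have -> : l^-1 *: w = pt b (b *: affine_part w).
      rewrite {1}(pt_affine lw) scalerA -pt_scale mulr1 /l invfM invrK mulrAC.
      by rewrite mulVf // mul1r.
    rewrite !mulrA; congr (_ * _ * _).
    have nl : l = `|lam w| / `|b| by rewrite -(gtr0_norm l0) /l normrM normfV.
    rewrite -[LHS]mulrA -/l nl -[b ^+ 2]real_normK ?num_real // expr2 invfM.
    by ring.
  - by lra.
  - exact: continuous_line (test_smooth tE).
  - by move=> t t12; rewrite hE bump_out // mul0r.
rewrite -(distr_fubini dv tE) -[LHS]mulr1 -(@Int_bump R).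
rewrite (Int_integ (@bump_out R)) -integZ; last exact: bump_continuous.
rewrite (@Int_integ _ 1 2) => [|a a12].
  apply: eq_integ => a a12; have a0 : 0 < a by lra.
  have -> : (fun w => E (pt a w)) = (fun w => bump_fun a * f (a^-1 *: w)).
    by apply/funext => w; rewrite /E /tent lam_pt affine_part_pt.
  (* Linearity of v requires test functions: the slice of E at a is one, and f(w/a) is recovered
     from it by dividing by rho(a) when this is nonzero. As a > 0, the homogeneity factor is 1. *)
  have [b0|b0] := eqVneq (bump_fun a) 0.
    rewrite b0 mulr0; transitivity (v (fun=> 0)); first by rewrite (distr0 dv).
    by congr v; apply/funext => w; rewrite mul0r.
  have := hv a (lt0r_neq0 a0) f tf.
  rewrite gtr0_norm // divff ?expf_neq0 ?gt_eqF // mul1r => <-.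
  have tEa := test_slice a tE; have := distrZ (bump_fun a)^-1 dv tEa.
  have E1 : (fun w => (bump_fun a)^-1 * E (pt a w)) = (fun w => f (a^-1 *: w)).
    by apply/funext => w; rewrite /E /tent lam_pt affine_part_pt mulKf.
  have E2 : (fun w => E (pt a w)) = (fun w => bump_fun a * f (a^-1 *: w)).
    by apply/funext => w; rewrite /E /tent lam_pt affine_part_pt.
  by rewrite E1 E2 => ->; rewrite mulrC mulrA divff // mul1r.
transitivity (v (fun=> 0)); last by rewrite (distr0 dv).
congr v; apply/funext => w.
by rewrite /E /tent lam_pt bump_out // mul0r.
Qed.

End Homogeneous.

(** * The three maps *)

Section LinearChange.
Context {R : realType} {m : nat}.
Implicit Types (P : 'M[R]_m) (V : set 'cV[R]_m) (f : 'cV[R]_m -> R)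
  (u : @functional R m).

Definition linear_image P V : set 'cV[R]_m := [set w | V (invmx P *m w)].

Lemma open_linear_image P V : open V -> open (linear_image P V).
Proof.
move=> oV.
have sP : smooth_map setT (fun w : 'cV[R]_m => invmx P *m w).
  by apply: smooth_map_mulmx; [exact: openT|apply: smooth_map_id; exact: openT].
have -> : linear_image P V = [set w | setT w /\ V (invmx P *m w)].
  by apply/seteqP; split=> w //= [].
exact: (open_preimage openT sP oV).
Qed.

Lemma linear_proper P V : P \in unitmx -> open V ->
  proper_weight (linear_image P V) V (fun=> 1) (fun y => P *m y).
Proof.
move=> Pu oV.
apply: (@proper_weight_image _ _ _ _ _ V _ _ (fun w => invmx P *m w)) => //.
- exact: smooth_on_cst.
- by apply: smooth_map_mulmx => //; exact: smooth_map_id.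
- apply: smooth_map_mulmx; first exact: open_linear_image.
  by apply: smooth_map_id; exact: open_linear_image.
- by move=> y _ _; rewrite mulmxA mulVmx // mul1mx.
Qed.

Lemma test_linear P V f : P \in unitmx -> open V ->
  test_fun (linear_image P V) f -> test_fun V (fun y => f (P *m y)).
Proof.
move=> Pu oV tf; have := wcomp_test (linear_proper Pu oV) tf.
by under [fun _ => 1 * _]funext do rewrite mul1r.
Qed.

Lemma dcomp_linE P u f : P \in unitmx ->
  dcomp_lin (invmx P) u f = `|\det P| * u (fun y => f (P *m y)).
Proof. by move=> Pu; rewrite /dcomp_lin invmxK det_inv normfV invrK. Qed.

Lemma dcomp_lin_distr P V u : P \in unitmx -> open V -> is_distr V u ->
  is_distr (linear_image P V) (dcomp_lin (invmx P) u).
Proof.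
move=> Pu oV du.
apply: is_distr_eq (is_distrZ `|\det P| (wcomp_distr (linear_proper Pu oV) du)) => f _.
rewrite dcomp_linE //; change (`|\det P| * u (fun y => 1 * f (P *m y)) =
  `|\det P| * u (fun y => f (P *m y))).
by under [fun _ => 1 * _]funext do rewrite mul1r.
Qed.

Lemma pder1_linear P f j y : differentiable f (P *m y) ->
  pder [:: j] (fun y => f (P *m y)) y = \sum_i P i j * pder [:: i] f (P *m y).
Proof.
move=> df.
have E i : (fun y : 'cV[R]_m => (P *m y) i ord0) =
    (fun y => \sum_k P i k * y k ord0) by apply/funext => z; rewrite mxE.
have s1 i k : smooth_on setT (fun y : 'cV[R]_m => P i k * y k ord0).
  by apply: smooth_onM; [exact: openT|exact: smooth_on_cst|exact: smooth_on_coord openT].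
have D i : smooth_on setT (fun y : 'cV[R]_m => (P *m y) i ord0).
  by rewrite E; apply: smooth_on_sum => //; exact: openT.
rewrite (@pder1_comp _ _ _ f (fun y => P *m y)) //; last first.
  by move=> i; exact: smooth_on_diff (D i) I.
apply: eq_bigr => i _; congr (_ * _); rewrite E (pder_sum _ _ openT) //.
rewrite (bigD1 j) //= (pderZ _ _ openT (smooth_on_coord j openT) I).
rewrite pder1_coord eqxx mulr1 big1 ?addr0 // => k kj.
rewrite (pderZ _ _ openT (smooth_on_coord k openT) I) pder1_coord (negbTE kj).
by rewrite mulr0.
Qed.

End LinearChange.

Lemma tlinE {R : realType} {m : nat} (a : R) (S T : tensor R m) i j :
  tlin a S T i j = a *: S i j + T i j.
Proof. by rewrite /tlin /= mxE. Qed.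

(** * From S to Xi *)

Section XiSection.
Context {R : realType} {n : nat}.
Implicit Types (S : tensor R n) (f : 'cV[R]_(1 + n) -> R) (a l : R)
  (x : 'cV[R]_n).

Lemma ord0_lshift : (@ord0 n) = lshift n (@ord0 0).
Proof. exact: val_inj. Qed.

Lemma XiE0l S k : Xi S ord0 k = 0.
Proof.
rewrite /Xi /= ord0_lshift; have [->|[j ->]] := ord_1D k.
  by rewrite ord0_lshift block_mxEul mxE.
by rewrite block_mxEur mxE.
Qed.

Lemma XiE0r S k : Xi S k ord0 = 0.
Proof.
rewrite /Xi /= ord0_lshift; have [->|[j ->]] := ord_1D k.
  by rewrite ord0_lshift block_mxEul mxE.
by rewrite block_mxEdl mxE.
Qed.

Lemma XiE S i j : Xi S (rshift 1 i) (rshift 1 j) = dlift (S i j).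
Proof. by rewrite /Xi /= block_mxEdr mxE. Qed.

Lemma test_dilation (U : set 'cV[R]_n) a f : open U -> a != 0 ->
  test_fun (cone_over U) f -> test_fun (cone_over U) (fun w => f (a^-1 *: w)).
Proof.
move=> oU a0 tf; have oC := open_cone_over oU.
have au : (a^-1)%:M \in @unitmx R (1 + n).
  by rewrite unitmxE det_scalar unitfE expf_neq0 // invr_eq0.
have := @test_linear _ _ _ _ f au oC.
under [fun _ => f _]funext do rewrite mul_scalar_mx.
apply; apply: test_funS tf => w Cw.
by rewrite /linear_image /= invmx_scalar invrK mul_scalar_mx; exact: cone_overZ.
Qed.

Lemma jacM a l : @jac R n (a * l) = @jac R n a * @jac R n l.
Proof. by rewrite /jac normrM !exprMn invfM mulrACA. Qed.

(** Multiplicativity of [jac] pulls [jac a] out of the lift, and the substitution l = a t in the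
    fiber gives the remaining |a|. *)
Lemma fiber_dilation (U : set 'cV[R]_n) a f x : open U -> a != 0 ->
  test_fun (cone_over U) f ->
  fiber_int (cone_lift (fun w => f (a^-1 *: w))) x =
  `|a| ^+ n.+1 * a ^- n.+1 * fiber_int (cone_lift f) x.
Proof.
move=> oU a0 tf; have tl := test_lift oU tf.
pose F w := @jac R n a * cone_lift f w.
have tF : test_fun (cylinder U) F by exact: test_funZ.
have [sF [K [cK KU vF]]] := tF; have [B B0 KB] := lam_bound cK.
have h0 (t : R) : t \notin `[- B, B] -> F (pt t x) = 0.
  rewrite in_itv /= => tB; apply: (line_off _ KB vF); rewrite leNgt.
  by apply: contra tB; rewrite ltr_norml => /andP[? ?]; apply/andP; split; lra.
have BB : - B < B by lra.
have := Int_scale a0 BB (@continuous_line _ _ F x sF) (fun t => h0 t).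
have -> : (fun t => F (pt (t / a) x)) =
    (fun t => cone_lift (fun w => f (a^-1 *: w)) (pt t x)).
  apply/funext => t; rewrite /F !lift_pt -pt_scale scalerA ![a^-1 * t]mulrC mulrA.
  by rewrite -jacM [a * _]mulrC divfK.
rewrite /fiber_int => ->; rewrite -/(fiber_int F x) (fiber_intZ _ _ tl) mulrA.
by congr (_ * _); rewrite /jac mulrA -exprS.
Qed.

Lemma dlift_dilation (U : set 'cV[R]_n) u : open U -> is_distr U u ->
  dilation_invariant (cone_over U) (dlift u).
Proof.
move=> oU du a a0 f tf.
rewrite (dliftE oU du (test_dilation oU a0 tf)) (dliftE oU du tf).
rewrite -(distrZ _ du (test_fiber (test_lift oU tf))); congr u.
by apply/funext => x; rewrite (fiber_dilation _ oU).
Qed.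

Lemma pder1_scaled f l j x : smooth f ->
  pder [:: j] (fun y => f (pt l (l *: y))) x =
  l * pder [:: rshift 1 j] f (pt l (l *: x)).
Proof.
move=> sf; pose g (y : 'cV[R]_n) := f (pt l y).
have sg : smooth g by exact: smooth_slice.
have := @pder1_linear _ _ l%:M g j x (sg [::] _).
under [fun _ => g _]funext do rewrite mul_scalar_mx.
move=> ->; rewrite (bigD1 j) //= mxE eqxx mulr1n big1 ?addr0.
  by rewrite mul_scalar_mx /g pder1_slice //; exact: (sf [::]).
by move=> k kj; rewrite mxE (negbTE kj) mulr0n mul0r.
Qed.

(** Differentiating f(l, l x) in x produces a factor l, which the weight 1/l compensates. Thus Div
    Xi tested on f is Div S tested on the fiber integral of the lift of f/l. *)
Lemma fiber_lift_pder (U : set 'cV[R]_n) f j x : open U ->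
  test_fun (cone_over U) f ->
  fiber_int (cone_lift (pder [:: rshift 1 j] f)) x =
  pder [:: j] (fiber_int (cone_lift (fun w => (lam w)^-1 * f w))) x.
Proof.
move=> oU tf; have oC := open_cone_over oU.
have tf' : test_fun (cone_over U) (fun w => (lam w)^-1 * f w).
  apply: test_funM => //; apply: smooth_onV => //; last exact: smooth_on_lam.
  by move=> w [].
have tl := test_lift oU tf'.
rewrite (fiber_int_pder _ _ tl); congr (Rintegral _ _ _); apply/funext => l.
rewrite -pder1_slice; last exact: ((test_smooth tl) [::]).
have -> : (fun y => cone_lift (fun w => (lam w)^-1 * f w) (pt l y)) =
    (fun y => (@jac R n l * l^-1) * f (pt l (l *: y))).
  by apply/funext => y; rewrite lift_pt lam_pt mulrA.
have sf := test_smooth tf.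
have ss : smooth_on setT (fun y : 'cV[R]_n => f (pt l (l *: y))).
  apply: (@smooth_on_comp _ _ _ setT setT f (fun y => pt l (l *: y))) => //.
  - exact: openT.
  - apply: smooth_map_pt; first exact: smooth_on_cst.
    apply: smooth_map_scale; [exact: openT|exact: smooth_on_cst|].
    by apply: smooth_map_id; exact: openT.
rewrite (pderZ _ _ openT ss I) pder1_scaled // lift_pt.
have [->|l0] := eqVneq l 0; first by rewrite /jac expr0n /= invr0 !(mulr0, mul0r).
by rewrite mulrA divfK.
Qed.

Theorem Xi_hom_sym_div_free S : sym_div_free S -> hom_sym_div_free (Xi S).
Proof.
move=> [[oU dS] symS divS]; set U := tdom S in oU dS symS divS.
have oC := open_cone_over oU.
have tC : tdom (Xi S) = cone_over U by [].
split; [split|].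
- split=> // k l; have [->|[i ->]] := ord_1D k; first by rewrite XiE0l; exact: is_distr0.
  have [->|[j ->]] := ord_1D l; first by rewrite XiE0r; exact: is_distr0.
  by rewrite XiE; exact: (dlift_distr oU (dS i j)).
- move=> k l; have [->|[i ->]] := ord_1D k; first by rewrite XiE0l XiE0r.
  have [->|[j ->]] := ord_1D l; first by rewrite XiE0l XiE0r.
  by rewrite !XiE; exact: (dlift_eq oU (dS i j) (symS i j)).
- move=> k f tf; rewrite /DivT fct_sumE big_split_ord /= big_ord1.
  rewrite -ord0_lshift /dpart XiE0r oppr0 add0r.
  have [->|[i ->]] := ord_1D k.
    by rewrite big1 // => j _; rewrite XiE0l oppr0.
  have oC' := oC; have tf' : test_fun (cone_over U) (fun w => (lam w)^-1 * f w).
    apply: test_funM => //; apply: smooth_onV => //; last exact: smooth_on_lam.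
    by move=> w [].
  have := divS i _ (test_fiber (test_lift oU tf')); rewrite /DivT fct_sumE /dpart => E.
  rewrite -[RHS]E; apply: eq_bigr => j _; congr (- _).
  rewrite XiE (dliftE oU (dS i j) (test_fun_pder _ tf)); congr (S i j _).
  by apply/funext => x; exact: (fiber_lift_pder j x oU tf).
move=> a a0; split; first by move=> w; exact: cone_overZ.
move=> k l.
have D0 : dilation_invariant (cone_over U) (0 : @functional R (1 + n)).
  by move=> b b0 f tf; exact: esym (mulr0 _).
apply: (dilation_invariantP _ _).1 a0.
have [->|[i ->]] := ord_1D k; first by rewrite XiE0l.
have [->|[j ->]] := ord_1D l; first by rewrite XiE0r.
by rewrite XiE; exact: (dlift_dilation oU (dS i j)).
Qed.

Theorem Xi_linear a S S' : sym_div_free S -> sym_div_free S' -> tdom S = tdom S' ->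
  eq_tensor (Xi (tlin a S S')) (tlin a (Xi S) (Xi S')).
Proof.
move=> [[oU dS] _ _] [[_ dS'] _ _] E; split=> // k l f tf.
rewrite tlinE.
change (Xi (tlin a S S') k l f = a * Xi S k l f + Xi S' k l f).
have [->|[i ->]] := ord_1D k; first by rewrite !XiE0l /= mulr0 addr0.
have [->|[j ->]] := ord_1D l; first by rewrite !XiE0r /= mulr0 addr0.
have dS'' : is_distr (tdom S) (S' i j) by rewrite E.
have dl : is_distr (tdom S) (a *: S i j + S' i j) by exact: is_distr_lin.
rewrite !XiE tlinE (dliftE oU dl tf) (dliftE oU (dS i j) tf).
by rewrite (dliftE oU dS'' tf).
Qed.

End XiSection.

Lemma sum_exchange4 {V : nmodType} {I : finType} (G : I -> I -> I -> I -> V) :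
  \sum_k \sum_l \sum_a \sum_b G k l a b = \sum_a \sum_b \sum_k \sum_l G k l a b.
Proof.
rewrite pair_big [RHS]pair_big /=.
under eq_bigr do rewrite pair_big /=.
under [RHS]eq_bigr do rewrite pair_big /=.
exact: exchange_big.
Qed.

Lemma invmx_mul {R : comUnitRingType} {m : nat} (P Q : 'M[R]_m) :
  P \in unitmx -> Q \in unitmx -> invmx (P *m Q) = invmx Q *m invmx P.
Proof.
move=> Pu Qu; have PQu : P *m Q \in unitmx by rewrite unitmx_mul Pu.
rewrite -[RHS]mulmx1 -(mulmxV PQu) !mulmxA -[_ *m invmx P *m P]mulmxA.
by rewrite mulVmx // mulmx1 mulVmx // mul1mx.
Qed.

(** * From Xi to Sigma *)

Section SigmaSection.
Context {R : realType} {n : nat}.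
Implicit Types (X : tensor R (1 + n)) (P Q : 'M[R]_(1 + n))
  (f : 'cV[R]_(1 + n) -> R).

Definition sigma_weight P : R := (\det P)^-1 * `|\det P| `^ (- 2 / n.+1%:R).

Lemma SigmaE P X i j f : P \in unitmx -> Sigma P X i j f =
  sigma_weight P * \sum_k \sum_l
    P i k * P j l * (`|\det P| * X k l (fun y => f (P *m y))).
Proof.
move=> Pu; rewrite /Sigma /= mxE.
change (sigma_weight P * (\sum_k \sum_l (P i k * P j l) *:
  dcomp_lin (invmx P) (X k l)) f = sigma_weight P * \sum_k \sum_l
    P i k * P j l * (`|\det P| * X k l (fun y => f (P *m y)))).
congr (_ * _); rewrite fct_sumE; apply: eq_bigr => k _.
rewrite fct_sumE; apply: eq_bigr => l _; rewrite -dcomp_linE //.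
Qed.

Lemma sigma_is_tensor P X : P \in unitmx -> is_tensor X -> is_tensor (Sigma P X).
Proof.
move=> Pu [oX dX]; split; first exact: open_linear_image.
move=> i j; rewrite /Sigma /= mxE; apply: is_distrZ.
apply: is_distr_sum => k; apply: is_distr_sum => l; apply: is_distrZ.
exact: dcomp_lin_distr.
Qed.

Lemma sigma_test P X f : P \in unitmx -> open (tdom X) ->
  test_fun (tdom (Sigma P X)) f -> test_fun (tdom X) (fun y => f (P *m y)).
Proof. exact: test_linear. Qed.

Theorem Sigma_hom_sym_div_free P X : P \in unitmx ->
  hom_sym_div_free X -> hom_sym_div_free (Sigma P X).
Proof.
move=> Pu [[[oX dX] symX divX] homX]; split; [split|].
- exact: sigma_is_tensor.
- move=> i j f tf; rewrite !SigmaE // exchange_big /=; congr (_ * _).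
  apply: eq_bigr => k _; apply: eq_bigr => l _.
  by rewrite [P i l * _]mulrC (symX l k) //; exact: sigma_test.
- move=> i f tf; rewrite /DivT fct_sumE /dpart.
  (* Div X tested on f o P: the chain rule supplies the factor P j l, so the sum over j and l is a
     divergence of row k of X. *)
  have E0 k : \sum_j \sum_l P j l * X k l (fun y => pder [:: j] f (P *m y)) = 0.
    have tfP := sigma_test Pu oX tf.
    have := divX k _ tfP; rewrite /DivT fct_sumE /dpart sumrN => /eqP; rewrite oppr_eq0 => /eqP E.
    rewrite -[RHS]E exchange_big /=; apply: eq_bigr => l _.
    have tj j : test_fun (tdom X) (fun y => pder [:: j] f (P *m y)).
      by apply: (@sigma_test P X) => //; exact: test_fun_pder.
    have -> : pder [:: l] (fun y => f (P *m y)) =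
        (fun y => \sum_j P j l * pder [:: j] f (P *m y)).
      by apply/funext => y; rewrite pder1_linear //; exact: (test_smooth tf [::]).
    rewrite (distr_sum _ (dX k l)); last by move=> j; exact: test_funZ.
    by apply: eq_bigr => j _; rewrite (distrZ _ (dX k l)).
  under eq_bigr do rewrite SigmaE //.
  rewrite sumrN -mulr_sumr exchange_big /=.
  rewrite big1 ?mulr0 ?oppr0 // => k _.
  transitivity (P i k * `|\det P| *
    \sum_j \sum_l P j l * X k l (fun y => pder [:: j] f (P *m y))).
    rewrite mulr_sumr; apply: eq_bigr => j _.
    by rewrite mulr_sumr; apply: eq_bigr => l _; ring.
  by rewrite E0 mulr0.
move=> a a0; split.
  move=> w Xw; rewrite /Sigma /= -scalemxAr; exact: (homX a a0).1.
move=> i j; apply: (dilation_invariantP _ _).1 a0 => b b0 f tf.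
have hX k l : dilation_invariant (tdom X) (X k l).
  by apply/dilation_invariantP => c c0; exact: (homX c c0).2.
rewrite !SigmaE // [RHS]mulrCA; congr (_ * _).
rewrite mulr_sumr; apply: eq_bigr => k _; rewrite mulr_sumr; apply: eq_bigr => l _.
have := hX k l b b0 _ (sigma_test Pu oX tf).
under [fun _ => f _]funext do rewrite -scalemxAr.
by move=> ->; ring.
Qed.

Theorem Sigma_linear P a X X' : P \in unitmx -> tdom X = tdom X' ->
  eq_tensor (Sigma P (tlin a X X')) (tlin a (Sigma P X) (Sigma P X')).
Proof.
move=> Pu E; split=> // i j f tf; rewrite tlinE.
change (Sigma P (tlin a X X') i j f = a * Sigma P X i j f + Sigma P X' i j f).
rewrite !SigmaE // mulrCA -mulrDr; congr (_ * _).
rewrite mulr_sumr -big_split /=.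
apply: eq_bigr => k _; rewrite mulr_sumr -big_split /=; apply: eq_bigr => l _.
rewrite tlinE.
change (P i k * P j l * (`|\det P| * (a * X k l (fun y => f (P *m y)) +
  X' k l (fun y => f (P *m y)))) =
  a * (P i k * P j l * (`|\det P| * X k l (fun y => f (P *m y)))) +
  P i k * P j l * (`|\det P| * X' k l (fun y => f (P *m y)))).
by ring.
Qed.

Lemma sigma_weight1 : sigma_weight 1%:M = 1.
Proof. by rewrite /sigma_weight det1 invr1 normr1 powR1 mulr1. Qed.

Lemma sigma_weightM P Q : sigma_weight (P *m Q) = sigma_weight P * sigma_weight Q.
Proof.
by rewrite /sigma_weight det_mulmx normrM powRM // invfM mulrACA.
Qed.

Theorem Sigma1 X : eq_tensor (Sigma 1%:M X) X.
Proof.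
split=> [|i j f tf].
  by apply/seteqP; split=> w; rewrite /= invmx1 mul1mx.
rewrite SigmaE ?unitmx1 // sigma_weight1 mul1r det1 normr1.
rewrite (bigD1 i) //= (bigD1 j) //= !mxE !eqxx !mul1r.
rewrite !big1 ?addr0 //.
- by congr (X i j _); apply/funext => y; rewrite mul1mx.
- move=> k ki; rewrite big1 // => l _; rewrite !mxE eq_sym (negbTE ki).
  by rewrite !mul0r.
- by move=> l lj; rewrite !mxE [j == l]eq_sym (negbTE lj) mulr0 mul0r.
Qed.

Theorem SigmaM P Q X : P \in unitmx -> Q \in unitmx ->
  eq_tensor (Sigma P (Sigma Q X)) (Sigma (P *m Q) X).
Proof.
move=> Pu Qu; split=> [|i j f tf].
  by apply/seteqP; split=> w; rewrite /= invmx_mul // mulmxA.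
rewrite SigmaE // [RHS]SigmaE ?unitmx_mul ?Pu // sigma_weightM -mulrA; congr (_ * _).
rewrite det_mulmx normrM.
under eq_bigr do under eq_bigr do rewrite SigmaE //.
pose T a b := X a b (fun y => f (P *m Q *m y)).
transitivity (\sum_k \sum_l P i k * P j l * `|\det P| * (sigma_weight Q *
   \sum_a \sum_b Q k a * Q l b * (`|\det Q| * T a b))).
  apply: eq_bigr => k _; apply: eq_bigr => l _; rewrite -[RHS]mulrA; congr (_ * (_ * (_ * _))).
  apply: eq_bigr => a _; apply: eq_bigr => b _; congr (_ * (_ * X a b _)).
  by apply/funext => y; rewrite mulmxA.
transitivity (sigma_weight Q * \sum_a \sum_b \sum_k \sum_l
    P i k * Q k a * (P j l * Q l b) * (`|\det P| * `|\det Q| * T a b)); last first.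
  congr (_ * _); apply: eq_bigr => a _; apply: eq_bigr => b _.
  rewrite !mxE -/(T a b) !mulr_suml; apply: eq_bigr => k _.
  by rewrite mulr_sumr mulr_suml.
under eq_bigr do under eq_bigr do rewrite mulrCA.
under eq_bigr do rewrite -mulr_sumr.
rewrite -mulr_sumr; congr (_ * _).
rewrite -sum_exchange4; apply: eq_bigr => k _; apply: eq_bigr => l _.
rewrite mulr_sumr; apply: eq_bigr => a _; rewrite mulr_sumr; apply: eq_bigr => b _.
by ring.
Qed.

End SigmaSection.

(** * The derivative of the bump *)

Section BumpDerivative.
Context {R : realType}.
Notation mu := (@lebesgue_measure R).

Definition bump_deriv (t : R) : R :=
  pder [:: ord0] (fun w : 'cV[R]_1 => bump_fun (w ord0 ord0)) t%:M.

Let smooth_bump1 : smooth_on setT (fun w : 'cV[R]_1 => bump_fun (w ord0 ord0)).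
Proof. by apply: smooth_on_bump; [exact: openT|exact: smooth_on_coord openT]. Qed.

Lemma is_derive_scalar_mx (f : 'cV[R]_1 -> R) t : differentiable f t%:M ->
  is_derive t 1 (fun s : R => f s%:M) (pder [:: ord0] f t%:M).
Proof.
move=> df.
have E (s : R) : (s%:M : 'cV[R]_1) = s *: 1%:M by rewrite scalemx1.
have dg : is_diff t (fun s : R => s *: (1%:M : 'cV[R]_1)) ( *:%R ^~ 1%:M).
  exact: is_diff_scalel.
have -> : (fun s : R => f s%:M) = f \o (fun s : R => s *: 1%:M).
  by apply/funext => s /=; rewrite E.
rewrite E in df *.
have dgt := @ex_diff _ _ _ _ _ _ _ dg.
apply: DeriveDef.
  by apply: diff_derivable; apply: differentiable_comp.
rewrite deriveE; last exact: differentiable_comp.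
rewrite diff_comp //= (@diff_val _ _ _ _ _ _ _ dg) scale1r dE //.
by congr ('d f _ _); apply/colP => k; rewrite ord1 !mxE.
Qed.

Lemma is_derive_bump (t : R) : is_derive t 1 bump_fun (bump_deriv t).
Proof.
have d := smooth_on_diff smooth_bump1 (x := t%:M) I.
have := @is_derive_scalar_mx _ t d; rewrite -/(bump_deriv t).
by under [fun _ => bump_fun _]funext do rewrite mxE eqxx.
Qed.

Lemma bump_deriv_continuous : continuous bump_deriv.
Proof.
move=> t; apply: differentiable_continuous; apply/derivable1_diffP.
have d := smooth_on_diff (smooth_on_pder [:: ord0] smooth_bump1) (x := t%:M) I.
by have [] := @is_derive_scalar_mx _ t d.
Qed.

Lemma bump_deriv_out t : t \notin `[1, 2] -> bump_deriv t = 0.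
Proof.
move=> t12; have [_ <-] := is_derive_bump t.
have E : \forall s \near t, bump_fun s = cst 0 s.
  move: t12; rewrite in_itv /= negb_and -!ltNge => /orP[t1|t2].
    have H := open_nbhs_nbhs (conj (@open_lt R 1) t1).
    apply: filterS H => s /= s0; rewrite bump_out // in_itv /= negb_and -ltNge.
    by rewrite s0.
  have H := open_nbhs_nbhs (conj (@open_gt R 2) t2).
  apply: filterS H => s /= s0; rewrite bump_out // in_itv /= negb_and -!ltNge.
  by rewrite s0 orbT.
by rewrite (near_eq_derive _ E) derive_cst.
Qed.

Lemma is_derive_weighted_bump (t : R) :
  is_derive t 1 (fun s => s * bump_fun s) (bump_fun t + t * bump_deriv t).
Proof.
have X : is_derive t 1 (fun s => s * bump_fun s) _ :=
  is_deriveM (is_derive_id t (1 : R)) (is_derive_bump t).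
by apply: (is_derive_eq X); rewrite /GRing.scale /= mulr1 addrC.
Qed.

Lemma notin_itv03 (t : R) : t \notin `[0, 3] -> t \notin `[1, 2].
Proof.
rewrite !in_itv /=; apply: contra => /andP[? ?]; apply/andP; split; lra.
Qed.

(** The second summand is the derivative of t rho(t) and integrates to 0. The interval [[0, 3]] is
    wider than the support so that rho is known to vanish at both endpoints. *)
Lemma integ_bump_deriv :
  integ 0 3 (fun t => bump_fun t + (bump_fun t + t * bump_deriv t)) = 1.
Proof.
have cb := @bump_continuous R.
have c2 : continuous (fun t : R => bump_fun t + t * bump_deriv t).
  apply: continuous_addf => // t; apply: continuousM; first exact: cvg_id.
  exact: bump_deriv_continuous.
rewrite integD // -(Int_integ (fun t t03 => bump_out (notin_itv03 t03))) Int_bump.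
have e0 : bump_fun (0 : R) = 0 by rewrite bump_out // in_itv /= negb_and -!ltNge ltr01.
have e3 : bump_fun (3 : R) = 0.
  by rewrite bump_out // in_itv /= negb_and -!ltNge; apply/orP; right; lra.
have -> : integ 0 3 (fun t : R => bump_fun t + t * bump_deriv t) =
    3 * bump_fun 3 - 0 * bump_fun 0.
  apply: (@integ_prim _ 0 3 _ (fun s => s * bump_fun s)).
  - by lra.
  - exact: continuous_subspaceT.
  - by move=> t _; exact: is_derive_weighted_bump.
by rewrite e0 e3 !mulr0 subrr addr0.
Qed.

End BumpDerivative.

(** * Back to the affine chart *)

Section Dehomogenize.
Context {R : realType} {n : nat}.
Notation mu := (@lebesgue_measure R).
Implicit Types (U : set 'cV[R]_n) (X : tensor R (1 + n)) (f phi : 'cV[R]_n -> R)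
  (x : 'cV[R]_n).

Lemma dmul_distr U (a : 'cV[R]_n -> R) (u : @functional R n) : open U ->
  smooth_on U a -> is_distr U u -> is_distr U (dmul a u).
Proof.
move=> oU sa; apply: (@wcomp_distr _ _ _ U U a (fun x => x)).
by apply: (@proper_weight_image _ _ _ _ _ U _ _ (fun x => x)) => //;
  exact: smooth_map_id.
Qed.

(** A partial derivative in z of the section of phi brings out a factor 1/l; the extra l cancels it,
    so that fiber integration returns the partials of phi themselves. *)
Definition lam_section phi (w : 'cV[R]_(1 + n)) : R := lam w * section_fun phi w.

Lemma test_lam_section U phi : open U -> test_fun U phi ->
  test_fun (cone_over U) (lam_section phi).
Proof.
move=> oU tf; have oC := open_cone_over oU.
by apply: test_funM => //; [exact: smooth_on_lam|exact: test_section].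
Qed.

Lemma lam_section_pt phi l x :
  lam_section phi (pt l (l *: x)) = l * (l * bump_fun l) * phi x.
Proof.
rewrite /lam_section /section_fun /tent lam_pt.
have [->|l0] := eqVneq l 0; first by rewrite !mul0r.
by rewrite affine_part_pt scalerA mulVf // scale1r mulrA.
Qed.

Lemma lam_sectionV phi : (fun w => (lam w)^-1 * lam_section phi w) = section_fun phi.
Proof.
apply/funext => w; rewrite /lam_section /section_fun /tent.
have [->|l0] := eqVneq (lam w) 0; first by rewrite !(mul0r, mulr0).
by rewrite mulKf.
Qed.

Lemma fiber_lam_section_tail U phi j x : open U -> test_fun U phi ->
  fiber_int (cone_lift (pder [:: rshift 1 j] (lam_section phi))) x =
  pder [:: j] phi x.
Proof.
move=> oU tf; rewrite (fiber_lift_pder _ _ oU (test_lam_section oU tf)).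
rewrite lam_sectionV; congr (pder _ _ x); apply/funext => y; exact: fiber_section.
Qed.

Lemma fiber_int_sum (V : set 'cV[R]_n) (F : 'I_n -> 'cV[R]_(1 + n) -> R) x :
  (forall j, test_fun (cylinder V) (F j)) ->
  fiber_int (fun w => \sum_j F j w) x = \sum_j fiber_int (F j) x.
Proof.
move=> tF; elim: (index_enum _) => [|j r IH].
  rewrite big_nil /fiber_int (@Int_integ _ 0 1 (fun l => \sum_(j <- [::]) F j (pt l x))).
    transitivity (integ (0 : R) 1 (fun=> 0)); last exact: integ0.
    by apply: eq_integ => l _; rewrite big_nil.
  by move=> l _; rewrite big_nil.
rewrite big_cons -IH -(fiber_intD _ (V := V)) //; last exact: test_fun_sum.
by congr fiber_int; apply/funext => w; rewrite big_cons.
Qed.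

(** Along the ray (l, l x) the combination d_0 F + sum_j x_j d_j F is the derivative of l |-> F(l, l
    x) = l^2 rho(l) phi(x). Weighted by [jac], it becomes (rho + (l rho)') phi(x), of integral
    phi(x); the sum over j contributes the subtracted term. *)
Lemma fiber_lam_section_head U phi x : open U -> test_fun U phi ->
  fiber_int (cone_lift (pder [:: ord0] (lam_section phi))) x =
  phi x - \sum_j x j ord0 * pder [:: j] phi x.
Proof.
move=> oU tf; set F := lam_section phi.
have tF : test_fun (cone_over U) F by exact: test_lam_section.
have sF := test_smooth tF.
have t0 := test_lift oU (test_fun_pder [:: ord0] tF).
have tj j := test_lift oU (test_fun_pder [:: rshift 1 j] tF).
have tj' j := test_funZ (x j ord0) (tj j).
(* The coordinates of x are frozen here: they are constants, independent of w. *)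
pose G w := cone_lift (pder [:: ord0] F) w +
  \sum_j x j ord0 * cone_lift (pder [:: rshift 1 j] F) w.
have EG : fiber_int G x = fiber_int (cone_lift (pder [:: ord0] F)) x +
    \sum_j x j ord0 * pder [:: j] phi x.
  rewrite /G (fiber_intD x t0); last exact: test_fun_sum tj'.
  rewrite (fiber_int_sum x tj'); congr (_ + _); apply: eq_bigr => j _.
  by rewrite (fiber_intZ _ _ (tj j)) (fiber_lam_section_tail _ _ oU tf).
have GE l : G (pt l x) = (bump_fun l + (bump_fun l + l * bump_deriv l)) * phi x.
  have dF : differentiable F (pt l (l *: x)) := sF [::] _.
  have d1 : is_derive l 1 (fun s => F (pt s (s *: x)))
      (pder [:: ord0] F (pt l (l *: x)) +
       \sum_j x j ord0 * pder [:: rshift 1 j] F (pt l (l *: x))).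
    have Es (s : R) : pt s (s *: x) = s *: pt 1 x by rewrite -pt_scale mulr1.
    have dg : is_diff l (fun s : R => s *: (pt 1 x : 'cV[R]_(1 + n)))
      ( *:%R ^~ (pt 1 x)) by exact: is_diff_scalel.
    have dgt := @ex_diff _ _ _ _ _ _ _ dg.
    have -> : (fun s : R => F (pt s (s *: x))) = F \o (fun s : R => s *: pt 1 x).
      by apply/funext => s /=; rewrite Es.
    rewrite Es in dF *.
    apply: DeriveDef; first by apply: diff_derivable; exact: differentiable_comp.
    rewrite deriveE; last exact: differentiable_comp.
    rewrite diff_comp //= (@diff_val _ _ _ _ _ _ _ dg) scale1r diff_colE //.
    rewrite (@big_split_ord _ _ _ 1 n) /= big_ord1 -ord0_lshift pt_head mul1r.
    by congr (_ + _); apply: eq_bigr => j _; rewrite pt_tail.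
  have d2 : is_derive l 1 (fun s => F (pt s (s *: x)))
      ((l * bump_fun l + l * (bump_fun l + l * bump_deriv l)) * phi x).
    have X : is_derive l 1 (fun s => s * (s * bump_fun s)) _ :=
      is_deriveM (is_derive_id l (1 : R)) (is_derive_weighted_bump l).
    have -> : (fun s => F (pt s (s *: x))) = (fun s => phi x * (s * (s * bump_fun s))).
      by apply/funext => s; rewrite /F lam_section_pt mulrC.
    have Y := is_deriveZ (phi x) X.
    by apply: (is_derive_eq Y); rewrite /GRing.scale /= mulr1; ring.
  (* The same radial derivative computed by the chain rule and from the explicit product. *)
  have E : pder [:: ord0] F (pt l (l *: x)) +
      \sum_j x j ord0 * pder [:: rshift 1 j] F (pt l (l *: x)) =
      (l * bump_fun l + l * (bump_fun l + l * bump_deriv l)) * phi x.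
    by have [_ <-] := d1; have [_ <-] := d2.
  rewrite /G lift_pt; transitivity (@jac R n l * (pder [:: ord0] F (pt l (l *: x)) +
      \sum_j x j ord0 * pder [:: rshift 1 j] F (pt l (l *: x)))).
    rewrite mulrDr mulr_sumr; congr (_ + _); apply: eq_bigr => j _.
    by rewrite lift_pt mulrCA.
  rewrite E -mulrDr -mulrA mulrA.
  have [l12|l12] := boolP (l \in `[1, 2]); last first.
    by rewrite bump_out // bump_deriv_out // !(mulr0, addr0, mul0r).
  have l0 : 0 < l by rewrite in_itv /= in l12; lra.
  by rewrite jac_pos // mulVf ?mul1r // gt_eqF.
have -> : phi x = fiber_int G x.
  rewrite /fiber_int (@Int_integ _ 0 3) => [|l l03].
    pose k (t : R) := bump_fun t + (bump_fun t + t * bump_deriv t).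
    have ck : continuous k.
      have cb := @bump_continuous R.
      do 2![apply: continuous_addf => //] => t; apply: continuousM; first exact: cvg_id.
      exact: bump_deriv_continuous.
    transitivity (phi x * integ 0 3 k); first by rewrite integ_bump_deriv mulr1.
    by rewrite -integZ //; apply: eq_integ => l _; rewrite GE mulrC.
  have l12 := notin_itv03 l03.
  by rewrite GE bump_out // bump_deriv_out // !(mulr0, addr0, mul0r).
by rewrite EG addrK.
Qed.

Definition dehom (X : tensor R (1 + n)) k l : @functional R n :=
  fun phi => X k l (section_fun phi).

Definition affine_dom (X : tensor R (1 + n)) : set 'cV[R]_n := [set x | tdom X (pt 1 x)].

Definition projected (h : @functional R n) (Z : 'I_n -> @functional R n)
    (H : 'I_n -> 'I_n -> @functional R n) i j : @functional R n :=
  H i j - dmul (fun x => x i ord0) (Z j) - dmul (fun x => x j ord0) (Z i)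
  + dmul (fun x => x i ord0 * x j ord0) h.

Definition Htilde_tensor X : tensor R n := Tensor (affine_dom X)
  (\matrix_(i, j) projected (dehom X ord0 ord0)
     (fun i => dehom X (rshift 1 i) ord0)
     (fun i j => dehom X (rshift 1 i) (rshift 1 j)) i j).

Lemma projectedE h Z H i j phi : projected h Z H i j phi =
  H i j phi - Z j (fun x => x i ord0 * phi x) - Z i (fun x => x j ord0 * phi x)
  + h (fun x => x i ord0 * x j ord0 * phi x).
Proof. by []. Qed.

Lemma test_coord U i phi : open U -> test_fun U phi ->
  test_fun U (fun x => x i ord0 * phi x).
Proof. by move=> oU; apply: test_funM => //; exact: smooth_on_coord. Qed.

Lemma projected_eq U h h' Z Z' H H' i j : open U -> eq_distr U h h' ->
  (forall i, eq_distr U (Z i) (Z' i)) -> (forall i j, eq_distr U (H i j) (H' i j)) ->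
  eq_distr U (projected h Z H i j) (projected h' Z' H' i j).
Proof.
move=> oU eh eZ eH f tf; rewrite !projectedE.
rewrite eH // !eZ ?eh //; try exact: test_coord.
by apply: test_funM => //; apply: smooth_onM => //; exact: smooth_on_coord.
Qed.

Lemma projected_distr U h Z H i j : open U -> is_distr U h ->
  (forall i, is_distr U (Z i)) -> (forall i j, is_distr U (H i j)) ->
  is_distr U (projected h Z H i j).
Proof.
move=> oU dh dZ dH.
have dm k u : is_distr U u -> is_distr U (dmul (fun x : 'cV[R]_n => x k ord0) u).
  by apply: dmul_distr => //; exact: smooth_on_coord.
apply: is_distrD; last first.
  by apply: dmul_distr => //; apply: smooth_onM => //; exact: smooth_on_coord.
apply: is_distrD; last by apply: is_distrN; exact: dm.
by apply: is_distrD => //; apply: is_distrN; exact: dm.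
Qed.

Section Fixed.
Variable X : tensor R (1 + n).
Hypothesis hX : hom_sym_div_free X.
Let U := affine_dom X.

Lemma open_affine_dom : open U.
Proof.
have [[[oX _] _ _] _] := hX.
have -> : U = [set x | setT x /\ tdom X (pt 1 x)].
  by apply/seteqP; split=> x //= [].
apply: open_preimage oX; first exact: openT.
apply: smooth_map_pt; first exact: smooth_on_cst.
by apply: smooth_map_id; exact: openT.
Qed.

Lemma cone_affine_dom : cone_over U `<=` tdom X.
Proof.
move=> w [w0 Uw]; rewrite (pt_affine w0).
by have [_ homX] := hX; apply: (homX _ w0).1.
Qed.

Lemma dehomP k l : is_distr U (dehom X k l) /\
  eq_distr (cone_over U) (X k l) (dlift (dehom X k l)).
Proof.
have [[[oX dX] _ _] homX] := hX.
apply: homogeneous_section; first exact: open_affine_dom.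
  by apply: distrS (dX k l); exact: cone_affine_dom.
apply: dilation_invariantS cone_affine_dom _.
by apply/dilation_invariantP => a a0; exact: (homX a a0).2.
Qed.

Lemma dehom_sym k l : eq_distr U (dehom X k l) (dehom X l k).
Proof.
move=> f tf; have [[_ symX _] _] := hX; apply: symX.
by apply: test_funS cone_affine_dom _; apply: test_section => //; exact: open_affine_dom.
Qed.

(** Weak form, in the chart lambda = 1, of sum_j d_j (X_kj - x_j X_k0) = X_k0. It is Div X = 0
    tested on [lam_section phi]. *)
Lemma dehom_div k phi : test_fun U phi ->
  dehom X k ord0 phi - \sum_j dehom X k ord0 (fun x => x j ord0 * pder [:: j] phi x)
  + \sum_j dehom X k (rshift 1 j) (pder [:: j] phi) = 0.
Proof.
move=> tf; have oU := open_affine_dom; have tF := test_lam_section oU tf.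
have [[_ _ divX] _] := hX.
have := divX k _ (test_funS cone_affine_dom tF).
rewrite /DivT fct_sumE big_split_ord /= big_ord1 -ord0_lshift /dpart.
have tp l := test_fun_pder [:: l] tF.
have EX l m : X k l (pder [:: m] (lam_section phi)) =
    dehom X k l (fiber_int (cone_lift (pder [:: m] (lam_section phi)))).
  have [dl el] := dehomP k l; rewrite (el _ (tp m)); exact: (dliftE oU dl (tp m)).
have td j : test_fun U (pder [:: j] phi) by exact: test_fun_pder.
have tx j : test_fun U (fun x => x j ord0 * pder [:: j] phi x) by exact: test_coord.
have [d0 _] := dehomP k ord0.
rewrite EX sumrN -opprD => /eqP; rewrite oppr_eq0 => /eqP E.
rewrite -[RHS]E; congr (_ + _); last first.
  apply: eq_bigr => j _; rewrite EX; congr dehom; apply/funext => x.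
  by rewrite (fiber_lam_section_tail _ _ oU tf).
rewrite -(distr_sum _ d0 tx) -[X in _ - X]mul1r -mulNr.
rewrite -(distrZ _ d0); last exact: test_fun_sum.
rewrite -(distrD d0) //; last by apply: test_funZ; exact: test_fun_sum.
congr dehom; apply/funext => x.
by rewrite (fiber_lam_section_head _ oU tf) mulN1r.
Qed.

(** Write T_ij = (H_ij - x_j Z_i) - x_i (Z_j - x_j h). By [dehom_div] the brackets have divergences
    Z_i and h, so the divergence of row i is Z_i - x_i h - (Z_i - x_i h) = 0. *)
Theorem Htilde_tensor_sym_div_free : sym_div_free (Htilde_tensor X).
Proof.
have oU := open_affine_dom.
have dd k l := (dehomP k l).1.
have TE i j : Htilde_tensor X i j = projected (dehom X ord0 ord0)
     (fun i => dehom X (rshift 1 i) ord0)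
     (fun i j => dehom X (rshift 1 i) (rshift 1 j)) i j by rewrite /= mxE.
split; [split=> // i j|move=> i j f tf|move=> i f tf].
- by rewrite TE; exact: projected_distr.
- rewrite !TE !projectedE (dehom_sym (rshift 1 i) (rshift 1 j)) //.
  rewrite -!addrA; congr (_ + _); rewrite !addrA; congr (_ + _); first by rewrite addrC.
  by congr (dehom X ord0 ord0 _); apply/funext => x; rewrite [x i _ * _]mulrC.
- rewrite /DivT fct_sumE /dpart sumrN; apply/eqP; rewrite oppr_eq0; apply/eqP.
  have tj j : test_fun U (pder [:: j] f) by exact: test_fun_pder.
  have E1 := dehom_div (rshift 1 i) tf.
  (* Row 0 is tested on x_i f, which accounts for the multiplication by x_i; Leibniz then produces
     the diagonal terms with i = j. *)
  have E2 := dehom_div ord0 (test_coord i oU tf).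
  have Ed j x : pder [:: j] (fun x : 'cV[R]_n => x i ord0 * f x) x =
      (i == j)%:R * f x + x i ord0 * pder [:: j] f x.
    rewrite pder1M ?pder1_coord //; first exact: differentiable_coord.
    exact: (test_smooth tf [::]).
  under eq_bigr do rewrite TE projectedE.
  rewrite !big_split /= !sumrN.
  set h := dehom X ord0 ord0 in E2 *; have dh : is_distr U h := dd _ _.
  pose Z j := dehom X (rshift 1 j) ord0; have dZ j : is_distr U (Z j) := dd _ _.
  have E2' : h (fun x => x i ord0 * f x) -
      (h (fun x => x i ord0 * f x) +
        \sum_j h (fun x => x i ord0 * x j ord0 * pder [:: j] f x)) +
      (Z i f + \sum_j Z j (fun x => x i ord0 * pder [:: j] f x)) = 0.
    rewrite -[RHS]E2; congr (_ - _ + _).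
      transitivity (\sum_j ((i == j)%:R * h (fun x => x i ord0 * f x) +
          h (fun x => x i ord0 * x j ord0 * pder [:: j] f x))).
        rewrite big_split /=; congr (_ + _).
        rewrite (bigD1 i) //= eqxx mul1r big1 ?addr0 // => j /negbTE ji.
        by rewrite eq_sym ji mul0r.
      apply: eq_bigr => j _.
      have tif : test_fun U (fun x => x i ord0 * f x) by exact: test_coord.
      have tijf : test_fun U (fun x => x i ord0 * x j ord0 * pder [:: j] f x).
        by apply: test_funM => //; apply: smooth_onM => //; exact: smooth_on_coord.
      rewrite -(distrZ _ dh tif) -(distrD dh) //; last exact: test_funZ.
      congr h; apply/funext => x; rewrite Ed.
      by have [->|ij] := eqVneq i j; rewrite ?mul0r; ring.
    transitivity (\sum_j ((i == j)%:R * Z j f + Z j (fun x => x i ord0 * pder [:: j] f x))).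
      rewrite big_split /=; congr (_ + _).
      rewrite (bigD1 i) //= eqxx mul1r big1 ?addr0 // => j /negbTE ji.
      by rewrite eq_sym ji mul0r.
    apply: eq_bigr => j _; have tij := test_coord i oU (tj j).
    rewrite -(distrZ _ (dZ j) tf) -(distrD (dZ j)) //; last exact: test_funZ.
    transitivity (Z j (pder [:: j] (fun x => x i ord0 * f x))).
      by congr (Z j _); apply/funext => x; rewrite Ed.
    by apply: (dehom_sym (rshift 1 j) ord0); apply: test_fun_pder; exact: test_coord.
  move: E1 E2'; rewrite -/(Z i); set a := \sum_j dehom X _ (rshift 1 _) _.
  rewrite -/h.
  set b := \sum_j Z i _; set c := \sum_j h _; set d := \sum_j Z _ _.
  by move=> E1 E2'; move: E1 E2'; lra.
Qed.

(** Existence of the blocks comes from [dehomP], their uniqueness from [dlift_inj]. *)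
Theorem Htilde_tensorP T : Htilde X T <-> eq_tensor T (Htilde_tensor X).
Proof.
have oU := open_affine_dom.
have dd k l := (dehomP k l).1; have de k l := (dehomP k l).2.
have blk (h : @functional R n) (Z : 'cV[@functional R n]_n)
    (H : 'M[@functional R n]_n) :
    [/\ block_mx (const_mx h) Z^T Z H ord0 ord0 = h,
        forall i, block_mx (const_mx h) Z^T Z H (rshift 1 i) ord0 = Z i ord0,
        forall i, block_mx (const_mx h) Z^T Z H ord0 (rshift 1 i) = Z i ord0 &
        forall i j, block_mx (const_mx h) Z^T Z H (rshift 1 i) (rshift 1 j) = H i j].
  rewrite !(@ord0_lshift n); split=> [|i|i|i j].
  - by rewrite block_mxEul mxE.
  - by rewrite block_mxEdl.
  - by rewrite block_mxEur mxE.
  - by rewrite block_mxEdr.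
split.
- move=> [tT [h [Z [H [dh dZ dH E TE]]]]].
  have tU : tdom T = U by [].
  rewrite tU in dh dZ dH E TE; have [b00 b10 b01 b11] := blk h Z H.
  have H00 : eq_distr U h (dehom X ord0 ord0).
    apply: (dlift_inj oU dh (dd _ _)) => f tf; rewrite -de // E // b00 //.
  have H10 i : eq_distr U (Z i ord0) (dehom X (rshift 1 i) ord0).
    apply: (dlift_inj oU (dZ i) (dd _ _)) => f tf; rewrite -de // E // b10 //.
  have H11 i j : eq_distr U (H i j) (dehom X (rshift 1 i) (rshift 1 j)).
    apply: (dlift_inj oU (dH i j) (dd _ _)) => f tf; rewrite -de // E // b11 //.
  split; first exact: tU.
  rewrite tU => i j f tf; rewrite TE // /= mxE.
  exact: (projected_eq (Z := fun j => Z j ord0) i j oU H00 H10 H11).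
- move=> [tT TE]; have tU : tdom T = U by [].
  split=> //.
  exists (dehom X ord0 ord0), (\col_i dehom X (rshift 1 i) ord0),
    (\matrix_(i, j) dehom X (rshift 1 i) (rshift 1 j)).
  rewrite tU; rewrite tU in TE.
  set h := dehom X ord0 ord0; set Z := \col_i _; set H := \matrix_(i, j) _.
  have [b00 b10 b01 b11] := blk h Z H.
  split=> //.
  + exact: dd.
  + by move=> i; rewrite mxE; exact: dd.
  + by move=> i j; rewrite mxE; exact: dd.
  + move=> k l f tf; have [->|[i ->]] := ord_1D k; have [->|[j ->]] := ord_1D l.
    * by rewrite b00; exact: de.
    (* The upper right block is the transpose of Z, which was read off the lower left one: symmetry
       of X identifies the two. *)
    * rewrite b01 mxE de //; apply: dlift_eq tf => //; exact: dehom_sym.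
    * by rewrite b10 mxE; exact: de.
    * by rewrite b11 mxE; exact: de.
  + move=> i j f tf; rewrite TE // /= mxE !projectedE.
    by rewrite /Z /H !mxE.
Qed.

End Fixed.

Theorem Htilde_linear a X X' (T T' : tensor R n) :
  hom_sym_div_free X -> hom_sym_div_free X' -> tdom X = tdom X' ->
  Htilde X T -> Htilde X' T' -> Htilde (tlin a X X') (tlin a T T').
Proof.
move=> hX hX' EX [tT [h [Z [H [dh dZ dH E TE]]]]].
move=> [tT' [h' [Z' [H' [dh' dZ' dH' E' TE']]]]].
have tU : tdom T = affine_dom X by [].
have tU' : tdom T' = affine_dom X by rewrite tT' /affine_dom EX.
have oU := open_affine_dom hX.
rewrite tU in dh dZ dH E TE; rewrite tU' in dh' dZ' dH' E' TE'.
split; first exact: tT.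
exists (a *: h + h'), (\col_i (a *: Z i ord0 + Z' i ord0)),
  (\matrix_(i, j) (a *: H i j + H' i j)); rewrite /= tU; split.
- exact: is_distr_lin.
- by move=> i; rewrite mxE; exact: is_distr_lin.
- by move=> i j; rewrite mxE; exact: is_distr_lin.
- move=> k l f tf; rewrite mxE.
  change (a * X k l f + X' k l f = dlift (block_mx (const_mx (a *: h + h'))
    (\col_i (a *: Z i ord0 + Z' i ord0))^T (\col_i (a *: Z i ord0 + Z' i ord0))
    (\matrix_(i, j) (a *: H i j + H' i j)) k l) f).
  rewrite E // E' //.
  have lin u v : is_distr (affine_dom X) u -> is_distr (affine_dom X) v ->
      a * dlift u f + dlift v f = dlift (a *: u + v) f.
    move=> du dv; have dl := is_distr_lin a du dv.
    by rewrite (dliftE oU du tf) (dliftE oU dv tf) (dliftE oU dl tf).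
  rewrite ?(@ord0_lshift n).
  have [->|[i ->]] := ord_1D k; have [->|[j ->]] := ord_1D l; rewrite ?(@ord0_lshift n).
  + by rewrite !block_mxEul !mxE; exact: lin.
  + by rewrite !block_mxEur !mxE; exact: lin.
  + by rewrite !block_mxEdl !mxE; exact: lin.
  + by rewrite !block_mxEdr !mxE; exact: lin.
- move=> i j f tf; rewrite !mxE.
  change (a * T i j f + T' i j f = projected (a *: h + h')
    (fun j => a *: Z j ord0 + Z' j ord0) (fun i j => a *: H i j + H' i j) i j f).
  rewrite TE // TE' //.
  change (a * projected h (fun j => Z j ord0) H i j f +
    projected h' (fun j => Z' j ord0) H' i j f = projected (a *: h + h')
    (fun j => a *: Z j ord0 + Z' j ord0) (fun i j => a *: H i j + H' i j) i j f).
  rewrite !projectedE.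
  have lE (u v : @functional R n) g : (a *: u + v) g = a * u g + v g by [].
  by rewrite !lE; ring.
Qed.

End Dehomogenize.

(** * The projective action *)

Section Projective.
Context {R : realType} {n : nat}.
Notation mu := (@lebesgue_measure R).
Implicit Types (U : set 'cV[R]_n) (P Q : 'M[R]_(1 + n)) (S T : tensor R n)
  (x y : 'cV[R]_n) (f phi : 'cV[R]_n -> R).

Definition proj_map P y : 'cV[R]_n := affine_part (P *m pt 1 y).

Definition proj_denom P y : R := lam (P *m pt 1 y).

(* [proj_denom P y] times the Jacobian matrix of [proj_map P] at y *)
Definition proj_jac P y i k : R :=
  P (rshift 1 i) (rshift 1 k) - proj_map P y i ord0 * P ord0 (rshift 1 k).

(** The constant c of the overview: the factor |det P| comes from the change of variables in
    [dcomp_lin]. *)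
Definition act_weight P : R := sigma_weight P * `|\det P|.

(** The exponent is positive, so the value is 0 where the denominator vanishes, and with it
    [act_coef]. *)
Definition proj_sign P y : R := Num.sg (proj_denom P y) ^+ n.+1.

Definition act_coef P i j k l y : R :=
  act_weight P * proj_sign P y * (proj_jac P y i k * proj_jac P y j l).

Definition proj_dom P U : set 'cV[R]_n := [set x | cone_over U (invmx P *m pt 1 x)].

Definition act_tensor P S : tensor R n := Tensor (proj_dom P (tdom S))
  (\matrix_(i, j) fun f =>
    \sum_k \sum_l S k l (fun y => act_coef P i j k l y * f (proj_map P y))).

Lemma act_tensorE P S i j f : act_tensor P S i j f =
  \sum_k \sum_l S k l (fun y => act_coef P i j k l y * f (proj_map P y)).
Proof. by rewrite /= mxE. Qed.

Lemma proj_denomK P y : proj_denom P y != 0 ->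
  P *m pt 1 y = proj_denom P y *: pt 1 (proj_map P y).
Proof. exact: pt_affine. Qed.

Lemma proj_invmx P y : P \in unitmx -> proj_denom P y != 0 ->
  invmx P *m pt 1 (proj_map P y) = (proj_denom P y)^-1 *: pt 1 y.
Proof.
move=> Pu d0; have := proj_denomK d0 => /(congr1 (fun w => invmx P *m w)).
rewrite mulmxA mulVmx // mul1mx -scalemxAr => ->.
by rewrite scalerA mulVf // scale1r.
Qed.

Lemma proj_cone P U x : P \in unitmx -> proj_dom P U x ->
  [/\ U (proj_map (invmx P) x), proj_denom P (proj_map (invmx P) x) != 0 &
      proj_map P (proj_map (invmx P) x) = x].
Proof.
move=> Pu [l0 Ux]; split => //.
  rewrite /proj_denom /proj_map /affine_part.
  have -> : P *m pt 1 ((lam (invmx P *m pt 1 x))^-1 *: dsubmx (invmx P *m pt 1 x)) =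
      (lam (invmx P *m pt 1 x))^-1 *: pt 1 x.
    have := pt_affine l0; rewrite /affine_part.
    move=> /(congr1 (fun w => (lam (invmx P *m pt 1 x))^-1 *: (P *m w))).
    rewrite -scalemxAr scalerA mulVf // scale1r => <-.
    by rewrite mulmxA mulmxV // mul1mx.
  by rewrite lam_scale lam_pt mulr1 invr_eq0.
have Pu' : invmx P \in unitmx by rewrite unitmx_inv.
have := proj_invmx Pu' l0; rewrite invmxK => E.
by rewrite {1}/proj_map E affine_part_scale ?invr_eq0 // affine_part_pt invr1 scale1r.
Qed.

Lemma smooth_map_proj_lin P (W : set 'cV[R]_n) : open W ->
  smooth_map W (fun y => P *m pt 1 y).
Proof.
move=> oW; apply: smooth_map_mulmx => //; apply: smooth_map_pt.
  exact: smooth_on_cst.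
exact: smooth_map_id.
Qed.

Lemma open_proj_denom P : open [set y | proj_denom P y != 0].
Proof.
have -> : [set y | proj_denom P y != 0] =
    [set y | setT y /\ [set w : 'cV[R]_(1 + n) | lam w != 0] (P *m pt 1 y)].
  by apply/seteqP; split=> y //= [].
apply: open_preimage; [exact: openT|exact: smooth_map_proj_lin openT|].
exact: open_lam_neq0.
Qed.

Lemma smooth_map_proj P : smooth_map [set y | proj_denom P y != 0] (proj_map P).
Proof.
have oW := @open_proj_denom P; apply: smooth_map_affine => //.
exact: smooth_map_proj_lin.
Qed.

Lemma smooth_on_proj_denom P (W : set 'cV[R]_n) : open W ->
  smooth_on W (proj_denom P).
Proof. by move=> oW; exact: (@smooth_map_proj_lin P W oW ord0). Qed.

Lemma open_proj_dom P U : open U -> open (proj_dom P U).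
Proof.
move=> oU; have -> : proj_dom P U = [set x | setT x /\ cone_over U (invmx P *m pt 1 x)].
  by apply/seteqP; split=> x //= [].
apply: open_preimage; [exact: openT|exact: smooth_map_proj_lin openT|].
exact: open_cone_over.
Qed.

Lemma smooth_on_proj_sign P : smooth_on [set y | proj_denom P y != 0] (proj_sign P).
Proof.
have oW := @open_proj_denom P; apply: smooth_onX => //; apply: smooth_on_sg => //.
exact: smooth_on_proj_denom.
Qed.

Lemma smooth_on_act_coef P i j k l :
  smooth_on [set y | proj_denom P y != 0] (act_coef P i j k l).
Proof.
have oW := @open_proj_denom P.
have sA a b : smooth_on [set y | proj_denom P y != 0] (fun y => proj_jac P y a b).
  apply: smooth_onD => //; first exact: smooth_on_cst.
  apply: smooth_onN => //; apply: smooth_onM => //; last exact: smooth_on_cst.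
  exact: smooth_map_proj.
apply: smooth_onM => //; last exact: smooth_onM.
by apply: smooth_onM => //; [exact: smooth_on_cst|exact: smooth_on_proj_sign].
Qed.

Lemma proj_sign_neq0 P y : proj_sign P y != 0 -> proj_denom P y != 0.
Proof. by apply: contra => /eqP E; rewrite /proj_sign E sgr0 expr0n. Qed.

Lemma act_coef_neq0 P i j k l y : act_coef P i j k l y != 0 -> proj_denom P y != 0.
Proof.
move=> c0; apply: proj_sign_neq0; apply: contraNneq c0 => E.
by rewrite /act_coef E mulr0 mul0r.
Qed.

(** Where its denominator is nonzero, the projective map of P is inverted by that of the inverse
    matrix, which transports compact supports. *)
Lemma proj_proper P U (a : 'cV[R]_n -> R) : P \in unitmx -> open U ->
  smooth_on [set y | proj_denom P y != 0] a ->
  (forall y, a y != 0 -> proj_denom P y != 0) ->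
  proper_weight (proj_dom P U) U a (proj_map P).
Proof.
move=> Pu oU sa a0; pose W := [set y | proj_denom P y != 0 /\ U y].
have oW : open W.
  apply: (open_preimage (q := fun y => y) _ _ oU); first exact: open_proj_denom.
  by apply: smooth_map_id; exact: open_proj_denom.
have WD : W `<=` [set y | proj_denom P y != 0] by move=> y [].
apply: (@proper_weight_image _ _ _ _ _ W _ _ (proj_map (invmx P))) => //.
- by move=> y [].
- exact: smooth_onS sa.
- by apply: smooth_mapS (@smooth_map_proj P).
- by apply: smooth_mapS (@smooth_map_proj (invmx P)) => x [].
- by move=> x /(proj_cone Pu) [].
move=> y /a0 d0 _; rewrite {1}/proj_map proj_invmx // affine_part_scale ?invr_eq0 //.
by rewrite affine_part_pt invr1 scale1r.
Qed.

Lemma test_act_coef P U i j k l f : P \in unitmx -> open U ->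
  test_fun (proj_dom P U) f ->
  test_fun U (fun y => act_coef P i j k l y * f (proj_map P y)).
Proof.
move=> Pu oU; apply: wcomp_test; apply: proj_proper => //.
  exact: smooth_on_act_coef.
exact: act_coef_neq0.
Qed.

Lemma test_proj_sign P U f : P \in unitmx -> open U ->
  test_fun (proj_dom P U) f ->
  test_fun U (fun y => proj_sign P y * f (proj_map P y)).
Proof.
move=> Pu oU; apply: wcomp_test; apply: proj_proper => //.
  exact: smooth_on_proj_sign.
exact: proj_sign_neq0.
Qed.

(** Since P (l, l y) = l d (1, p(y)) with d the denominator, the substitution t = l d leaves
    |d|^(-1) m(1/d) = sg(d)^(n+1) times the integral of the bump. *)
Lemma fiber_section_linear P f y :
  fiber_int (cone_lift (fun w => section_fun f (P *m w))) y =
  proj_sign P y * f (proj_map P y).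
Proof.
set d := proj_denom P y.
have E l : cone_lift (fun w => section_fun f (P *m w)) (pt l y) =
    @jac R n l * (l * d * bump_fun (l * d)) * f (proj_map P y).
  rewrite lift_pt -[l in pt l _]mulr1 pt_scale -scalemxAr /section_fun /tent.
  rewrite lam_scale -/(proj_denom P y) -/d.
  have [->|l0] := eqVneq l 0; first by rewrite !(mul0r, mulr0).
  by rewrite affine_part_scale // mulrA.
rewrite /fiber_int; under [fun _ => _]funext do rewrite E.
have [d0|d0] := eqVneq d 0.
  have -> : (fun l => @jac R n l * (l * d * bump_fun (l * d)) * f (proj_map P y)) =
      (fun=> 0) by apply/funext => l; rewrite d0 !(mulr0, mul0r).
  by rewrite (@Int_integ _ 0 1) // integ0 /proj_sign -/d d0 sgr0 expr0n /= mul0r.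
have di : d^-1 != 0 by rewrite invr_eq0.
pose h (t : R) := @jac R n d^-1 * f (proj_map P y) * bump_fun t.
have ch : continuous h := @continuous_scalef _ _ _ (@bump_continuous R).
have h0 (t : R) : t \notin `[1, 2] -> h t = 0.
  by move=> t12; rewrite /h bump_out // mulr0.
have r12 : 1 < 2 :> R by lra.
have Eh : (fun l => @jac R n l * (l * d * bump_fun (l * d)) * f (proj_map P y)) =
    (fun l => h (l / d^-1)).
  apply/funext => l; rewrite /h invrK -[in RHS](@jac_bump R n) [RHS]mulrAC.
  by congr (_ * _); rewrite [RHS]mulrA -jacM [d^-1 * _]mulrC mulfK.
rewrite Eh (Int_scale di r12 ch h0) (Int_integ h0) integZ; last exact: bump_continuous.
rewrite -(Int_integ (@bump_out R)) Int_bump mulr1 !mulrA; congr (_ * _).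
rewrite -exprS /proj_sign -/d -exprVn invrK -exprMn; congr (_ ^+ _).
by rewrite normfV {2}[d]numEsg mulrCA mulVf ?mulr1 ?normr_eq0.
Qed.

(** The sums run over n indices only, because row 0 and column 0 of Xi are zero. *)
Lemma dehom_Sigma P S k l f : P \in unitmx -> sym_div_free S ->
  test_fun (proj_dom P (tdom S)) f ->
  dehom (Sigma P (Xi S)) k l f = act_weight P * \sum_a \sum_b
    P k (rshift 1 a) * P l (rshift 1 b) *
    S a b (fun y => proj_sign P y * f (proj_map P y)).
Proof.
move=> Pu sS tf; have [[oS dS] _ _] := sS; have hXi := Xi_hom_sym_div_free sS.
have hSig := Sigma_hom_sym_div_free Pu hXi.
have oD := @open_proj_dom P _ oS.
have ts : test_fun (tdom (Sigma P (Xi S))) (section_fun f).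
  apply: test_funS (cone_affine_dom hSig) _; exact: (test_section oD tf).
have tsP : test_fun (cone_over (tdom S)) (fun w => section_fun f (P *m w)).
  exact: (@sigma_test R n P (Xi S) _ Pu (open_cone_over oS) ts).
rewrite /dehom SigmaE // /act_weight -mulrA; congr (_ * _).
rewrite mulr_sumr (@big_split_ord _ _ _ 1 n) /= big_ord1 -ord0_lshift.
rewrite big1 ?add0r; last first.
  by move=> b _; rewrite XiE0l; change (P k ord0 * P l b * (`|\det P| * 0) = 0);
    rewrite !mulr0.
apply: eq_bigr => a _.
rewrite mulr_sumr (@big_split_ord _ _ _ 1 n) /= big_ord1 -ord0_lshift.
have -> : Xi S (rshift 1 a) ord0 (fun w => section_fun f (P *m w)) = 0.
  by rewrite XiE0r.
rewrite !mulr0 add0r; apply: eq_bigr => b _.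
rewrite XiE (dliftE oS (dS a b) tsP) mulrCA; congr (_ * (_ * S a b _)).
by apply/funext => y; exact: fiber_section_linear.
Qed.

Lemma eq_tensor_sym (m : nat) (T T' : tensor R m) : eq_tensor T T' -> eq_tensor T' T.
Proof. by move=> [E H]; split=> // i j f; rewrite -E => tf; rewrite H. Qed.

Lemma eq_tensor_trans (m : nat) (T1 T2 T3 : tensor R m) :
  eq_tensor T1 T2 -> eq_tensor T2 T3 -> eq_tensor T1 T3.
Proof.
move=> [E H] [E' H']; split=> [|i j f tf]; first by rewrite E.
by rewrite H // H' // -E.
Qed.

Lemma sym_div_free_eq (m : nat) (T T' : tensor R m) : eq_tensor T T' ->
  sym_div_free T' -> sym_div_free T.
Proof.
move=> [E H] [[oT dT] sT vT]; rewrite -E in oT; split; [split=> //|..].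
- move=> i j; apply: is_distr_eq (_ : is_distr _ (T' i j)); last by rewrite E.
  by move=> f tf; rewrite H.
- by move=> i j f tf; rewrite !H // sT // -E.
- move=> i f tf; rewrite -[RHS](vT i f) -?E // /DivT !fct_sumE.
  apply: eq_bigr => j _; rewrite /dpart H //; exact: test_fun_pder.
Qed.

Lemma act_tensor_Htilde P S : P \in unitmx -> sym_div_free S ->
  eq_tensor (act_tensor P S) (Htilde_tensor (Sigma P (Xi S))).
Proof.
move=> Pu sS; have [[oS dS] _ _] := sS; have hXi := Xi_hom_sym_div_free sS.
have hSig := Sigma_hom_sym_div_free Pu hXi.
have oD := @open_proj_dom P _ oS.
split=> // i j f tf; rewrite act_tensorE.
have -> : Htilde_tensor (Sigma P (Xi S)) i j f = projected
    (dehom (Sigma P (Xi S)) ord0 ord0)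
    (fun i => dehom (Sigma P (Xi S)) (rshift 1 i) ord0)
    (fun i j => dehom (Sigma P (Xi S)) (rshift 1 i) (rshift 1 j)) i j f.
  by rewrite /= mxE.
rewrite projectedE.
have ti := test_coord i oD tf; have tj := test_coord j oD tf.
have tij : test_fun (proj_dom P (tdom S)) (fun x => x i ord0 * x j ord0 * f x).
  by apply: test_funM => //; apply: smooth_onM => //; exact: smooth_on_coord.
rewrite (dehom_sym hSig (rshift 1 j) ord0) //.
rewrite !(dehom_Sigma _ _ Pu sS) // -!mulrBr -mulrDr.
rewrite -!sumrB -big_split mulr_sumr /=; apply: eq_bigr => a _.
rewrite -!sumrB -big_split mulr_sumr /=; apply: eq_bigr => b _.
pose g c phi : 'cV[R]_n -> R := fun y => c * (proj_sign P y * phi (proj_map P y)).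
have tg c phi : test_fun (proj_dom P (tdom S)) phi -> test_fun (tdom S) (g c phi).
  by move=> tp; apply: test_funZ; exact: test_proj_sign.
have gE c phi : test_fun (proj_dom P (tdom S)) phi ->
    c * S a b (fun y => proj_sign P y * phi (proj_map P y)) = S a b (g c phi).
  by move=> tp; rewrite -(distrZ _ (dS a b)) //; exact: test_proj_sign.
rewrite -!mulrA -!mulNr.
set c1 := P (rshift 1 i) (rshift 1 a); set c2 := P (rshift 1 j) (rshift 1 b).
set c3 := P ord0 (rshift 1 a); set c4 := P ord0 (rshift 1 b).
(* The four terms are the expansion of the product of two factors P_ia - p_i P_0a: multiplication by
   x_i before composing with p becomes multiplication by p_i. *)
transitivity (act_weight P * (S a b (g (c1 * c2) f) +
    S a b (g (- (c3 * c2)) (fun x => x i ord0 * f x)) +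
    S a b (g (- (c1 * c4)) (fun x => x j ord0 * f x)) +
    S a b (g (c3 * c4) (fun x => x i ord0 * x j ord0 * f x)))); last first.
  by rewrite -!gE // /act_weight /sigma_weight; ring.
have t1 := tg (c1 * c2) _ tf; have t2 := tg (- (c3 * c2)) _ ti.
have t3 := tg (- (c1 * c4)) _ tj; have t4 := tg (c3 * c4) _ tij.
rewrite -(distrD (dS a b) t1 t2) -(distrD (dS a b) (test_funD t1 t2) t3).
rewrite -(distrD (dS a b) (test_funD (test_funD t1 t2) t3) t4).
rewrite -(distrZ _ (dS a b)).
  congr (S a b _); apply/funext => y.
  by rewrite /g /act_coef /proj_jac -/c1 -/c2 -/c3 -/c4; ring.
by apply: test_funD => //; apply: test_funD => //; exact: test_funD.
Qed.

Theorem composition_act P S T : P \in unitmx -> sym_div_free S ->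
  composition P S T <-> eq_tensor T (act_tensor P S).
Proof.
move=> Pu sS; have hXi := Xi_hom_sym_div_free sS.
have hSig := Sigma_hom_sym_div_free Pu hXi; have E := act_tensor_Htilde Pu sS.
apply: iff_trans (Htilde_tensorP hSig T) _; split=> H.
  exact: eq_tensor_trans H (eq_tensor_sym E).
exact: eq_tensor_trans H E.
Qed.

Theorem act_sym_div_free P S : P \in unitmx -> sym_div_free S ->
  sym_div_free (act_tensor P S).
Proof.
move=> Pu sS; apply: sym_div_free_eq (act_tensor_Htilde Pu sS) _.
apply: Htilde_tensor_sym_div_free; apply: Sigma_hom_sym_div_free => //.
exact: Xi_hom_sym_div_free.
Qed.

Theorem act_linear P a S S' : tdom S = tdom S' ->
  eq_tensor (act_tensor P (tlin a S S')) (tlin a (act_tensor P S) (act_tensor P S')).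
Proof.
move=> E; split=> // i j f tf; rewrite tlinE.
change (act_tensor P (tlin a S S') i j f =
  a * act_tensor P S i j f + act_tensor P S' i j f).
rewrite !act_tensorE mulr_sumr -big_split /=; apply: eq_bigr => k _.
by rewrite mulr_sumr -big_split /=; apply: eq_bigr => l _; rewrite tlinE.
Qed.

End Projective.

(** * Action laws and positivity *)

Section ActionLaws.
Context {R : realType} {n : nat}.
Implicit Types (U : set 'cV[R]_n) (P Q : 'M[R]_(1 + n)) (S T : tensor R n)
  (x y : 'cV[R]_n) (f phi : 'cV[R]_n -> R).

Lemma cone_overZE U (a : R) (w : 'cV[R]_(1 + n)) : a != 0 ->
  cone_over U (a *: w) <-> cone_over U w.
Proof.
move=> a0; split=> [H|]; last exact: cone_overZ.
have := cone_overZ (_ : a^-1 != 0) H.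
by rewrite scalerA mulVf // scale1r invr_eq0 => /(_ a0).
Qed.

Lemma proj_scale (a : R) P y : a != 0 -> proj_map (a *: P) y = proj_map P y.
Proof. by move=> a0; rewrite /proj_map -scalemxAl affine_part_scale. Qed.

Lemma proj_denom_scale (a : R) P y : proj_denom (a *: P) y = a * proj_denom P y.
Proof. by rewrite /proj_denom -scalemxAl lam_scale. Qed.

Lemma proj_jac_scale (a : R) P y i k : a != 0 ->
  proj_jac (a *: P) y i k = a * proj_jac P y i k.
Proof. by move=> a0; rewrite /proj_jac proj_scale // !mxE; ring. Qed.

(** The power of |a|^(n+1) with exponent -2/(n+1) is a^(-2): this normalization makes the action
    descend to PGL. *)
Lemma act_weight_scale (a : R) P : a != 0 ->
  act_weight (a *: P) * (Num.sg a ^+ n.+1 * (a * a)) = act_weight P.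
Proof.
move=> a0; rewrite /act_weight /sigma_weight detZ normrM normrX.
have na : 0 < `|a| by rewrite normr_gt0.
have -> : (`|a| ^+ (1 + n) * `|\det P|) `^ (- 2 / n.+1%:R) =
    (a * a)^-1 * `|\det P| `^ (- 2 / n.+1%:R).
  rewrite powRM ?exprn_ge0 //; congr (_ * _).
  rewrite -powR_mulrn // -powRrM mulrCA divff ?pnatr_eq0 // mulr1 powRN.
  by rewrite powR_mulrn // real_normK ?num_real // expr2.
have E : (a ^+ (1 + n))^-1 * `|a| ^+ (1 + n) * Num.sg a ^+ n.+1 = 1.
  by rewrite -mulrA -exprMn [`|a| * _]mulrC -numEsg mulVf // expf_neq0.
rewrite invfM.
transitivity ((a ^+ (1 + n))^-1 * `|a| ^+ (1 + n) * Num.sg a ^+ n.+1 *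
  ((a * a)^-1 * (a * a)) * ((\det P)^-1 * `|\det P| `^ (- 2 / n.+1%:R) * `|\det P|)).
  by ring.
by rewrite E mulVf ?mul1r // mulf_neq0.
Qed.

Lemma act_coef_scale (a : R) P i j k l y : a != 0 ->
  act_coef (a *: P) i j k l y = act_coef P i j k l y.
Proof.
move=> a0; rewrite /act_coef /proj_sign proj_denom_scale sgrM exprMn.
by rewrite !proj_jac_scale // -(act_weight_scale P a0); ring.
Qed.

Lemma proj_dom_scale (a : R) P U : a != 0 -> P \in unitmx ->
  proj_dom (a *: P) U = proj_dom P U.
Proof.
move=> a0 Pu; have a1 : a^-1 != 0 by rewrite invr_eq0.
have aP : a *: P \in unitmx by rewrite unitmxZ // unitfE.
apply/seteqP; split=> x; rewrite /proj_dom /= invmxZ // -scalemxAl;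
  by move=> H; apply/(cone_overZE _ _ a1).
Qed.

Lemma act_tensor_scale (a : R) P S : a != 0 -> P \in unitmx ->
  act_tensor (a *: P) S = act_tensor P S.
Proof.
move=> a0 Pu; rewrite /act_tensor proj_dom_scale //; congr Tensor.
apply/matrixP => i j; rewrite !mxE; apply/funext => f.
apply: eq_bigr => k _; apply: eq_bigr => l _; congr (S k l _); apply/funext => y.
by rewrite act_coef_scale // proj_scale.
Qed.

Lemma act_tensor1 S : sym_div_free S -> eq_tensor (act_tensor 1%:M S) S.
Proof.
move=> [[oS dS] _ _].
have p1 y : 1%:M *m pt 1 y = pt 1 y by rewrite mul1mx.
have pj y : proj_map 1%:M y = y by rewrite /proj_map p1 affine_part_pt invr1 scale1r.
split=> [|i j f].
  apply/seteqP; split=> x; rewrite /= /proj_dom /= invmx1 p1.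
    by move=> [_]; rewrite affine_part_pt invr1 scale1r.
  by move=> Sx; split; rewrite ?lam_pt ?oner_neq0 // affine_part_pt invr1 scale1r.
move=> _; rewrite act_tensorE.
have cE k l y : act_coef 1%:M i j k l y = (i == k)%:R * (j == l)%:R.
  rewrite /act_coef /act_weight sigma_weight1 det1 normr1 !mul1r.
  rewrite /proj_sign /proj_denom p1 lam_pt sgr1 expr1n mul1r /proj_jac !mxE.
  by rewrite ![ord0 == _]eq_sym !rshift_neq0 !mulr0n !mulr0 !subr0
    !(inj_eq (@rshift_inj _ _)).
have z k l : S k l (fun y => 0) = 0 by exact: distr0 (dS k l).
rewrite (bigD1 i) //= (bigD1 j) //= !big1 ?addr0.
- congr (S i j _); apply/funext => y; by rewrite cE !eqxx !mul1r pj.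
- move=> k ki; apply: big1 => l _; rewrite -(z k l); congr (S k l _).
  by apply/funext => y; rewrite cE eq_sym (negbTE ki) !mul0r.
- move=> l lj; rewrite -(z i l); congr (S i l _).
  by apply/funext => y; rewrite cE [j == l]eq_sym (negbTE lj) mulr0 mul0r.
Qed.

Lemma proj_mul P Q y : proj_denom Q y != 0 ->
  [/\ proj_denom (P *m Q) y = proj_denom Q y * proj_denom P (proj_map Q y) &
      proj_map (P *m Q) y = proj_map P (proj_map Q y)].
Proof.
move=> d0; have E : P *m Q *m pt 1 y = proj_denom Q y *: (P *m pt 1 (proj_map Q y)).
  by rewrite -mulmxA proj_denomK // scalemxAr.
by rewrite /proj_denom /proj_map E lam_scale affine_part_scale.
Qed.

Lemma row_pt (A : 'M[R]_(1 + n)) i x :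
  (A *m pt 1 x) i ord0 = A i ord0 + \sum_k A i (rshift 1 k) * x k ord0.
Proof.
rewrite mxE (@big_split_ord _ _ _ 1 n) /= big_ord1 -ord0_lshift pt_head mulr1.
by congr (_ + _); apply: eq_bigr => k _; rewrite pt_tail.
Qed.

(** The chain rule for projective maps, multiplied by the denominators, which are themselves
    multiplicative by [proj_mul]. *)
Lemma proj_jac_mul P Q y i a : proj_denom Q y != 0 ->
  proj_denom P (proj_map Q y) != 0 ->
  proj_jac (P *m Q) y i a =
  \sum_k proj_jac P (proj_map Q y) i k * proj_jac Q y k a.
Proof.
move=> dQ dP; have [_ E] := proj_mul P dQ.
rewrite /proj_jac E; set x := proj_map Q y in dP *; set x' := proj_map P x.
(* Row i of P (1, x) = nu (1, x'); it eliminates the sum t1, after which the claim is a ring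
   identity. *)
have Ei : (P *m pt 1 x) (rshift 1 i) ord0 = x' i ord0 * (P *m pt 1 x) ord0 ord0.
  rewrite proj_denomK // [LHS]mxE [X in _ = _ * X]mxE pt_tail pt_head mulr1.
  by rewrite mulrC.
rewrite !row_pt in Ei.
have mE k : (P *m Q) k (rshift 1 a) = P k ord0 * Q ord0 (rshift 1 a) +
    \sum_b P k (rshift 1 b) * Q (rshift 1 b) (rshift 1 a).
  by rewrite mxE (@big_split_ord _ _ _ 1 n) /= big_ord1 -ord0_lshift.
rewrite !mE.
set p0 := P (rshift 1 i) ord0 in Ei *; set p00 := P ord0 ord0 in Ei *.
set q := Q ord0 (rshift 1 a).
set s1 := \sum_b _ * Q _ _; set s2 := \sum_b _ * Q _ _.
set t1 := \sum_k _ * _ in Ei; set t2 := \sum_k _ * _ in Ei.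
have -> : \sum_k (P (rshift 1 i) (rshift 1 k) - x' i ord0 * P ord0 (rshift 1 k)) *
    (Q (rshift 1 k) (rshift 1 a) - x k ord0 * q) =
    s1 - x' i ord0 * s2 - q * (t1 - x' i ord0 * t2).
  rewrite /s1 /s2 /t1 /t2 !mulr_sumr -!sumrB mulr_sumr -sumrB.
  by apply: eq_bigr => k _; ring.
have -> : t1 = x' i ord0 * (p00 + t2) - p0 by rewrite -Ei addrC addKr.
by ring.
Qed.

Lemma act_weight_mul P Q : act_weight (P *m Q) = act_weight P * act_weight Q.
Proof. by rewrite /act_weight sigma_weightM det_mulmx normrM; ring. Qed.

Lemma act_coef_mul P Q i j a b y : proj_denom Q y != 0 ->
  act_coef (P *m Q) i j a b y =
  \sum_k \sum_l act_coef Q k l a b y * act_coef P i j k l (proj_map Q y).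
Proof.
move=> dQ; have [dE _] := proj_mul P dQ.
rewrite /act_coef /proj_sign dE; set x := proj_map Q y.
(* If P sends x to infinity, the sign factors make both sides 0. *)
have [d0|d0] := eqVneq (proj_denom P x) 0.
  rewrite d0 mulr0 sgr0 expr0n /= mulr0 mul0r big1 // => k _.
  by rewrite big1 // => l _; rewrite !(mulr0, mul0r).
rewrite !proj_jac_mul // act_weight_mul sgrM exprMn mulr_suml mulr_sumr.
apply: eq_bigr => k _; rewrite !mulr_sumr; apply: eq_bigr => l _.
by rewrite -/x; ring.
Qed.

(** Acting in two steps also requires the intermediate point, the preimage of x under P, to be
    finite. *)
Lemma proj_dom_mul P Q U : P \in unitmx -> Q \in unitmx ->
  proj_dom P (proj_dom Q U) = proj_dom (P *m Q) U `&` not_from_infinity P.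
Proof.
move=> Pu Qu.
have E x : lam (invmx P *m pt 1 x) != 0 -> invmx (P *m Q) *m pt 1 x =
    lam (invmx P *m pt 1 x) *: (invmx Q *m pt 1 (affine_part (invmx P *m pt 1 x))).
  by move=> l0; rewrite invmx_mul // -mulmxA {1}(pt_affine l0) -scalemxAr.
apply/seteqP; split=> x; rewrite /proj_dom /not_from_infinity /=.
  move=> [l0 H]; split=> //; rewrite E //; exact: cone_overZ.
move=> [H l0]; split=> //; move: H; rewrite E //.
by move/(cone_overZE _ _ l0).
Qed.

Theorem act_tensorM P Q S : P \in unitmx -> Q \in unitmx -> sym_div_free S ->
  eq_tensor (act_tensor P (act_tensor Q S))
    (trestrict (tdom (act_tensor (P *m Q) S) `&` not_from_infinity P)
       (act_tensor (P *m Q) S)).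
Proof.
move=> Pu Qu [[oS dS] _ _]; have dE := proj_dom_mul (tdom S) Pu Qu.
have oQ := @open_proj_dom _ _ Q _ oS.
split=> [|i j f tf]; first exact: dE.
have {}tf : test_fun (proj_dom P (proj_dom Q (tdom S))) f by exact: tf.
change (act_tensor P (act_tensor Q S) i j f = act_tensor (P *m Q) S i j f).
rewrite !act_tensorE.
pose g k l a b y := act_coef Q k l a b y *
  (act_coef P i j k l (proj_map Q y) * f (proj_map P (proj_map Q y))).
have tg k l a b : test_fun (tdom S) (g k l a b).
  exact: (@test_act_coef _ _ Q _ _ _ _ _ _ Qu oS (test_act_coef i j k l Pu oQ tf)).
transitivity (\sum_k \sum_l \sum_a \sum_b S a b (g k l a b)).
  by apply: eq_bigr => k _; apply: eq_bigr => l _; rewrite act_tensorE.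
rewrite sum_exchange4; apply: eq_bigr => a _; apply: eq_bigr => b _.
rewrite -(eq_bigr _ (fun k _ => distr_sum (index_enum _) (dS a b) (fun l => tg k l a b))).
rewrite -(distr_sum _ (dS a b)); last by move=> k; exact: test_fun_sum.
congr (S a b _); apply/funext => y; rewrite /g.
(* If Q sends y to infinity the left side is 0. If P Q sends y to a finite point, that point comes
   from infinity under P, hence lies outside the domain, and f vanishes there. *)
have [dQ|dQ] := eqVneq (proj_denom Q y) 0.
  have zQ k l : act_coef Q k l a b y = 0.
    by apply/eqP; apply: contraT => /act_coef_neq0; rewrite dQ eqxx.
  rewrite big1 => [|k _]; last by rewrite big1 // => l _; rewrite zQ mul0r.
  have [dPQ|dPQ] := eqVneq (proj_denom (P *m Q) y) 0.
    have -> : act_coef (P *m Q) i j a b y = 0.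
      by apply/eqP; apply: contraT => /act_coef_neq0; rewrite dPQ eqxx.
    by rewrite mul0r.
  rewrite (test_fun_off tf) ?mulr0 // dE => -[_]; rewrite /not_from_infinity /=.
  have PQu : P *m Q \in unitmx by rewrite unitmx_mul Pu.
  have := proj_invmx PQu dPQ; rewrite invmx_mul // -mulmxA.
  move=> /(congr1 (mulmx Q)); rewrite [LHS]mulmxA mulmxV // mul1mx -scalemxAr => ->.
  by rewrite lam_scale -/(proj_denom Q y) dQ mulr0 eqxx.
have [_ ->] := proj_mul P dQ; rewrite (act_coef_mul P i j a b dQ) mulr_suml.
apply: eq_bigr => k _; rewrite mulr_suml; apply: eq_bigr => l _.
by rewrite mulrA.
Qed.

Lemma orientation_proj P y : P \in unitmx -> proj_denom P y != 0 ->
  orientation P (proj_map P y) = \det P * (proj_denom P y) ^- n.+1.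
Proof.
by move=> Pu d0; rewrite /orientation proj_invmx // lam_scale lam_pt mulr1 exprVn.
Qed.

Lemma act_weight_sg P : P \in unitmx -> Num.sg (act_weight P) = Num.sg (\det P).
Proof.
move=> Pu; have d0 : \det P != 0 by rewrite -unitfE -unitmxE.
rewrite /act_weight /sigma_weight !sgrM sgrV.
have p : 0 < `|\det P| by rewrite normr_gt0.
by rewrite (gtr0_sg p) (gtr0_sg (powR_gt0 _ p)) !mulr1.
Qed.

Lemma sgr_X (r : R) k : Num.sg (r ^+ k) = Num.sg r ^+ k.
Proof. by elim: k => [|k IH]; rewrite ?sgr1 // !exprS sgrM IH. Qed.

(** Identifies the sign of the scalar in front of the congruence A S A^T, on which positivity
    depends. *)
Lemma act_factor_sg P y : P \in unitmx -> proj_denom P y != 0 ->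
  Num.sg (act_weight P * proj_sign P y) = Num.sg (orientation P (proj_map P y)).
Proof.
move=> Pu d0; rewrite orientation_proj // sgrM act_weight_sg // [RHS]sgrM sgrV.
by rewrite /proj_sign !sgr_X sgr_id.
Qed.

(** Moving P onto the test field gives the field e c sg(nu)^(n+1) A^T (F o p) A, which is positive
    semi-definite when the scalar is nonnegative. The parameter e is 1 or -1 according to the
    orientation treated. *)
Lemma psd_act_signed (e : R) P S (V : set 'cV[R]_n) : P \in unitmx ->
  sym_div_free S -> psd S -> V `<=` proj_dom P (tdom S) ->
  (forall x, V x -> 0 < e * orientation P x) ->
  forall F : 'cV[R]_n -> 'M[R]_n, (forall i j, test_fun V (fun x => F x i j)) ->
  (forall x, psdmx (F x)) ->
  0 <= e * \sum_i \sum_j act_tensor P S i j (fun x => F x i j).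
Proof.
move=> Pu [[oS dS] _ _] pS VD Ve F tF pF.
have tF' i j : test_fun (proj_dom P (tdom S)) (fun x => F x i j).
  exact: test_funS (tF i j).
pose J y : 'M[R]_n := \matrix_(i, k) proj_jac P y i k.
pose c y := e * (act_weight P * proj_sign P y).
pose G y : 'M[R]_n := c y *: ((J y)^T *m F (proj_map P y) *m J y).
have GE y k l : G y k l =
    \sum_i \sum_j e * (act_coef P i j k l y * F (proj_map P y) i j).
  rewrite /G mxE mxE mulr_sumr exchange_big /=; apply: eq_bigr => j _.
  rewrite mxE mulr_suml mulr_sumr; apply: eq_bigr => i _.
  by rewrite !mxE /act_coef /c; ring.
have tt i j k l : test_fun (tdom S) (fun y => act_coef P i j k l y * F (proj_map P y) i j).
  exact: test_act_coef (tF' i j).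
have tt' i j k l := test_funZ e (tt i j k l).
have -> : e * (\sum_i \sum_j act_tensor P S i j (fun x => F x i j)) =
    \sum_k \sum_l S k l (fun y => G y k l).
  rewrite mulr_sumr; under eq_bigr do rewrite mulr_sumr.
  transitivity (\sum_i \sum_j \sum_k \sum_l
      S k l (fun y => e * (act_coef P i j k l y * F (proj_map P y) i j))).
    apply: eq_bigr => i _; apply: eq_bigr => j _; rewrite act_tensorE mulr_sumr.
    apply: eq_bigr => k _; rewrite mulr_sumr; apply: eq_bigr => l _.
    by rewrite (distrZ _ (dS k l)).
  rewrite sum_exchange4; apply: eq_bigr => k _; apply: eq_bigr => l _.
  rewrite -(eq_bigr _ (fun i _ => distr_sum (index_enum _) (dS k l)
    (fun j => tt' i j k l))).
  rewrite -(distr_sum _ (dS k l)); last by move=> i; exact: test_fun_sum.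
  by congr (S k l _); apply/funext => y; rewrite GE.
apply: pS.
  move=> k l; under [fun _ => _]funext do rewrite GE.
  by apply: test_fun_sum => i; apply: test_fun_sum => j.
move=> y; have [Fs Fp] := pF (proj_map P y).
(* The sign of c is controlled only where p(y) lies in V; elsewhere F is zero at p(y). *)
have cF : 0 <= c y \/ F (proj_map P y) = 0.
  have [Vx|Vx] := pselect (V (proj_map P y)); last first.
    by right; apply/matrixP => i j; rewrite mxE (test_fun_off (tF i j)).
  left; have [d0|d0] := eqVneq (proj_denom P y) 0.
    by rewrite /c /proj_sign d0 sgr0 expr0n /= !mulr0.
  apply: ltW; rewrite -sgr_gt0 /c sgrM act_factor_sg // -sgrM sgr_gt0.
  exact: Ve.
have [c0|F0] := cF; last first.
  rewrite /G F0 mulmx0 mul0mx scaler0; split; first by rewrite trmx0.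
  by move=> v; rewrite mulmx0 mul0mx mxE.
split; first by rewrite /G linearZ /= !trmx_mul trmxK Fs mulmxA.
move=> v; rewrite /G -scalemxAr -scalemxAl mxE mulr_ge0 //.
have := Fp (J y *m v); rewrite trmx_mul !mulmxA.
by [].
Qed.

End ActionLaws.

Theorem proposition2p4 (R : realType) (n : nat) (n_gt0 : (0 < n)%N) :
  (* S |-> Xi *)
  [/\ (forall S : tensor R n, sym_div_free S -> hom_sym_div_free (Xi S)) &
      (forall (a : R) (S S' : tensor R n),
         sym_div_free S -> sym_div_free S' -> tdom S = tdom S' ->
         eq_tensor (Xi (tlin a S S')) (tlin a (Xi S) (Xi S')))] /\
  (* Xi |-> Sigma, an action of GL *)
  [/\ (forall (P : GL R (1 + n)) (X : tensor R (1 + n)),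
         hom_sym_div_free X -> hom_sym_div_free (Sigma P X)),
      (forall (P : GL R (1 + n)) (a : R) (X X' : tensor R (1 + n)),
         hom_sym_div_free X -> hom_sym_div_free X' -> tdom X = tdom X' ->
         eq_tensor (Sigma P (tlin a X X')) (tlin a (Sigma P X) (Sigma P X'))),
      (forall X : tensor R (1 + n), hom_sym_div_free X ->
         eq_tensor (Sigma (1%g : GL R (1 + n)) X) X) &
      (forall (P Q : GL R (1 + n)) (X : tensor R (1 + n)),
         hom_sym_div_free X ->
         eq_tensor (Sigma P (Sigma Q X)) (Sigma (P * Q)%g X))] /\
  (* Sigma |-> Htilde *)
  [/\ (forall X : tensor R (1 + n), hom_sym_div_free X ->
         exists2 T : tensor R n, sym_div_free T &
           forall T' : tensor R n, Htilde X T' <-> eq_tensor T' T) &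
      (forall (a : R) (X X' : tensor R (1 + n)) (T T' : tensor R n),
         hom_sym_div_free X -> hom_sym_div_free X' -> tdom X = tdom X' ->
         Htilde X T -> Htilde X' T' ->
         Htilde (tlin a X X') (tlin a T T'))] /\
  (* the composition defines an action of PGL *)
  exists act : PGL R (1 + n) -> tensor R n -> tensor R n,
  [/\ (forall (P : GL R (1 + n)) (S T : tensor R n), sym_div_free S ->
         composition P S T <-> eq_tensor T (act (pgl P) S)),
      (forall (g : PGL R (1 + n)) (S : tensor R n),
         sym_div_free S -> sym_div_free (act g S)) &
      (forall (g : PGL R (1 + n)) (a : R) (S S' : tensor R n),
         sym_div_free S -> sym_div_free S' -> tdom S = tdom S' ->
         eq_tensor (act g (tlin a S S')) (tlin a (act g S) (act g S')))] /\
  [/\ (forall S : tensor R n, sym_div_free S -> eq_tensor (act 1%g S) S),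
      (* S pushed by Q, then by P: points sent to infinity by Q are lost *)
      (forall (P Q : GL R (1 + n)) (S : tensor R n), sym_div_free S ->
         eq_tensor (act (pgl P) (act (pgl Q) S))
           (trestrict
              (tdom (act (pgl P * pgl Q)%g S) `&` not_from_infinity P)
              (act (pgl P * pgl Q)%g S))) &
      (forall (P Q : GL R (1 + n)) (S : tensor R n), sym_div_free S ->
         (forall y, tdom S y -> lam (glmx Q *m pt 1 y) != 0) ->
         eq_tensor (act (pgl P) (act (pgl Q) S)) (act (pgl P * pgl Q)%g S))] /\
  (* preservation of positive semi-definiteness *)
  (forall (P : GL R (1 + n)) (S : tensor R n), sym_div_free S -> psd S ->
     psd (trestrict
            (tdom (act (pgl P) S) `&` [set x | 0 < orientation P x])
            (act (pgl P) S)) /\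
     psd (trestrict
            (tdom (act (pgl P) S) `&` [set x | orientation P x < 0])
            (topp (act (pgl P) S)))).
Proof.
(* The representative chosen in the class of P is a nonzero multiple of P, and [act_tensor] is
   unchanged by it as an equality of records, not merely up to [eq_tensor]. *)
have actE (P : GL R (1 + n)) S :
    act_tensor (glmx (repr (pgl P))) S = act_tensor P S.
  have /eqP/pglP[a a0 ->] := pgl_repr (pgl P).
  by rewrite act_tensor_scale // glmxP.
have pglM (P Q : GL R (1 + n)) : (pgl P * pgl Q)%g = pgl (P * Q)%g.
  exact: pgl_mulE.
have u (P : GL R (1 + n)) : glmx P \in unitmx := glmxP P.
split; first by split; [exact: Xi_hom_sym_div_free|exact: Xi_linear].
split.
  split=> [P X|P a X X' _ _|X _|P Q X _].
  - exact: Sigma_hom_sym_div_free.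
  - exact: Sigma_linear.
  - exact: Sigma1.
  - exact: SigmaM.
split.
  split=> [X hX|a X X' T T']; last exact: Htilde_linear.
  exists (Htilde_tensor X); first exact: Htilde_tensor_sym_div_free.
  exact: Htilde_tensorP.
exists (fun (g : PGL R (1 + n)) S => act_tensor (glmx (repr g)) S); split; [split|split; [split|]].
- by move=> P S T sS; rewrite actE; exact: composition_act.
- by move=> g S; exact: act_sym_div_free.
- by move=> g a S S' _ _; exact: act_linear.
- by move=> S sS; rewrite actE; exact: act_tensor1.
- by move=> P Q S sS; rewrite pglM !actE; exact: act_tensorM.
- move=> P Q S sS HQ; rewrite pglM !actE.
  have [tE eE] := act_tensorM (u P) (u Q) sS.
  (* With v = (P Q)^(-1) (1, x), the vector P^(-1) (1, x) is Q v, a nonzero multiple of Q (1, y)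
     with y in the domain of S, where the denominator of Q is nonzero by hypothesis. *)
  have E : proj_dom (P * Q)%g (tdom S) `<=` not_from_infinity P.
    move=> x; rewrite /proj_dom /=; set v := _ *m pt 1 x => -[l0 Sv].
    have vE : invmx P *m pt 1 x = Q *m v.
      by rewrite /v invmx_mul // !mulmxA mulmxV // mul1mx.
    rewrite /not_from_infinity /= vE (pt_affine l0) -scalemxAr lam_scale.
    by rewrite mulf_neq0 //; exact: HQ.
  split=> //; rewrite tE; apply/seteqP; split=> x; first by case.
  by move=> Hx; split=> //; exact: E.
- move=> P S sS pS; rewrite actE; split=> F tF pF.
    have := @psd_act_signed R n 1 P S _ (u P) sS pS _ _ F tF pF.
    rewrite mul1r; apply; first by move=> x [].
    by move=> x [_ ox]; rewrite mul1r.
  have := @psd_act_signed R n (-1) P S _ (u P) sS pS _ _ F tF pF.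
  have -> : \sum_i \sum_j trestrict
      (tdom (act_tensor P S) `&` [set x | orientation P x < 0])
      (topp (act_tensor P S)) i j (fun x => F x i j) =
    -1 * \sum_i \sum_j act_tensor P S i j (fun x => F x i j).
    rewrite mulN1r -sumrN; apply: eq_bigr => i _; rewrite -sumrN; apply: eq_bigr => j _.
    by rewrite /= mxE.
  apply; first by move=> x [].
  by move=> x [_ ox]; rewrite mulN1r oppr_gt0.
Qed.
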